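(* Let $d\ge 2$ be an integer, $V>0$, $\sigma>0$, and let $n_1,\dots,n_d\ge1$ be integers with $n=n_1\cdots n_d$ and $n_j\ge c_sn^{1/d}$ for all $j=1,\dots,d$, for some $c_s\in(0,1]$. Then there exists a constant $C_d>0$ depending only on $d$ and $c_s$ such that the minimax risk $\mathfrak M_{\mathrm{EM},\sigma,V,d}(n)$ on the lattice design $\mathbb L_{n_1,\dots,n_d}$ satisfies $$\mathfrak M_{\mathrm{EM},\sigma,V,d}(n)\ge C_d\left(\frac{\sigma^2V}{n}\right)^{2/3}\left(\log\left(\frac{V\sqrt n}{\sigma}\right)\right)^{\frac{2(d-2)}{3}}$$ provided $n$ is larger than a positive constant depending only on $d$, $\sigma^2/V^2$ and $c_s$. In the case $d=2$ this bound can be tightened to $$\mathfrak M_{\mathrm{EM},\sigma,V,2}(n)\ge C\left(\frac{\sigma^2V}{n}\right)^{2/3}\log\left(\frac{V\sqrt n}{\sigma}\right)$$ for a positive constant $C$ depending only on $c_s$, again provided $n$ is larger than a positive constant depending only on $\sigma^2/V^2$ and $c_s$.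
   Context: Notation: $\mathbf 0=(0,\dots,0)$, $\mathbf 1=(1,\dots,1)$; $\mathbf a\preceq\mathbf b$ means $a_j\le b_j$ for all $j$; for $\mathbf a\preceq\mathbf b$, $[\mathbf a,\mathbf b]=\prod_j[a_j,b_j]$. Quasi-volume: for $f:[0,1]^d\to\mathbb R$ and distinct $\mathbf a\preceq\mathbf b$ in $[0,1]^d$, $$\Delta(f;[\mathbf a,\mathbf b])=\sum_{j_1=0}^{J_1}\cdots\sum_{j_d=0}^{J_d}(-1)^{j_1+\dots+j_d}f(b_1+j_1(a_1-b_1),\dots,b_d+j_d(a_d-b_d)),$$ where $J_i=1$ if $a_i\ne b_i$ and $J_i=0$ otherwise. Entire monotonicity: $\mathcal F_{\mathrm{EM}}^d$ is the class of all $f:[0,1]^d\to\mathbb R$ with $\Delta(f;[\mathbf a,\mathbf b])\ge 0$ for all $\mathbf a\ne\mathbf b$ in $[0,1]^d$ with $\mathbf a\preceq\mathbf b$. Vitali variation: given univariate partitions $0=x^{(s)}_0<\dots<x^{(s)}_{k_s}=1$, $s=1,\dots,d$, the split they generate is the collection $\mathcal P$ of all rectangles $\prod_{s=1}^d[x^{(s)}_{l_s},x^{(s)}_{l_s+1}]$, $0\le l_s\le k_s-1$. Set $V^{(d)}(f;[0,1]^d)=\sup_{\mathcal P}\sum_{A\in\mathcal P}|\Delta(f;A)|$, supremum over all such splits. HK$\mathbf 0$ variation: for nonempty $S\subseteq\{1,\dots,d\}$ let $f_S:[0,1]^{|S|}\to\mathbb R$ be the restriction of $f$ to $\{\mathbf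 u\in[0,1]^d:u_j=0\ \forall j\notin S\}$, viewed as a function of the coordinates in $S$. Then $V_{\mathrm{HK}\mathbf 0}(f)=\sum_{\varnothing\ne S\subseteq\{1,\dots,d\}}V^{(|S|)}(f_S;[0,1]^{|S|})$. Lattice design: the design points $\mathbf x_1,\dots,\mathbf x_n$ are an enumeration of $\mathbb L_{n_1,\dots,n_d}=\{(i_1/n_1,\dots,i_d/n_d):0\le i_j\le n_j-1,\ j=1,\dots,d\}$. Model: under $f^*$ one observes $y_i=f^*(\mathbf x_i)+\xi_i$, $i=1,\dots,n$, with $\xi_i$ i.i.d. $N(0,\sigma^2)$; $\mathbb E_{f^*}$ is expectation under this model. Loss: $\mathcal L(\hat f,f^* )=\frac1n\sum_{i=1}^n(\hat f(\mathbf x_i)-f^*(\mathbf x_i))^2$. Minimax risk: $\mathfrak M_{\mathrm{EM},\sigma,V,d}(n)=\inf_{\hat f_n}\sup_{f^*\in\mathcal F^d_{\mathrm{EM}}:\,V_{\mathrm{HK}\mathbf 0}(f^* )\le V}\mathbb E_{f^*}\mathcal L(\hat f_n,f^* )$, the infimum being over all estimators $\hat f_n$ based on $y_1,\dots,y_n$. *)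

(* Defs.v *)
From HB Require Import structures.
From mathcomp Require Import all_boot all_order all_algebra.
From mathcomp Require Import all_classical all_reals all_analysis.

Set Implicit Arguments.
Unset Strict Implicit.
Unset Printing Implicit Defensive.

Import Order.TTheory GRing.Theory Num.Theory.
Import numFieldNormedType.Exports.

Local Open Scope classical_set_scope.
Local Open Scope ring_scope.

(* A point of R^I, for a finite set I of coordinates, is a function I -> R. A
   function on [0,1]^I is a total function (I -> R) -> R; every notion below
   only depends on its values on [0,1]^I. *)

Definition unit_cube (R : realType) (I : finType) : set (I -> R) :=
  [set u | forall i, 0 <= u i <= 1].

(* The boolean j i is the summation index j_i, subject to j_i <= J_i. *)
Definition quasi_volume (R : realType) (I : finType) (f : (I -> R) -> R)
    (a b : I -> R) : R :=
  \sum_(j : {ffun I -> bool} | [forall i, (j i <= (a i != b i))%N])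
    (-1) ^+ (\sum_i j i)%N * f (fun i => b i + (j i)%:R * (a i - b i)).

Definition entirely_monotone (R : realType) (I : finType) (f : (I -> R) -> R)
    : Prop :=
  forall a b : I -> R, unit_cube a -> unit_cube b ->
    a <> b -> (forall i, a i <= b i) -> 0 <= quasi_volume f a b.

(* The univariate partition 0 = x_0 < ... < x_k = 1 of coordinate i is encoded
   as in numfun.itv_partition, by the sequence p i = [:: x_1; ...; x_k], so that
   x_m is the m-th entry of 0 :: p i. *)
Definition split_variation (R : realType) (I : finType) (f : (I -> R) -> R)
    (p : I -> seq R) : R :=
  \sum_(l : {dffun forall i : I, 'I_(size (p i))})
    `|quasi_volume f (fun i => nth 1 (0 :: p i) (l i))
                     (fun i => nth 1 (0 :: p i) (l i).+1)|.

Definition vitali_variation (R : realType) (I : finType) (f : (I -> R) -> R)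
    : \bar R :=
  ereal_sup [set (split_variation f p)%:E |
    p in [set p : I -> seq R | forall i, itv_partition 0 1 (p i)]].

Definition face_restriction (R : realType) (I : finType) (f : (I -> R) -> R)
    (S : {set I}) (u : {i : I | i \in S} -> R) : R :=
  f (fun i => oapp u 0 (insub i)).

Definition hk0_variation (R : realType) (I : finType) (f : (I -> R) -> R)
    : \bar R :=
  (\sum_(S : {set I} | S != finset.set0)
    vitali_variation (@face_restriction R I f S))%E.

Definition lattice (R : realType) (d : nat) (ns : 'I_d -> nat)
    : set ('I_d -> R) :=
  [set u | exists i : 'I_d -> nat,
    (forall j, (i j < ns j)%N) /\ u = (fun j => (i j)%:R / (ns j)%:R)].

Arguments lattice R {d} ns.

Definition enumerates (T : Type) (n : nat) (x : 'I_n -> T) (A : set T) : Prop :=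
  injective x /\ range x = A.

Definition mutually_independent (R : realType) (disp : measure_display)
    (Omega : measurableType disp) (P : probability Omega R) (n : nat)
    (X : 'I_n -> {RV P >-> R}) : Prop :=
  forall (J : {set 'I_n}) (A : 'I_n -> set R),
    (forall i, measurable (A i)) ->
    P (\bigcap_(i in [set i | i \in J]) (X i @^-1` A i)) =
    (\prod_(i in J) P (X i @^-1` A i))%E.

(* The parameter sigma of normal_prob is the standard deviation. *)
Definition iid_gaussian_noise (R : realType) (disp : measure_display)
    (Omega : measurableType disp) (P : probability Omega R) (sigma : R)
    (n : nat) (xi : 'I_n -> {RV P >-> R}) : Prop :=
  mutually_independent xi /\
  forall (i : 'I_n) (A : set R), measurable A ->
    distribution P (xi i) A = normal_prob 0 sigma A.

Definition estimator (R : realType) (n d : nat)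
    (fhat : n.-tuple R -> ('I_d -> R) -> R) : Prop :=
  forall u, unit_cube u ->
    measurable_fun [set: n.-tuple R] (fun y => fhat y u).

Definition loss (R : realType) (n d : nat) (x : 'I_n -> 'I_d -> R)
    (g f : ('I_d -> R) -> R) : R :=
  n%:R^-1 * \sum_(i < n) (g (x i) - f (x i)) ^+ 2.

Definition observations (R : realType) (disp : measure_display)
    (Omega : measurableType disp) (P : probability Omega R) (n d : nat)
    (x : 'I_n -> 'I_d -> R) (xi : 'I_n -> {RV P >-> R}) (f : ('I_d -> R) -> R)
    (w : Omega) : n.-tuple R :=
  [tuple f (x i) + xi i w | i < n].

Definition risk (R : realType) (disp : measure_display)
    (Omega : measurableType disp) (P : probability Omega R) (n d : nat)
    (x : 'I_n -> 'I_d -> R) (xi : 'I_n -> {RV P >-> R})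
    (fhat : n.-tuple R -> ('I_d -> R) -> R) (f : ('I_d -> R) -> R) : \bar R :=
  'E_P[fun w => loss x (fhat (observations x xi f w)) f].

Definition minimax_risk_EM (R : realType) (disp : measure_display)
    (Omega : measurableType disp) (P : probability Omega R) (n d : nat)
    (x : 'I_n -> 'I_d -> R) (xi : 'I_n -> {RV P >-> R}) (V : R) : \bar R :=
  ereal_inf
    [set ereal_sup
      [set risk x xi fhat f |
        f in [set f : ('I_d -> R) -> R |
               entirely_monotone f /\ (hk0_variation f <= V%:E)%E]] |
     fhat in [set fhat : n.-tuple R -> ('I_d -> R) -> R | estimator fhat]].

(* Main.v *)
(** Assouad's lemma over sign patterns attached to a family of base-4 boxes.

Cut each axis into N = 4^L blocks and consider densities on the N^d cells. To a
box with base-4 sides attach the product over the coordinates of the function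
taking the values 1, -1, -1, 1 on the four quarters of the side. All boxes have
the same volume but range over many shapes, about t^(d-1) of them. A density
encodes one sign per box, and the distribution function of the corresponding
measure of mass V is entirely monotone with HK0 variation at most V. In one
coordinate, the values of the distribution function are tested against the
third difference pattern 1, -3, 3, -1: these test functions are orthogonal to
each other, and because 1, -1, -1, 1 is orthogonal to affine functions they
recover each sign exactly. Bessel's inequality then bounds the loss from below
by the number of signs guessed incorrectly, and the Gaussian shift formula shows
that a sign cannot be guessed when its flip moves the regression vector by less
than sigma.

The densities have to be nonnegative. For d = 2, a Riesz product over the shapes
keeps them nonnegative with amplitude one, because on a box of a given shape the
other factors split into a function of x and a function of y. For general d the
signs enter linearly with amplitude a ~ t^(-(d+1)/2), and by the exponential
moment bound for random signs all but a sixteenth of the sign patterns give a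
nonnegative density, which Assouad's argument tolerates. *)

Require Import Defs.
From HB Require Import structures.
From mathcomp Require Import all_boot all_order all_algebra.
From mathcomp Require Import ring lra zify.

Set Implicit Arguments.
Unset Strict Implicit.
Unset Printing Implicit Defensive.

Import Order.TTheory GRing.Theory Num.Theory.

Local Open Scope ring_scope.

(** Let T be the number of shapes, 4^(-m) the common relative volume of the boxes, a the amplitude
    and X = n V^2 / sigma^2. Flipping one sign moves the regression vector by a squared distance of
    order a^2 V^2 n 4^(-3m), so a flip stays hidden when a^2 X is at most of order 4^(3m). Each
    wrong sign costs a loss of order a^2 V^2 4^(-3m), and there are T 4^m signs. At the critical m
    the total is of order T a^(2/3) (sigma^2 V / n)^(2/3). With T ~ t^(d-1) and a ~ t^(-(d+1)/2) the
    extra factor is t^(2(d-2)/3); with T ~ t and a = 1 it is t; and t dominates the logarithm. The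
    obstacle is positivity: T signs of size a meet in every cell. In dimension two, shapes of equal
    area are totally ordered, finer in x meaning coarser in y, and this makes the Riesz product
    split on a box. In higher dimension another shape can be finer in two coordinates at once, and
    its factor couples them inside the box. *)

Definition flip (I : finType) (r : I) (e : {ffun I -> bool}) : {ffun I -> bool} :=
  [ffun i => if i == r then ~~ e i else e i].

Lemma sum_ord_mul (V : nmodType) (K m n : nat) (F : nat -> V) :
  K = (m * n)%N -> \sum_(c < K) F c = \sum_(i < m) \sum_(t < n) F (i * n + t)%N.
Proof.
move=> ->; elim: m => [|m IHm]; first by rewrite mul0n !big_ord0.
rewrite big_ord_recr /= -IHm -!(big_mkord xpredT F) mulSn addnC.
rewrite (big_cat_nat (n := m * n)) ?leq_addr//=; congr (_ + _).
rewrite -{1}[(m * n)%N]add0n big_addn addKn big_mkord.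
by apply: eq_bigr => i _; rewrite addnC.
Qed.

Lemma sum_ord_gtn (b t : nat) : (\sum_(i < b) (t < i))%N = (b - t.+1)%N.
Proof.
elim: b => [|b IHb]; first by rewrite big_ord0 sub0n.
by rewrite big_ord_recr /= IHb; lia.
Qed.

(** * Base-4 digits in one coordinate *)

Section digits.
Variables (R : realFieldType) (L : nat).
Local Notation N := (4 ^ L)%N.

(* The cell [c] lies in the [ancestor k c]-th block of length [4 ^ (L - k)], in the
   quarter [digit k c] of it. *)
Definition ancestor (k c : nat) : nat := (c %/ 4 ^ (L - k))%N.
Definition digit (k c : nat) : nat := ((c %/ 4 ^ (L - k.+1)) %% 4)%N.
(** Measurability with respect to the blocks of level [k]. Functions live on all of [nat] because
    lattice indices beyond the grid are inserted later. *)
Definition adapted (k : nat) (f : nat -> R) : Prop :=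
  forall c c', ancestor k c = ancestor k c' -> f c = f c'.

(** The Thue-Morse word of length 4: no shorter pattern of signs has two vanishing moments, which is
    why the base is 4. *)
Definition haar_coef (x : nat) : R := nth 0 [:: 1; -1; -1; 1] x.
(** Third differences have vanishing sum and first moment, so that their tail sums again have sum
    zero over the block. A pattern with vanishing sum only could pick up coarser signs. *)
Definition tdiff_coef (x : nat) : R := nth 0 [:: 1; -3; 3; -1] x.

Lemma normr_haar_coef_digit k c : `|haar_coef (digit k c)| = 1.
Proof.
have : (digit k c < 4)%N by rewrite ltn_mod.
by rewrite /haar_coef; case: (digit k c) => [|[|[|[|]]]]//= _; rewrite ?normrN normr1.
Qed.

Lemma ancestor_ancestor j k c : (j <= k <= L)%N -> ancestor j c = (ancestor k c %/ 4 ^ (k - j))%N.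
Proof.
move=> /andP[jk kL]; rewrite /ancestor -divnMA -expnD; congr (_ %/ 4 ^ _)%N.
lia.
Qed.

Lemma digit_ancestor j k c : (j < k <= L)%N -> digit j c = (ancestor k c %/ 4 ^ (k - j.+1) %% 4)%N.
Proof.
by move=> /andP[jk kL]; rewrite /digit -/(ancestor j.+1 c) (@ancestor_ancestor j.+1 k) ?jk.
Qed.

Lemma adapted_ancestor k (f : nat -> R) : adapted k (fun c => f (ancestor k c)).
Proof. by move=> c c' ->. Qed.

Lemma adapted_cst k a : adapted k (fun=> a).
Proof. by []. Qed.

Lemma adapted_le j k f : (j <= k <= L)%N -> adapted j f -> adapted k f.
Proof. by move=> jk fj c c' cc'; apply: fj; rewrite !(ancestor_ancestor _ jk) cc'. Qed.

Lemma adapted_digit j k (f : nat -> R) : (j < k <= L)%N -> adapted k (fun c => f (digit j c)).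
Proof. by move=> jk c c' cc'; rewrite !(digit_ancestor _ jk) cc'. Qed.

Lemma adaptedM k f g : adapted k f -> adapted k g -> adapted k (fun c => f c * g c).
Proof. by move=> fk gk c c' cc'; rewrite (fk _ _ cc') (gk _ _ cc'). Qed.

Lemma exp4_gt0 n : (0 < 4 ^ n)%N. Proof. by rewrite expn_gt0. Qed.

Lemma block_size k : (k < L)%N -> (4 ^ (L - k) = 4 * 4 ^ (L - k.+1))%N.
Proof. by move=> kL; rewrite -expnS; congr (4 ^ _)%N; lia. Qed.

Lemma ancestor_block k p x t : (k < L)%N -> (x < 4)%N -> (t < 4 ^ (L - k.+1))%N ->
  ancestor k (p * 4 ^ (L - k) + (x * 4 ^ (L - k.+1) + t)) = p.
Proof.
move=> kL x4 tb; rewrite /ancestor divnMDl ?exp4_gt0// divn_small ?addn0//.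
rewrite (block_size kL); apply: (@leq_trans (x.+1 * 4 ^ (L - k.+1))).
  by rewrite mulSn addnC ltn_add2r.
by rewrite leq_mul2r x4 orbT.
Qed.

Lemma preS_block k p x t : (k < L)%N -> (x < 4)%N -> (t < 4 ^ (L - k.+1))%N ->
  ancestor k.+1 (p * 4 ^ (L - k) + (x * 4 ^ (L - k.+1) + t)) = (p * 4 + x)%N.
Proof.
move=> kL x4 tb; rewrite /ancestor (block_size kL) mulnA addnA -mulnDl.
by rewrite divnMDl ?exp4_gt0// divn_small ?addn0.
Qed.

Lemma digit_block k p x t : (k < L)%N -> (x < 4)%N -> (t < 4 ^ (L - k.+1))%N ->
  digit k (p * 4 ^ (L - k) + (x * 4 ^ (L - k.+1) + t)) = x.
Proof.
by move=> kL x4 tb; rewrite /digit -/(ancestor k.+1 _) preS_block// modnMDl modn_small.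
Qed.

Lemma sum_blocks (k : nat) (F : nat -> R) : (k < L)%N ->
  \sum_(c < N) F c = \sum_(p < 4 ^ k) \sum_(x < 4) \sum_(t < 4 ^ (L - k.+1))
    F (p * 4 ^ (L - k) + (x * 4 ^ (L - k.+1) + t))%N.
Proof.
move=> kL; rewrite (@sum_ord_mul _ _ (4 ^ k) (4 ^ (L - k))); last first.
  by rewrite -expnD subnKC// ltnW.
apply: eq_bigr => p _; exact: (sum_ord_mul (fun c => F (_ + c)%N) (block_size kL)).
Qed.

(* The pattern 1, -1, -1, 1 has vanishing moments of order 0 and 1. *)
Lemma sum_haar_coef_affine (k : nat) (f u v : nat -> R) : (k < L)%N ->
  adapted k f -> adapted k u -> adapted k v ->
  \sum_(c < N) f c * haar_coef (digit k c) * (u c + v c * c%:R) = 0.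
Proof.
move=> kL fk uk vk.
rewrite (sum_blocks (fun c => f c * haar_coef (digit k c) * (u c + v c * c%:R)) kL).
apply: big1 => p _.
set q := (p * 4 ^ (L - k))%N; set b := (4 ^ (L - k.+1))%N.
have b0 : (0 < b)%N by exact: exp4_gt0.
(* [T] is the contribution of the first quarter; moving to quarter [x] adds a multiple of [x], so
   the sum over [x] only sees the moments of the pattern. *)
pose T := \sum_(t < b) (u q + v q * (q + t)%:R).
have preq x t : (x < 4)%N -> (t < b)%N -> ancestor k (q + (x * b + t)) = ancestor k q.
  move=> x4 tb; rewrite ancestor_block//.
  by have := @ancestor_block k p 0 0 kL isT b0; rewrite !addn0.
rewrite (eq_bigr (fun x : 'I_4 => f q * haar_coef x * (T + b%:R * b%:R * v q * x%:R))); last first.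
  move=> x _; rewrite /T.
  rewrite (eq_bigr (fun t : 'I_b => f q * haar_coef x * ((u q + v q * (q + t)%:R) + b%:R * v q * x%:R))).
    rewrite -mulr_sumr big_split /= sumr_const card_ord -mulr_natl; ring.
  move=> t _; rewrite digit_block// (fk _ q) ?preq// (uk _ q) ?preq// (vk _ q) ?preq//.
  by rewrite !natrD natrM; ring.
by rewrite !big_ord_recr big_ord0 /=; rewrite /haar_coef /=; ring.
Qed.

(** Under the uniform measure on the cells, the digit at level [k] is uniform and independent of
    everything adapted to level [k]. *)
Lemma sum_adapted_digit (k : nat) (f w : nat -> R) : (k < L)%N -> adapted k f ->
  \sum_(c < N) f c * w (digit k c) = (\sum_(x < 4) w x) / 4 * \sum_(c < N) f c.
Proof.
move=> kL fk; rewrite (sum_blocks (fun c => f c * w (digit k c)) kL) (sum_blocks f kL).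
rewrite mulr_sumr; apply: eq_bigr => p _.
set q := (p * 4 ^ (L - k))%N; set b := (4 ^ (L - k.+1))%N.
have b0 : (0 < b)%N by exact: exp4_gt0.
have fq x t : (x < 4)%N -> (t < b)%N -> f (q + (x * b + t))%N = f q.
  move=> x4 tb; apply: fk; rewrite ancestor_block//.
  by have := @ancestor_block k p 0 0 kL isT b0; rewrite !addn0.
rewrite (eq_bigr (fun x : 'I_4 => w x * (b%:R * f q))); last first.
  move=> x _; rewrite (eq_bigr (fun=> w x * f q)).
    by rewrite sumr_const card_ord -mulr_natl; ring.
  by move=> t _; rewrite fq// digit_block// mulrC.
have -> : \sum_(x < 4) \sum_(t < b) f (q + (x * b + t))%N =
    \sum_(x < 4) b%:R * f q.
  apply: eq_bigr => x _; rewrite (eq_bigr (fun=> f q)); last by move=> t _; rewrite fq.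
  by rewrite sumr_const card_ord mulr_natl.
by rewrite -mulr_suml sumr_const card_ord -[_ *+ 4]mulr_natl; field.
Qed.

Definition in_block (k p c : nat) : R := (ancestor k c == p)%:R.
Definition haar (k p c : nat) : R := in_block k p c * haar_coef (digit k c).
Definition tdiff (k p c : nat) : R := in_block k p c * tdiff_coef (digit k c).

Lemma adapted_in_block k p : adapted k (in_block k p).
Proof. exact: (adapted_ancestor (fun q => (q == p)%:R)). Qed.

Lemma adapted_haar j k p : (j < k <= L)%N -> adapted k (haar j p).
Proof.
move=> jk; apply: adaptedM; last exact: adapted_digit.
by apply: (adapted_le (j := j)); [lia|exact: adapted_in_block].
Qed.

Lemma adapted_tdiff j k p : (j < k <= L)%N -> adapted k (tdiff j p).
Proof.
move=> jk; apply: adaptedM; last exact: adapted_digit.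
by apply: (adapted_le (j := j)); [lia|exact: adapted_in_block].
Qed.

Lemma in_block_idem k p c : in_block k p c * in_block k p c = in_block k p c.
Proof. by rewrite /in_block -natrM mulnb andbb. Qed.

Lemma in_block_neq k p p' c : p != p' -> in_block k p c * in_block k p' c = 0.
Proof.
by move=> pp'; rewrite /in_block; case: eqP => [->|_]; rewrite ?(negbTE pp') ?mulr0 ?mul0r.
Qed.

Lemma sum_in_block (k p : nat) : (k < L)%N -> (p < 4 ^ k)%N ->
  \sum_(c < N) in_block k p c = (4 ^ (L - k))%:R.
Proof.
move=> kL pk; rewrite (sum_blocks (in_block k p) kL) (bigD1 (Ordinal pk))//= [X in _ + X]big1.
  rewrite (eq_bigr (fun=> (4 ^ (L - k.+1))%:R)); last first.
    move=> x _; rewrite (eq_bigr (fun=> 1)) ?sumr_const ?card_ord// => t _.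
    by rewrite /in_block ancestor_block// eqxx.
  by rewrite sumr_const card_ord (block_size kL) natrM mulr_natl addr0.
move=> p' p'p; apply: big1 => x _; apply: big1 => t _.
by rewrite /in_block ancestor_block// (_ : _ == p = false)//; apply/negbTE.
Qed.

(** On different levels, the coarser function is adapted to the finer level, where the pattern sums
    to zero; on the same level the supports are disjoint. *)
Lemma tdiff_orthogonal (k p k' p' : nat) : (k < L)%N -> (k' < L)%N ->
  (k, p) != (k', p') -> \sum_(c < N) tdiff k p c * tdiff k' p' c = 0.
Proof.
move=> kL k'L; wlog : k p k' p' kL k'L / (k <= k')%N.
  move=> W; case: (leqP k k') => [|/ltnW kk'] ne; first exact: W.
  by under eq_bigr do rewrite mulrC; apply: W => //; rewrite eq_sym.
rewrite leq_eqVlt => /predU1P[<-|kk'] ne.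
  apply: big1 => c _; rewrite /tdiff mulrACA in_block_neq ?mul0r//.
  by apply: contra ne => /eqP ->.
rewrite (eq_bigr (fun c : 'I_N => (tdiff k p c * in_block k' p' c) * tdiff_coef (digit k' c))).
  rewrite (sum_adapted_digit tdiff_coef k'L (f := fun c => tdiff k p c * in_block k' p' c)).
    by rewrite !big_ord_recr big_ord0 /=; rewrite /tdiff_coef /=; ring.
  by apply: adaptedM; [apply: adapted_tdiff; lia|exact: adapted_in_block].
by move=> c _; rewrite /tdiff; ring.
Qed.

(** The 5 is the mean of the squares 1, 9, 9, 1. *)
Lemma tdiff_norm (k p : nat) : (k < L)%N -> (p < 4 ^ k)%N ->
  \sum_(c < N) tdiff k p c ^+ 2 = 5 * (4 ^ (L - k))%:R.
Proof.
move=> kL pk.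
rewrite (eq_bigr (fun c : 'I_N => in_block k p c * (fun x => tdiff_coef x ^+ 2) (digit k c))).
  rewrite (sum_adapted_digit (fun x => tdiff_coef x ^+ 2) kL (@adapted_in_block k p)) sum_in_block//; congr (_ * _).
  by rewrite !big_ord_recr big_ord0 /=; rewrite /tdiff_coef /=; field.
by move=> c _; rewrite /tdiff exprMn [in_block _ _ _ ^+ 2]in_block_idem.
Qed.

(** A martingale when each [E j] is adapted to level [j]: every factor then has conditional mean
    one. In dimension two the [E j] carry both the signs and the other coordinate, held fixed. *)
Definition riesz (E : nat -> nat -> R) (k l c : nat) : R :=
  \prod_(k <= j < l) (1 + E j c * haar_coef (digit j c)).

Lemma riesz0 k l c : riesz (fun _ _ => 0) k l c = 1.
Proof. by rewrite /riesz big1// => j _; rewrite mul0r addr0. Qed.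

(* Only the finest factor of the product oscillates below its own level, so the
   factors average out one at a time, starting from the finest. *)
Lemma sum_riesz_affine (E : nat -> nat -> R) (k : nat) (u v : nat -> R) : (k <= L)%N ->
  (forall j, adapted j (E j)) -> adapted k u -> adapted k v ->
  \sum_(c < N) riesz E k L c * (u c + v c * c%:R) = \sum_(c < N) (u c + v c * c%:R).
Proof.
move=> kL Ej uk vk.
suff H l : (k <= l <= L)%N -> \sum_(c < N) riesz E k l c * (u c + v c * c%:R) =
    \sum_(c < N) (u c + v c * c%:R) by apply: H; rewrite kL leqnn.
elim: l => [|l IHl] kl.
  by apply: eq_bigr => c _; rewrite /riesz big_geq// mul1r.
have [kl'|lk] := leqP k l; last first.
  by apply: eq_bigr => c _; rewrite /riesz big_geq// mul1r.
rewrite -IHl ?kl'; last lia.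
(* The summand 1 of the last factor gives the induction hypothesis; the other one oscillates at
   level [l] against a function that is affine on the blocks of that level. *)
rewrite (eq_bigr (fun c : 'I_N => riesz E k l c * (u c + v c * c%:R) +
    (riesz E k l c * E l c) * haar_coef (digit l c) * (u c + v c * c%:R))).
  rewrite big_split /= [X in _ + X](_ : _ = 0) ?addr0//.
  apply: (sum_haar_coef_affine (k := l) (f := fun c => riesz E k l c * E l c)); first lia.
  - apply: adaptedM => //; rewrite /riesz => c c' cc'; apply: eq_big_nat => j jl.
    have hj : (j < l <= L)%N by lia.
    rewrite (@adapted_digit j l haar_coef hj _ _ cc'); congr (1 + _ * _).
    by apply: (adapted_le (j := j) (k := l)) cc'; [lia|].
  - by apply: (adapted_le (j := k)) => //; lia.
  - by apply: (adapted_le (j := k)) => //; lia.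
by move=> c _; rewrite /riesz big_nat_recr//=; ring.
Qed.

Lemma sum_riesz_adapted (E : nat -> nat -> R) (k : nat) (u : nat -> R) : (k <= L)%N ->
  (forall j, adapted j (E j)) -> adapted k u ->
  \sum_(c < N) riesz E k L c * u c = \sum_(c < N) u c.
Proof.
move=> kL Ej uk; have H c : u c + 0 * c%:R = u c by rewrite mul0r addr0.
transitivity (\sum_(c < N) riesz E k L c * (u c + 0 * c%:R)).
  by apply: eq_bigr => c _; rewrite H.
rewrite (sum_riesz_affine (v := fun=> 0) kL Ej uk)//.
by apply: eq_bigr => c _; rewrite H.
Qed.

Lemma riesz_ge0 E k l c : (forall j c, `|E j c| <= 1) -> 0 <= riesz E k l c.
Proof.
move=> E1; apply: prodr_ge0 => j _.
have : `|E j c * haar_coef (digit j c)| <= 1.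
  by rewrite normrM normr_haar_coef_digit mulr1.
by rewrite ler_norml; lra.
Qed.

(** Only an inequality, since a large [x] lies in none of the blocks. *)
Lemma sum_in_block_le1 (k x : nat) : \sum_(q < N) in_block k q x <= 1.
Proof.
have [xN|Nx] := ltnP (ancestor k x) N.
  rewrite (bigD1 (Ordinal xN))//= big1 ?addr0; first by rewrite /in_block eqxx.
  move=> q qx; rewrite /in_block (_ : _ == _ = false)//; apply/negbTE.
  by apply: contra qx => /eqP h; apply/eqP/val_inj.
rewrite big1// => q _; rewrite /in_block (_ : _ == _ = false)//; apply/negbTE.
by rewrite gtn_eqF// (leq_trans (ltn_ord q)).
Qed.

(* Summation by parts: pairing [tdiff] with a distribution function amounts to
   pairing [tdiff_tail] with the density. *)
Definition tdiff_tail (k p c' : nat) : R := \sum_(c < N) (c' < c)%N%:R * tdiff k p c.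

(* [coef_tail x] is the sum of [tdiff_coef y] over y > x. *)
Definition coef_tail (x : nat) : R := nth 0 [:: -1; 2; -1; 0] x.

(** Within the quarter of [c'], the points beyond it number the quarter's length minus one minus the
    offset of [c']; the quarters further right contribute [coef_tail]. Outside the block the pattern
    is counted in full or not at all, and both give 0. *)
Lemma tdiff_tailE k p c' : (k < L)%N -> (p < 4 ^ k)%N ->
  tdiff_tail k p c' = in_block k p c' * ((4 ^ (L - k.+1))%:R * coef_tail (digit k c') +
    tdiff_coef (digit k c') * ((4 ^ (L - k.+1))%:R - 1 -
      (c'%:R - (4 ^ (L - k.+1))%:R * (ancestor k.+1 c')%:R))).
Proof.
move=> kL pk; rewrite /tdiff_tail (sum_blocks (fun c => (c' < c)%N%:R * tdiff k p c) kL).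
set b := (4 ^ (L - k.+1))%N; have b0 : (0 < b)%N by exact: exp4_gt0.
rewrite (bigD1 (Ordinal pk))//= [X in _ + X]big1 ?addr0; last first.
  move=> p' p'p; apply: big1 => x _; apply: big1 => t _.
  by rewrite /tdiff /in_block ancestor_block// (_ : _ == p = false) ?mul0r ?mulr0//; apply/negbTE.
have e4 : (4 ^ (L - k) = 4 * b)%N by exact: block_size.
have c'E : c' = (ancestor k.+1 c' * b + c' %% b)%N by exact: divn_eq.
have preE : ancestor k c' = (ancestor k.+1 c' %/ 4)%N.
  by rewrite (@ancestor_ancestor k k.+1) ?subSnn// leqnSn.
have digE : digit k c' = (ancestor k.+1 c' %% 4)%N by [].
have tb : (c' %% b < b)%N by rewrite ltn_mod.
have qE : ancestor k.+1 c' = (ancestor k c' * 4 + digit k c')%N by rewrite preE digE -divn_eq.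
have x4 : (digit k c' < 4)%N by rewrite digE ltn_mod.
rewrite /in_block.
move: (c' %% b)%N (ancestor k.+1 c') (ancestor k c') (digit k c') c'E tb qE x4
  => t' q p' x' c'E t'b qE x'4 {preE digE}.
pose P x t : nat := (p * (4 * b) + (x * b + t))%N.
transitivity (\sum_(x < 4) \sum_(t < b) (c' < P x t)%N%:R * tdiff_coef x).
  apply: eq_bigr => x _; apply: eq_bigr => t _.
  by rewrite /tdiff /in_block ancestor_block// digit_block// eqxx mul1r /P e4.
have gq0 : \sum_(x < 4) tdiff_coef x = 0.
  by rewrite !big_ord_recr big_ord0 /=; rewrite /tdiff_coef /=; ring.
have sum_tdiff_coef a : \sum_(x < 4) \sum_(t < b) a * tdiff_coef x = 0.
  under eq_bigr do rewrite sumr_const card_ord.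
  by rewrite sumrMnl -mulr_sumr gq0 mulr0 mul0rn.
have lt4b x t : (x < 4)%N -> (t < b)%N -> (x * b + t < 4 * b)%N.
  move=> x4 tb; apply: (@leq_trans (x.+1 * b)); first by rewrite mulSn addnC ltn_add2r.
  by rewrite leq_mul2r x4 orbT.
have c'4 : c' = (p' * (4 * b) + (x' * b + t'))%N by rewrite c'E qE; ring.
have [pp'|] := eqVneq p' p; last first.
  rewrite mul0r neq_ltn => /orP[] lt.
    rewrite -[RHS](sum_tdiff_coef 1); apply: eq_bigr => x _; apply: eq_bigr => t _.
    rewrite (_ : (_ < _)%N)// /P c'4.
    apply: (@leq_trans (p'.+1 * (4 * b))); first by rewrite mulSn addnC ltn_add2r lt4b.
    by rewrite (leq_trans _ (leq_addr _ _))// leq_mul2r lt orbT.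
  rewrite -[RHS](sum_tdiff_coef 0); apply: eq_bigr => x _; apply: eq_bigr => t _.
  rewrite (_ : (_ < _)%N = false)//; apply/negbTE; rewrite -leqNgt /P c'4.
  apply: (@leq_trans (p.+1 * (4 * b))).
    by rewrite mulSn addnC leq_add2r ltnW// lt4b.
  by rewrite (leq_trans _ (leq_addr _ _))// leq_mul2r lt orbT.
have sum_in x : (x < 4)%N -> \sum_(t < b) (c' < P x t)%N%:R * tdiff_coef x =
    tdiff_coef x * (if (x' < x)%N then b%:R else if (x == x')%N then b%:R - 1 - t'%:R else 0).
  move=> x4; rewrite -mulr_suml mulrC; congr (_ * _).
  rewrite /P c'4 pp'; case: ltngtP => xx'.
  - rewrite (eq_bigr (fun=> 1)) ?sumr_const ?card_ord// => t _.
    rewrite ltn_add2l (_ : (_ < _)%N)//.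
    apply: (@leq_trans (x'.+1 * b)); first by rewrite mulSn addnC ltn_add2r.
    by rewrite (leq_trans _ (leq_addr _ _))// leq_mul2r xx' orbT.
  - apply: big1 => t _; rewrite ltn_add2l (_ : (_ < _)%N = false)//.
    apply/negbTE; rewrite -leqNgt; apply: (@leq_trans (x.+1 * b)).
      by rewrite mulSn addnC leq_add2r ltnW.
    by rewrite (leq_trans _ (leq_addr _ _))// leq_mul2r xx' orbT.
  - rewrite xx'; under eq_bigr do rewrite !ltn_add2l.
    by rewrite -natr_sum sum_ord_gtn natrB// -[in LHS]natr1; ring.
have -> : c'%:R - b%:R * q%:R = t'%:R :> R by rewrite c'E natrD natrM; ring.
rewrite mul1r !big_ord_recr big_ord0 /= !sum_in// add0r.
by case: x' x'4 {qE c'4 sum_in} => [|[|[|[|]]]]//= _; rewrite /tdiff_coef /coef_tail /=; ring.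
Qed.

(** [T] is left unspecified: the weights used below are orthogonal to 1, -3, 3, -1, which removes
    it. *)
Lemma sum_digit_tdiff_tail (w : nat -> R) k p : (k < L)%N -> (p < 4 ^ k)%N ->
  exists T, \sum_(c < N) w (digit k c) * tdiff_tail k p c =
    (4 ^ (L - k.+1))%:R ^+ 2 * \sum_(x < 4) w x * coef_tail x + T * \sum_(x < 4) w x * tdiff_coef x.
Proof.
move=> kL pk; rewrite (sum_blocks (fun c => w (digit k c) * tdiff_tail k p c) kL).
set b := (4 ^ (L - k.+1))%N; have b0 : (0 < b)%N by exact: exp4_gt0.
exists (\sum_(t < b) (b%:R - 1 - t%:R)).
rewrite (bigD1 (Ordinal pk))//= [X in _ + X]big1 ?addr0; last first.
  move=> p' p'p; apply: big1 => x _; apply: big1 => t _.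
  by rewrite tdiff_tailE// /in_block ancestor_block// (_ : _ == p = false) ?mul0r ?mulr0//; apply/negbTE.
rewrite !mulr_sumr -big_split /=; apply: eq_bigr => x _.
rewrite (eq_bigr (fun t : 'I_b => w x * coef_tail x * b%:R + w x * tdiff_coef x * (b%:R - 1 - t%:R))).
  rewrite big_split /= -!mulr_sumr sumr_const card_ord -(mulr_natr b%:R); ring.
move=> t _; rewrite tdiff_tailE// /in_block ancestor_block// preS_block// digit_block// eqxx -/b.
by rewrite (block_size kL) -/b !natrD !natrM mulr1n; ring.
Qed.

(** -1 + 2 - 1 + 0 = 0, which expresses the vanishing first moment of the third difference. *)
Lemma sum_tdiff_tail k p : (k < L)%N -> (p < 4 ^ k)%N -> \sum_(c < N) tdiff_tail k p c = 0.
Proof.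
move=> kL pk; have [T] := sum_digit_tdiff_tail (fun=> 1) kL pk.
under eq_bigr do rewrite mul1r.
by move=> ->; rewrite !big_ord_recr !big_ord0 /=; rewrite /tdiff_coef /coef_tail /=; ring.
Qed.

(** The factor -2 is the pairing of 1, -1, -1, 1 with -1, 2, -1, 0; being nonzero, it recovers the
    sign. *)
Lemma sum_haar_coef_tdiff_tail k p : (k < L)%N -> (p < 4 ^ k)%N ->
  \sum_(c < N) haar_coef (digit k c) * tdiff_tail k p c = - 2 * (4 ^ (L - k.+1))%:R ^+ 2.
Proof.
move=> kL pk; have [T ->] := sum_digit_tdiff_tail (haar_coef) kL pk.
by rewrite !big_ord_recr !big_ord0 /=; rewrite /haar_coef /tdiff_coef /coef_tail /=; ring.
Qed.

(** Slope and constant term of [tdiff_tail] on the quarters of a block, both adapted to level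
    [k.+1], as the affine lemmas for [haar_coef] and [riesz] require. *)
Definition tdiff_tail_slope k p c : R := - (in_block k p c * tdiff_coef (digit k c)).
Definition tdiff_tail_const k p c : R := in_block k p c * ((4 ^ (L - k.+1))%:R * coef_tail (digit k c) +
    tdiff_coef (digit k c) * ((4 ^ (L - k.+1))%:R - 1 + (4 ^ (L - k.+1))%:R * (ancestor k.+1 c)%:R)).

Lemma tdiff_tail_affine k p c : (k < L)%N -> (p < 4 ^ k)%N ->
  tdiff_tail k p c = tdiff_tail_const k p c + tdiff_tail_slope k p c * c%:R.
Proof. by move=> kL pk; rewrite tdiff_tailE// /tdiff_tail_const /tdiff_tail_slope; ring. Qed.

Lemma adapted_tdiff_tail_slope j k p : (k < j <= L)%N -> adapted j (tdiff_tail_slope k p).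
Proof. by move=> kj c c' cc'; congr (- _); exact: (adapted_tdiff p kj cc'). Qed.

Lemma adapted_tdiff_tail_const j k p : (k < j <= L)%N -> adapted j (tdiff_tail_const k p).
Proof.
move=> kj c c' cc'; rewrite /tdiff_tail_const.
rewrite (adapted_le (j := k) _ (@adapted_in_block k p) cc'); last lia.
rewrite (adapted_digit (fun x => coef_tail x) kj cc') (adapted_digit (tdiff_coef) kj cc').
by rewrite (adapted_le (j := k.+1) _ (adapted_ancestor (fun q => q%:R : R)) cc').
Qed.

Lemma tdiff_tail_supp k p c : (k < L)%N -> (p < 4 ^ k)%N ->
  tdiff_tail k p c = in_block k p c * tdiff_tail k p c.
Proof. by move=> kL pk; rewrite tdiff_tailE// mulrA in_block_idem. Qed.

(** A finer Haar function meets an affine tail; a coarser one is constant on the block, where the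
    tail sums to zero; another one of the same level has disjoint support. *)
Lemma sum_haar_tdiff_tail k p k' p' : (k < L)%N -> (k' < L)%N -> (p < 4 ^ k)%N ->
  \sum_(c < N) haar k' p' c * tdiff_tail k p c =
  if (k', p') == (k, p) then - 2 * (4 ^ (L - k.+1))%:R ^+ 2 else 0.
Proof.
move=> kL k'L pk; case: eqP => [[-> ->]|].
  rewrite -(sum_haar_coef_tdiff_tail kL pk); apply: eq_bigr => c _.
  by rewrite /haar mulrAC -tdiff_tail_supp// mulrC.
move=> ne; case: (ltngtP k k') => kk'.
- rewrite -[RHS](@sum_haar_coef_affine k' (in_block k' p') (tdiff_tail_const k p) (tdiff_tail_slope k p))//.
  + by apply: eq_bigr => c _; rewrite -tdiff_tail_affine.
  + exact: adapted_in_block.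
  + by apply: adapted_tdiff_tail_const; lia.
  + by apply: adapted_tdiff_tail_slope; lia.
- have preq c : ancestor k c = p -> haar k' p' c = haar k' p' (p * 4 ^ (L - k))%N.
    move=> cp; apply: (adapted_haar p' (k := k)); first lia.
    by rewrite cp /ancestor mulnK// exp4_gt0.
  transitivity (\sum_(c < N) haar k' p' (p * 4 ^ (L - k))%N * tdiff_tail k p c).
    apply: eq_bigr => c _; rewrite tdiff_tail_supp// /in_block; case: eqP => [/preq -> //|_].
    by rewrite mul0r !mulr0.
  by rewrite -mulr_sumr sum_tdiff_tail// mulr0.
- apply: big1 => c _; rewrite tdiff_tail_supp// -kk' /haar mulrACA in_block_neq ?mul0r//.
  by apply/eqP => pp'; apply: ne; rewrite kk' pp'.
Qed.

Section riesz.
Variable E : nat -> nat -> R.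
Hypothesis Ej : forall j, adapted j (E j).

(** The tail is affine on the quarters of the block, so all Riesz factors finer than level [k]
    average out and leave the bare tail. *)
Lemma sum_riesz_tdiff_tail k p : (k < L)%N -> (p < 4 ^ k)%N ->
  \sum_(c < N) riesz E k.+1 L c * tdiff_tail k p c = 0.
Proof.
move=> kL pk; rewrite -[RHS](sum_tdiff_tail kL pk).
under eq_bigr do rewrite tdiff_tail_affine//; under [RHS]eq_bigr do rewrite tdiff_tail_affine//.
apply: (sum_riesz_affine (u := tdiff_tail_const k p) (v := tdiff_tail_slope k p)) => //.
- by apply: adapted_tdiff_tail_const; rewrite ltnSn.
- by apply: adapted_tdiff_tail_slope; rewrite ltnSn.
Qed.

Lemma sum_riesz_haar_coef_tdiff_tail k p : (k < L)%N -> (p < 4 ^ k)%N ->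
  \sum_(c < N) riesz E k.+1 L c * (haar_coef (digit k c) * tdiff_tail k p c) =
  - 2 * (4 ^ (L - k.+1))%:R ^+ 2.
Proof.
move=> kL pk; rewrite -[RHS](sum_haar_coef_tdiff_tail kL pk).
have sgE c : haar_coef (digit k c) * tdiff_tail k p c = haar_coef (digit k c) * tdiff_tail_const k p c +
    (haar_coef (digit k c) * tdiff_tail_slope k p c) * c%:R by rewrite tdiff_tail_affine//; ring.
under eq_bigr do rewrite sgE; under [RHS]eq_bigr do rewrite sgE.
have adk : (k < k.+1 <= L)%N by rewrite ltnSn.
apply: (sum_riesz_affine (u := fun c => haar_coef (digit k c) * tdiff_tail_const k p c)
  (v := fun c => haar_coef (digit k c) * tdiff_tail_slope k p c)) => //.
- by apply: adaptedM; [exact: adapted_digit|exact: adapted_tdiff_tail_const].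
- by apply: adaptedM; [exact: adapted_digit|exact: adapted_tdiff_tail_slope].
Qed.

Lemma sum_riesz_haar k p : (k < L)%N ->
  \sum_(c < N) riesz E k.+1 L c * haar k p c = 0.
Proof.
move=> kL; rewrite sum_riesz_adapted//; last by apply: adapted_haar; rewrite ltnSn.
rewrite (sum_adapted_digit (haar_coef) kL (@adapted_in_block k p)).
by rewrite !big_ord_recr !big_ord0 /=; rewrite /haar_coef /=; ring.
Qed.

(* Outside the block the summand has either been summed completely or not at all. *)
Lemma sum_riesz_haar_ltn k p x : (forall j c, `|E j c| <= 1) -> (k < L)%N -> (p < 4 ^ k)%N ->
  `|\sum_(c < N) (c < x)%N%:R * (riesz E k.+1 L c * haar k p c)| <=
  in_block k p x * (4 ^ (L - k))%:R.
Proof.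
move=> E1 kL pk; rewrite /in_block.
have le_ancestor c c' : (c <= c')%N -> (ancestor k c <= ancestor k c')%N by exact: leq_div2r.
case: eqP => [_|/eqP]; last first.
  rewrite neq_ltn mul0r => /orP[] lt; rewrite normr_le0; apply/eqP.
    apply: big1 => c _; case: ltnP => [/ltnW/le_ancestor cx|_]; last by rewrite mul0r.
    rewrite /haar /in_block (_ : _ == p = false) ?mul0r ?mulr0//.
    by apply/eqP => cp; rewrite cp leqNgt lt in cx.
  rewrite -[RHS](sum_riesz_haar p kL); apply: eq_bigr => c _.
  case: ltnP => [_|/le_ancestor xc]; first by rewrite mul1r.
  rewrite /haar /in_block (_ : _ == p = false) ?mul0r ?mulr0//.
  by apply/eqP => cp; rewrite cp leqNgt lt in xc.
(* Here [x] is in the block. The Haar function has modulus [in_block], and the Riesz product, of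
   conditional mean one, gives the block its number of cells as mass. *)
rewrite mul1r -(sum_in_block kL pk) -(sum_riesz_adapted (k := k.+1) kL Ej); last first.
  by apply: (adapted_le (j := k)); [lia|exact: adapted_in_block].
apply: le_trans (ler_norm_sum _ _ _) _; apply: ler_sum => c _.
have r0 := riesz_ge0 k.+1 L c E1.
rewrite !normrM (ger0_norm r0) mulrCA; apply: ler_wpM2l => //.
rewrite ger0_norm ?ler0n// (@ger0_norm _ (in_block k p c)) ?ler0n//.
rewrite mulrCA ler_piMr ?ler0n//.
by rewrite normr_haar_coef_digit mulr1; case: ltnP.
Qed.

End riesz.

End digits.

(** * Families of densities on the grid *)

Section grid.
Variables (R : realFieldType) (d L : nat) (T : finType) (k : T -> 'I_d -> nat).
Local Notation N := (4 ^ L)%N.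
Local Notation cell := {ffun 'I_d -> 'I_N}.
Local Notation par := (T * cell)%type.

Definition cell_prod (f : 'I_d -> nat -> R) (c : cell) : R := \prod_j f j (c j).

Lemma sum_cell_prod (f : 'I_d -> nat -> R) :
  \sum_(c : cell) cell_prod f c = \prod_j \sum_(x < N) f j x.
Proof. by rewrite (bigA_distr_bigA (fun j (x : 'I_N) => f j x)). Qed.

(** Block indices range over ['I_N] on every level so that parameters form one product type; at
    level [k] only those below [4 ^ k] name a block. *)
Definition valid_par : {set par} := [set r : par | [forall j, (r.2 j < 4 ^ k r.1 j)%N]].
Definition par_tdiff (r : par) (c : cell) : R :=
  cell_prod (fun j => @tdiff R L (k r.1 j) (r.2 j)) c.
Definition par_haar (r : par) (c : cell) : R :=
  cell_prod (fun j => @haar R L (k r.1 j) (r.2 j)) c.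
Definition par_tdiff_tail (r : par) (c : cell) : R :=
  cell_prod (fun j => tdiff_tail R L (k r.1 j) (r.2 j)) c.
(** The inequality is strict because a cell counts once its upper corner, at [(c j).+1], is
    reached. *)
Definition cumul (rho : cell -> R) (C : 'I_d -> nat) : R :=
  \sum_c rho c * \prod_j (c j < C j)%N%:R.

Hypothesis kL : forall s j, (k s j < L)%N.

Lemma valid_parP (r : par) : reflect (forall j, (r.2 j < 4 ^ k r.1 j)%N) (r \in valid_par).
Proof. by rewrite inE; apply: forallP. Qed.

Lemma card_valid_par m : (forall s, \sum_j k s j = m)%N ->
  #|valid_par| = (#|T| * 4 ^ m)%N.
Proof.
move=> km; rewrite -sum1_card.
rewrite (eq_bigl (fun r : par => xpredT r.1 && [forall j, (r.2 j < 4 ^ k r.1 j)%N])); last first.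
  by move=> r; rewrite inE.
rewrite -(pair_big_dep xpredT (fun s (p : cell) => [forall j, (p j < 4 ^ k s j)%N])
  (fun _ _ => 1%N)) /=.
rewrite -sum_nat_const; apply: eq_bigr => s _.
rewrite sum1_card -(km s) expn_sum.
rewrite (eq_card (B := family (fun j => [pred x : 'I_N | (x < 4 ^ k s j)%N]))).
  rewrite card_family foldrE big_image /=; apply: eq_bigr => j _.
  have le4 : (4 ^ k s j <= N)%N by rewrite leq_exp2l// ltnW.
  rewrite -sum1_card (eq_bigl (fun x : 'I_N => x < 4 ^ k s j)%N)//.
  by rewrite (big_ord_narrow le4) sum1_card card_ord.
by move=> p; rewrite !inE; apply: eq_forallb => j; rewrite !inE.
Qed.

Lemma par_neq (r r' : par) : (forall s s', k s =1 k s' -> s = s') -> r != r' ->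
  exists j, (k r.1 j, val (r.2 j)) != (k r'.1 j, val (r'.2 j)).
Proof.
move=> kinj rr'; apply/existsP; apply: contraNT rr'; rewrite negb_exists => /forallP h.
have {}h j : k r.1 j = k r'.1 j /\ r.2 j = r'.2 j.
  by move: (h j); rewrite negbK => /eqP[-> /val_inj ->].
case: r r' h => s p [s' p'] /= h; apply/eqP; congr (_, _).
  by apply: kinj => j; have [] := h j.
by apply/ffunP => j; have [] := h j.
Qed.

Lemma sum_par_tdiff_orthogonal r r' : r != r' ->
  (forall s s', k s =1 k s' -> s = s') ->
  \sum_c par_tdiff r c * par_tdiff r' c = 0.
Proof.
move=> rr' kinj.
have [j jne] := par_neq kinj rr'.
rewrite (eq_bigr (cell_prod (fun j x => @tdiff R L (k r.1 j) (r.2 j) x * tdiff R L (k r'.1 j) (r'.2 j) x))).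
  rewrite sum_cell_prod (bigD1 j)//= tdiff_orthogonal ?mul0r//.
by move=> c _; rewrite /par_tdiff /cell_prod -big_split.
Qed.

Lemma sum_par_tdiff_sqr r : r \in valid_par ->
  \sum_c par_tdiff r c ^+ 2 = \prod_j (5 * (4 ^ (L - k r.1 j))%:R).
Proof.
move=> /valid_parP rv.
rewrite (eq_bigr (cell_prod (fun j x => @tdiff R L (k r.1 j) (r.2 j) x ^+ 2))).
  by rewrite sum_cell_prod; apply: eq_bigr => j _; rewrite tdiff_norm.
by move=> c _; rewrite /par_tdiff /cell_prod -prodrXl.
Qed.

(* What the statistical argument needs to know about a family of densities
   [rho e] on the grid, indexed by vertices [e] of a hypercube. *)
Definition grid_family (rho : {ffun par -> bool} -> cell -> R)
    (good : {set {ffun par -> bool}}) (a : R) : Prop :=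
  [/\ forall e, e \in good -> (forall c, 0 <= rho e c) /\ \sum_c rho e c = (N ^ d)%:R,
      (16 * #|~: good| <= #|{ffun par -> bool}|)%N,
      forall e r, r \in valid_par -> \sum_c rho e c * par_tdiff_tail r c =
        (-1) ^+ e r * a * \prod_j (- 2 * (4 ^ (L - (k r.1 j).+1))%:R ^+ 2) &
      forall e r (C : 'I_d -> nat), r \in valid_par ->
        `|cumul (rho (flip r e)) C - cumul (rho e) C| <=
        2 * a * \prod_j (in_block R L (k r.1 j) (r.2 j) (C j) * (4 ^ (L - k r.1 j))%:R)].

Definition signed_sum (e : {ffun par -> bool}) (c : cell) : R :=
  \sum_r (-1) ^+ e r * par_haar r c.

Lemma signed_sum_flip e r c :
  signed_sum (flip r e) c - signed_sum e c = - 2 * (-1) ^+ e r * par_haar r c.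
Proof.
rewrite /signed_sum (bigD1 r)//= [in X in _ - X](bigD1 r)//= ffunE eqxx.
rewrite (eq_bigr (fun r' => (-1) ^+ e r' * par_haar r' c)) => [|r' /negbTE r'r].
  by case: (e r) => /=; ring.
by rewrite ffunE r'r.
Qed.

Lemma abs_sum_haar_ltn r j (x : nat) : r \in valid_par ->
  `|\sum_(c < N) (c < x)%N%:R * @haar R L (k r.1 j) (r.2 j) c| <=
  in_block R L (k r.1 j) (r.2 j) x * (4 ^ (L - k r.1 j))%:R.
Proof.
move=> /valid_parP rv.
have := @sum_riesz_haar_ltn R L (fun _ _ => 0) (fun j => adapted_cst (k := j) 0)
  (k r.1 j) (r.2 j) x _ (kL r.1 j) (rv j).
under eq_bigr do rewrite riesz0 mul1r.
by apply => *; rewrite normr0.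
Qed.

Definition linear_density (a : R) (e : {ffun par -> bool}) (c : cell) : R :=
  1 + a * signed_sum e c.

Definition linear_good (a : R) : {set {ffun par -> bool}} :=
  [set e | [forall c, `|a * signed_sum e c| <= 1]].

(** As the density is linear in the signs, the test of [r] meets the parameters one by one: for
    [r' != r] some coordinate has another level or block, and its factor is zero. *)
Lemma linear_grid_family a : (0 < d)%N -> 0 <= a ->
  (forall s s', k s =1 k s' -> s = s') ->
  (16 * #|~: linear_good a| <= #|{ffun par -> bool}|)%N ->
  grid_family (linear_density a) (linear_good a) a.
Proof.
move=> d0 a0 kinj bad; pose j0 := Ordinal d0.
have sum_par_haar r : \sum_c par_haar r c = 0.
  rewrite sum_cell_prod (bigD1 j0)//=.
  rewrite (_ : \sum_(x < N) _ = 0) ?mul0r//.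
  rewrite -[RHS](@sum_riesz_haar R L (fun _ _ => 0) (fun j => adapted_cst (k := j) 0)
    (k r.1 j0) (r.2 j0) (kL _ _)).
  by apply: eq_bigr => c _; rewrite riesz0 mul1r.
split => //.
- move=> e; rewrite inE => /forallP ge; split.
    by move=> c; have := ge c; rewrite ler_norml /linear_density; lra.
  rewrite big_split /= -mulr_sumr exchange_big /= [X in _ * X]big1 ?mulr0 ?addr0.
    by rewrite sumr_const card_ffun !card_ord.
  by move=> r _; rewrite -mulr_sumr sum_par_haar mulr0.
- move=> e r rv; have /valid_parP rvj := rv.
  rewrite (eq_bigr (fun c => par_tdiff_tail r c + a * (\sum_r' (-1) ^+ e r' * (par_haar r' c * par_tdiff_tail r c)))).
    rewrite big_split /= -mulr_sumr exchange_big /=.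
    (* The constant density 1 is invisible to the tests, whose tails sum to zero. *)
    rewrite [X in X + _](_ : _ = 0); last first.
      by rewrite sum_cell_prod (bigD1 j0)//= sum_tdiff_tail// mul0r.
    rewrite add0r (bigD1 r)//= [X in _ + X]big1 ?addr0.
      rewrite -mulr_sumr mulrA (mulrC a); congr (_ * _).
      rewrite (eq_bigr (cell_prod (fun j x => @haar R L (k r.1 j) (r.2 j) x *
          tdiff_tail R L (k r.1 j) (r.2 j) x))).
        by rewrite sum_cell_prod; apply: eq_bigr => j _; rewrite sum_haar_tdiff_tail// eqxx.
      by move=> c _; rewrite -big_split.
    move=> r' r'r; rewrite -mulr_sumr.
    have [j jne] := par_neq kinj r'r.
    rewrite (eq_bigr (cell_prod (fun j x => @haar R L (k r'.1 j) (r'.2 j) x *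
          tdiff_tail R L (k r.1 j) (r.2 j) x))).
      by rewrite sum_cell_prod (bigD1 j)//= sum_haar_tdiff_tail// (negbTE jne) mul0r mulr0.
    by move=> c _; rewrite -big_split.
  move=> c _; rewrite /linear_density mulrDl mul1r -mulrA; congr (_ + _ * _).
  by rewrite /signed_sum mulr_suml; apply: eq_bigr => r' _; rewrite mulrA.
- move=> e r C rv.
  have -> : cumul (linear_density a (flip r e)) C - cumul (linear_density a e) C =
      - 2 * (-1) ^+ e r * a * \prod_j \sum_(x < N) (x < C j)%N%:R * @haar R L (k r.1 j) (r.2 j) x.
    rewrite -sumrB.
    rewrite -(sum_cell_prod (fun j x => (x < C j)%N%:R * @haar R L (k r.1 j) (r.2 j) x)).
    rewrite mulr_sumr; apply: eq_bigr => c _.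
    rewrite -mulrBl /linear_density opprD addrACA subrr add0r -mulrBr signed_sum_flip.
    rewrite [X in _ = _ * X](_ : _ = (\prod_j (c j < C j)%N%:R) * par_haar r c).
      by move: (\prod_j _) (par_haar r c) ((-1) ^+ e r) => A B S; ring.
    by rewrite /par_haar /cell_prod -big_split.
  rewrite normrM (_ : `|- 2 * (-1) ^+ e r * a| = 2 * a); last first.
    by rewrite !normrM normrN normrX normrN normr1 expr1n mulr1 !ger0_norm.
  rewrite normr_prod; apply: ler_wpM2l; first by rewrite mulr_ge0.
  by apply: ler_prod => j _; rewrite normr_ge0 abs_sum_haar_ltn.
Qed.

End grid.

Lemma sum_ffun2 (V : nmodType) (J : finType) (f : J -> J -> V) :
  \sum_(c : {ffun 'I_2 -> J}) f (c ord0) (c ord_max) = \sum_x \sum_y f x y.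
Proof.
rewrite pair_big /=.
rewrite (reindex (fun z : J * J => [ffun j : 'I_2 => if j == ord0 then z.1 else z.2])) /=.
  by apply: eq_bigr => -[x y] _; rewrite !ffunE.
exists (fun c => (c ord0, c ord_max)) => [[x y]|c] _; first by rewrite !ffunE.
apply/ffunP => j; rewrite ffunE; case: eqP => [->|] //.
by case: j => -[|[|]] // jlt jne; [case: jne; exact: val_inj|congr (c _); exact: val_inj].
Qed.

Lemma prod_nat_neq (R : comPzSemiRingType) (F : nat -> R) (s n : nat) : (s < n)%N ->
  \prod_(0 <= i < n | i != s) F i = \prod_(0 <= i < s) F i * \prod_(s.+1 <= i < n) F i.
Proof.
move=> sn; rewrite (big_cat_nat (leq0n s) (ltnW sn)) /=; congr (_ * _).
  rewrite big_nat_cond [RHS]big_nat_cond; apply: eq_bigl => i.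
  by case: ltngtP; rewrite ?andbF.
rewrite big_ltn_cond// eqxx /= big_nat_cond [RHS]big_nat_cond; apply: eq_bigl => i.
by case: ltngtP.
Qed.

(** * The Riesz product in dimension two *)

Section riesz_product.
Variables (R : realFieldType) (L' : nat).
Local Notation L := L'.+1.
Local Notation N := (4 ^ L)%N.
Local Notation cell := {ffun 'I_2 -> 'I_N}.
Local Notation par := ('I_L * cell)%type.

Definition level2 (s : 'I_L) (j : 'I_2) : nat := if j == ord0 then s else rev_ord s.

Lemma level2_lt s j : (level2 s j < L)%N.
Proof. by rewrite /level2; case: ifP. Qed.

Lemma sum_level2 s : (\sum_j level2 s j)%N = L'.
Proof. by rewrite !big_ord_recl big_ord0 /level2 /=; have := ltn_ord s; lia. Qed.

Lemma level2_inj s s' : level2 s =1 level2 s' -> s = s'.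
Proof. by move=> /(_ ord0); rewrite /level2 /= => /val_inj. Qed.

Local Notation box := (in_block R L).
Local Notation dgt := (digit L).
Local Notation sgn := (haar_coef R).

(* The sign of the parameter whose box of shape [s] contains (x, y). *)
Definition par_sign (e : {ffun par -> bool}) (s : nat) (x y : nat) : R :=
  \sum_(p : cell) (-1) ^+ e (inord s, p) *
    (box s (p ord0) x * box (L' - s)%N (p ord_max) y).

Definition riesz_factor e s x y : R :=
  1 + par_sign e s x y * (sgn (dgt s x) * sgn (dgt (L' - s)%N y)).

Definition riesz_density e (c : cell) : R :=
  \prod_(s < L) riesz_factor e s (c ord0) (c ord_max).

Lemma par_sign_le1 e s x y : `|par_sign e s x y| <= 1.
Proof.
apply: le_trans (ler_norm_sum _ _ _) _.
rewrite (eq_bigr (fun p : cell => box s (p ord0) x * box (L' - s)%N (p ord_max) y)).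
  rewrite (sum_ffun2 (fun a b : 'I_N => box s a x * box (L' - s)%N b y)).
  rewrite -big_distrlr /= mulr_ile1 ?sum_in_block_le1//.
    by apply: sumr_ge0 => q _; rewrite /in_block ler0n.
  by apply: sumr_ge0 => q _; rewrite /in_block ler0n.
move=> p _; rewrite !normrM normrX normrN normr1 expr1n mul1r.
by rewrite !ger0_norm ?ler0n.
Qed.

Lemma adapted_par_signl e s y : adapted L s (fun x => par_sign e s x y).
Proof.
move=> x x' xx'; apply: eq_bigr => p _.
by rewrite (@adapted_in_block R L s (p ord0) _ _ xx').
Qed.

Lemma adapted_par_signr e s x : adapted L (L' - s)%N (fun y => par_sign e s x y).
Proof.
move=> y y' yy'; apply: eq_bigr => p _.
by rewrite (@adapted_in_block R L (L' - s)%N (p ord_max) _ _ yy').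
Qed.

Lemma haar_coef_le1 k x : `|sgn (dgt k x)| <= 1.
Proof. by rewrite normr_haar_coef_digit. Qed.

Lemma riesz_density_ge0 e c : 0 <= riesz_density e c.
Proof.
apply: prodr_ge0 => s _; rewrite /riesz_factor.
have : `|par_sign e s (c ord0) (c ord_max) *
    (sgn (dgt s (c ord0)) * sgn (dgt (L' - s)%N (c ord_max)))| <= 1.
  by rewrite normrM mulr_ile1 ?par_sign_le1// normrM mulr_ile1 ?haar_coef_le1.
by rewrite ler_norml; lra.
Qed.

(** With the other coordinate frozen, these present a factor as a one-dimensional Riesz factor. Each
    is indexed by the level in its own coordinate, hence the reversed shape in [riesz_coefr], whose
    value 0 past [L'] keeps it adapted on every level. *)
Definition riesz_coefl e y (j x : nat) : R := par_sign e j x y * sgn (dgt (L' - j)%N y).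
Definition riesz_coefr e x (j y : nat) : R :=
  if (j <= L')%N then par_sign e (L' - j)%N x y * sgn (dgt (L' - j)%N x) else 0.

Lemma adapted_riesz_coefl e y j : adapted L j (riesz_coefl e y j).
Proof. by apply: adaptedM; [exact: adapted_par_signl|exact: adapted_cst]. Qed.

Lemma adapted_riesz_coefr e x j : adapted L j (riesz_coefr e x j).
Proof.
rewrite /riesz_coefr; case: leqP => jL; last exact: adapted_cst.
apply: adaptedM; last exact: adapted_cst.
by have := @adapted_par_signr e (L' - j)%N x; rewrite subKn.
Qed.

Lemma riesz_coefl_le1 e y j x : `|riesz_coefl e y j x| <= 1.
Proof. by rewrite normrM mulr_ile1 ?par_sign_le1 ?haar_coef_le1. Qed.

Lemma riesz_coefr_le1 e x j y : `|riesz_coefr e x j y| <= 1.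
Proof.
rewrite /riesz_coefr; case: ifP => _; last by rewrite normr0.
by rewrite normrM mulr_ile1 ?par_sign_le1 ?haar_coef_le1.
Qed.

(** For frozen [y] the density is a Riesz product in [x], of mean one. *)
Lemma sum_riesz_density e : \sum_c riesz_density e c = (N ^ 2)%:R.
Proof.
rewrite (sum_ffun2 (fun x y : 'I_N => \prod_(s < L) riesz_factor e s x y)).
rewrite exchange_big /= (eq_bigr (fun=> N%:R)).
  by rewrite sumr_const card_ord -mulrnA mulnn.
move=> y _; rewrite (eq_bigr (fun x : 'I_N => riesz L (riesz_coefl e y) 0 L x * 1)).
  rewrite (sum_riesz_adapted (u := fun=> 1))//; first by rewrite sumr_const card_ord.
  exact: adapted_riesz_coefl.
move=> x _; rewrite mulr1 /riesz big_mkord; apply: eq_bigr => s _.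
by rewrite /riesz_factor /riesz_coefl; ring.
Qed.

Lemma par_sign_in_block e (s : 'I_L) (p : cell) x y :
  ancestor L s x = p ord0 -> ancestor L (L' - s) y = p ord_max ->
  par_sign e s x y = (-1) ^+ e (s, p).
Proof.
move=> xp yp; rewrite /par_sign (bigD1 p)//= [X in _ + X]big1 ?addr0.
  by rewrite /in_block xp yp !eqxx !mulr1 inord_val.
move=> p' p'p; rewrite /in_block xp yp -natrM mulnb (_ : _ && _ = false) ?mulr0//.
apply: contraNF p'p => /andP[/eqP/val_inj h0 /eqP/val_inj haar].
apply/eqP/ffunP => j; case: j => -[|[|]] // jlt.
  by rewrite (_ : Ordinal jlt = ord0)//; exact: val_inj.
by rewrite (_ : Ordinal jlt = ord_max)//; exact: val_inj.
Qed.

(* On a box of shape [s] the factors of larger index only depend on the first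
   coordinate and those of smaller index only on the second one. *)
Lemma riesz_density_in_block e (s : 'I_L) (p : cell) (x0 y0 x y : nat) :
  ancestor L s x = p ord0 -> ancestor L (L' - s) y = p ord_max ->
  ancestor L s x0 = p ord0 -> ancestor L (L' - s) y0 = p ord_max ->
  \prod_(i < L | i != s) riesz_factor e i x y =
  riesz L (riesz_coefl e y0) s.+1 L x * riesz L (riesz_coefr e x0) (L' - s).+1 L y.
Proof.
move=> xp yp x0p y0p; have sL := ltn_ord s.
rewrite -(big_mkord (fun i => i != s :> nat) (fun i => riesz_factor e i x y)).
rewrite (prod_nat_neq (fun i => riesz_factor e i x y) sL) mulrC; congr (_ * _).
  rewrite /riesz; apply: eq_big_nat => i /andP[si iL].
  rewrite /riesz_factor /riesz_coefl.
  have lt1 : (L' - i <= L' - s <= L)%N by lia.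
  have lt2 : (L' - i < L' - s <= L)%N by lia.
  have yy0 : ancestor L (L' - s) y = ancestor L (L' - s) y0 by rewrite yp y0p.
  rewrite (adapted_le lt1 (@adapted_par_signr e i x) yy0) (adapted_digit sgn lt2 yy0).
  by rewrite (mulrC (sgn _)) mulrA.
have -> : riesz L (riesz_coefr e x0) (L' - s).+1 L y =
    \prod_(0 <= i < s) (1 + riesz_coefr e x0 (L' - i) y * sgn (dgt (L' - i) y)).
  rewrite /riesz big_nat_rev -{1}[(L' - s).+1]add0n big_addn.
  rewrite (_ : (L - (L' - s).+1 = s)%N); last lia.
  apply: eq_big_nat => i /andP[_ si].
  by rewrite (_ : (_ - (i + (L' - s).+1).+1 = L' - i)%N)//; lia.
apply: eq_big_nat => i /andP[_ si].
rewrite /riesz_factor /riesz_coefr leq_subr subKn; last lia.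
have lt1 : (i <= s <= L)%N by lia.
have lt2 : (i < s <= L)%N by lia.
have xx0 : ancestor L s x = ancestor L s x0 by rewrite xp x0p.
by rewrite (adapted_le lt1 (@adapted_par_signl e i y) xx0) (adapted_digit sgn lt2 xx0) mulrA.
Qed.

Lemma in_block_eq0 k p x : ancestor L k x != p -> box k p x = 0.
Proof. by rewrite /in_block => /negbTE ->. Qed.

Lemma par_sign_flip e (s : 'I_L) (p : cell) (i : 'I_L) x y :
  par_sign (flip (s, p) e) i x y = par_sign e i x y -
  (i == s)%:R * (2 * (-1) ^+ e (s, p) * (box s (p ord0) x * box (L' - s) (p ord_max) y)).
Proof.
rewrite /par_sign inord_val; have [->|is_] := eqVneq i s; last first.
  rewrite mul0r subr0; apply: eq_bigr => p' _; rewrite ffunE.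
  by rewrite (_ : (i, p') == (s, p) = false)//; apply: contraNF is_ => /eqP[->].
rewrite mul1r (bigD1 p)//= [in RHS](bigD1 p)//= ffunE eqxx.
rewrite (eq_bigr (fun p' => (-1) ^+ e (s, p') *
    (box s (p' ord0) x * box (L' - s)%N (p' ord_max) y))); last first.
  move=> p' p'p; rewrite ffunE (_ : (s, p') == (s, p) = false)//.
  by apply: contraNF p'p => /eqP[->].
move: (box s _ x * _) (\sum_(_ | _) _) => B S.
by case: (e (s, p)); rewrite /= ?expr1 ?expr0; ring.
Qed.

Lemma prod_ord2 (f : 'I_2 -> R) : \prod_j f j = f ord0 * f ord_max.
Proof.
by rewrite big_ord_recr big_ord1 /=; congr (f _ * _); exact: val_inj.
Qed.

(** Every sign pattern gives a nonnegative density, so no vertex is bad and the amplitude is 1. On a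
    box of shape [s] the density is a product of Riesz products A(x) B(y), times the one factor that
    carries the sign of the box. *)
Lemma riesz_grid_family :
  @grid_family R 2 L 'I_L level2 riesz_density setT 1.
Proof.
have level20 s : level2 s ord0 = s by [].
have level21 s : level2 s ord_max = (L' - s)%N by rewrite /level2 /= subSS.
split.
- move=> e _; split; [exact: riesz_density_ge0|exact: sum_riesz_density].
- by rewrite setCT cards0 muln0.
- move=> e r /valid_parP rv; case: r rv => s p /= rv.
  have := rv ord_max; have := rv ord0; rewrite level20 level21 => p0 p1.
  have sL := ltn_ord s; have s'L : (L' - s < L)%N by lia.
  (* The lower corner of the box serves as the reference point at which coordinates are frozen. *)
  pose x0 := (p ord0 * 4 ^ (L - s))%N; pose y0 := (p ord_max * 4 ^ (L - (L' - s)))%N.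
  have x0p : ancestor L s x0 = p ord0 by rewrite /ancestor mulnK// expn_gt0.
  have y0p : ancestor L (L' - s) y0 = p ord_max by rewrite /ancestor mulnK// expn_gt0.
  pose fx := tdiff_tail R L s (p ord0); pose fy := tdiff_tail R L (L' - s) (p ord_max).
  pose A := riesz L (riesz_coefl e y0) s.+1 L.
  pose B := riesz L (riesz_coefr e x0) (L' - s).+1 L.
  (* Off the box both sides vanish with the tails. On it, the first summand comes from the 1 in the
     factor [s] and is killed by [sum_riesz_tdiff_tail]; the second carries the sign. *)
  have key x y : (\prod_(i < L) riesz_factor e i x y) * (fx x * fy y) =
      (A x * fx x) * (B y * fy y) + (-1) ^+ e (s, p) *
      ((A x * (sgn (dgt s x) * fx x)) * (B y * (sgn (dgt (L' - s) y) * fy y))).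
    have [xp|/in_block_eq0 xp] := eqVneq (ancestor L s x) (p ord0); last first.
      by rewrite /fx (@tdiff_tail_supp _ _ _ _ x sL p0) xp !(mul0r, mulr0) addr0.
    have [yp|/in_block_eq0 yp] := eqVneq (ancestor L (L' - s) y) (p ord_max); last first.
      by rewrite /fy (@tdiff_tail_supp _ _ _ _ y s'L p1) yp !(mul0r, mulr0) addr0.
    rewrite (bigD1 s)//= (riesz_density_in_block e xp yp x0p y0p) -/(A x) -/(B y).
    rewrite /riesz_factor (par_sign_in_block e xp yp).
    by move: (A x) (B y) (fx x) (fy y) (sgn _) (sgn _) (_ ^+ _) => *; ring.
  rewrite mulr1; transitivity (\sum_(c : cell) (fun x y : 'I_N =>
      (\prod_(i < L) riesz_factor e i x y) * (fx x * fy y)) (c ord0) (c ord_max)).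
    by apply: eq_bigr => c _; rewrite /par_tdiff_tail /cell_prod prod_ord2 /= level20 level21.
  rewrite (sum_ffun2 (fun x y : 'I_N =>
      (\prod_(i < L) riesz_factor e i x y) * (fx x * fy y))).
  rewrite (eq_bigr (fun x : 'I_N => (A x * fx x) * (\sum_(y < N) B y * fy y) +
      (-1) ^+ e (s, p) * ((A x * (sgn (dgt s x) * fx x)) *
        (\sum_(y < N) B y * (sgn (dgt (L' - s) y) * fy y))))); last first.
    move=> x _; transitivity (\sum_(y < N) (A x * fx x * (B y * fy y) + (-1) ^+ e (s, p) *
        (A x * (sgn (dgt s x) * fx x) * (B y * (sgn (dgt (L' - s) y) * fy y))))).
      by apply: eq_bigr => y _; exact: key.
    by rewrite big_split /= !mulr_sumr.
  rewrite big_split /= -mulr_suml -mulr_sumr -mulr_suml.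
  have adl := @adapted_riesz_coefl e y0; have adr := @adapted_riesz_coefr e x0.
  rewrite (sum_riesz_tdiff_tail adl sL p0) mul0r add0r.
  rewrite (sum_riesz_haar_coef_tdiff_tail adl sL p0) (sum_riesz_haar_coef_tdiff_tail adr s'L p1).
  by rewrite prod_ord2 level20 level21.
- move=> e r C /valid_parP rv; case: r rv => s p /= rv.
  have := rv ord_max; have := rv ord0; rewrite level20 level21 => p0 p1.
  have sL := ltn_ord s; have s'L : (L' - s < L)%N by lia.
  pose x0 := (p ord0 * 4 ^ (L - s))%N; pose y0 := (p ord_max * 4 ^ (L - (L' - s)))%N.
  have x0p : ancestor L s x0 = p ord0 by rewrite /ancestor mulnK// expn_gt0.
  have y0p : ancestor L (L' - s) y0 = p ord_max by rewrite /ancestor mulnK// expn_gt0.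
  pose hx := @haar R L s (p ord0); pose hy := @haar R L (L' - s) (p ord_max).
  pose A := riesz L (riesz_coefl e y0) s.+1 L.
  pose B := riesz L (riesz_coefr e x0) (L' - s).+1 L.
  (* Only the factor [s] changes, and only on the box of [p]; [A] and [B] contain no sign of shape
     [s]. *)
  have key x y : \prod_(i < L) riesz_factor (flip (s, p) e) i x y -
      \prod_(i < L) riesz_factor e i x y =
      - 2 * (-1) ^+ e (s, p) * ((A x * hx x) * (B y * hy y)).
    rewrite (bigD1 s)//= [in X in _ - X](bigD1 s)//=.
    rewrite (eq_bigr (fun i : 'I_L => riesz_factor e i x y)); last first.
      by move=> i /negbTE is_; rewrite /riesz_factor par_sign_flip is_ mul0r subr0.
    rewrite -mulrBl /riesz_factor par_sign_flip eqxx mul1r /hx /hy /haar.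
    have [xp|/in_block_eq0 xp] := eqVneq (ancestor L s x) (p ord0); last first.
      by rewrite xp !(mul0r, mulr0) subr0 subrr mul0r.
    have [yp|/in_block_eq0 yp] := eqVneq (ancestor L (L' - s) y) (p ord_max); last first.
      by rewrite yp !(mul0r, mulr0) subr0 subrr mul0r.
    rewrite -/(riesz_factor _ _ _ _) (riesz_density_in_block e xp yp x0p y0p) -/(A x) -/(B y).
    rewrite /riesz_factor.
    move: (A x) (B y) (sgn _) (sgn _) (_ ^+ _) (par_sign e s x y) => *.
    by move: (box s _ _) (box (L' - s)%N _ _) => *; ring.
  rewrite /cumul -sumrB.
  rewrite [X in `|X|](_ : _ = \sum_(c : cell) (fun x y : 'I_N => - 2 * (-1) ^+ e (s, p) *
      (((x < C ord0)%N%:R * (A x * hx x)) * ((y < C ord_max)%N%:R * (B y * hy y))))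
      (c ord0) (c ord_max)); last first.
    apply: eq_bigr => c _; rewrite -mulrBl /riesz_density key prod_ord2.
    by move: (A _) (B _) (hx _) (hy _) (_ ^+ _) => *; ring.
  rewrite (sum_ffun2 (fun x y : 'I_N => - 2 * (-1) ^+ e (s, p) *
      (((x < C ord0)%N%:R * (A x * hx x)) * ((y < C ord_max)%N%:R * (B y * hy y))))).
  rewrite [X in `|X|](_ : _ = - 2 * (-1) ^+ e (s, p) *
      ((\sum_(x < N) (x < C ord0)%N%:R * (A x * hx x)) *
       (\sum_(y < N) (y < C ord_max)%N%:R * (B y * hy y)))); last first.
    rewrite mulr_suml mulr_sumr; apply: eq_bigr => x _.
    by rewrite mulr_sumr mulr_sumr.
  rewrite normrM (_ : `|- 2 * (-1) ^+ e (s, p)| = 2 * 1); last first.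
    by rewrite !normrM normrN normrX normrN normr1 expr1n ger0_norm.
  apply: ler_wpM2l; first by rewrite mulr1.
  rewrite prod_ord2 level20 level21 normrM.
  apply: ler_pM => //.
  + apply: sum_riesz_haar_ltn => //; first exact: adapted_riesz_coefl.
    exact: riesz_coefl_le1.
  + apply: sum_riesz_haar_ltn => //; first exact: adapted_riesz_coefr.
    exact: riesz_coefr_le1.
Qed.

End riesz_product.

From mathcomp Require Import all_classical all_reals all_analysis.
From mathcomp Require Import measurable_realfun.

Import numFieldNormedType.Exports.

Local Open Scope classical_set_scope.
Local Open Scope ring_scope.

(** * Gaussian observations *)

Section density.
Context d1 d2 (X : measurableType d1) (Y : measurableType d2) (R : realType).
Variables (mu : {measure set Y -> \bar R}) (nu : {measure set X -> \bar R}).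
Variables (phi : Y -> X) (w : Y -> R).
Hypotheses (mphi : measurable_fun [set: Y] phi) (mw : measurable_fun [set: Y] w).
Hypothesis w0 : forall y, 0 <= w y.
Hypothesis nuE : forall A, measurable A ->
  nu A = (\int[mu]_y (\1_A (phi y) * w y)%:E)%E.

Import HBNNSimple.

(** By simple functions and monotone convergence. With [phi] the identity this is integration
    against a density; with [phi] a random variable it integrates out one factor of a product. *)
Lemma ge0_integral_density (f : X -> R) :
  measurable_fun [set: X] f -> (forall x, 0 <= f x) ->
  (\int[nu]_x (f x)%:E = \int[mu]_y (f (phi y) * w y)%:E)%E.
Proof.
move=> mf f0.
have mEf : measurable_fun [set: X] (fun x => (f x)%:E) by exact/measurable_EFinP.
pose f_ := nnsfun_approx measurableT mEf.
have cvf x : (EFin \o f_^~ x) @ \oo --> (f x)%:E.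
  by apply: cvg_nnsfun_approx => // ? _ /=; rewrite lee_fin.
have ndf : nondecreasing_seq (f_ : (X -> R)^nat) by exact: nd_nnsfun_approx.
have mfphi n : measurable_fun [set: Y] (fun y => f_ n (phi y)).
  exact: measurableT_comp.
transitivity (limn (fun n => \int[nu]_x (f_ n x)%:E)%E).
  rewrite -monotone_convergence//.
  - by apply: eq_integral => x _; apply/esym/cvg_lim => //; exact: cvf.
  - by move=> n; apply/measurable_EFinP.
  - by move=> n x _; rewrite lee_fin.
  - by move=> x _ m n mn; rewrite lee_fin; exact/lefP/ndf.
transitivity (limn (fun n => \int[mu]_y (f_ n (phi y) * w y)%:E)%E); last first.
  rewrite -monotone_convergence//.
  - apply: eq_integral => y _; apply/cvg_lim => //.
    under eq_fun do rewrite EFinM.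
    rewrite EFinM; apply: cvgeZr => //; exact: cvf.
  - by move=> n; apply/measurable_EFinP; exact: measurable_funM.
  - by move=> n x _; rewrite lee_fin mulr_ge0.
  - move=> x _ m n mn; rewrite lee_fin; apply: ler_wpM2r => //.
    exact/lefP/ndf.
congr (limn _); apply/funext => n.
have mpre r : measurable (f_ n @^-1` [set r]) by exact: measurable_sfunP.
transitivity (\sum_(r \in range (f_ n)) (r%:E * nu (f_ n @^-1` [set r])))%E.
  by rewrite integralT_nnsfun sintegralE.
transitivity (\sum_(r \in range (f_ n))
   (\int[mu]_y (r * \1_(f_ n @^-1` [set r]) (phi y) * w y)%:E))%E.
  apply: eq_fsbigr => r; rewrite inE => -[x _ <-].
  rewrite nuE// -ge0_integralZl_EFin//.
  - by apply: eq_integral => y _; rewrite -EFinM mulrA.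
  - by move=> y _; rewrite lee_fin mulr_ge0.
  - apply/measurable_EFinP; apply: measurable_funM => //.
    by apply: measurableT_comp => //; exact: measurable_indic.
rewrite -ge0_integral_fsum//.
- apply: eq_integral => y _.
  by rewrite fsumEFin// -mulr_fsuml -fimfunE.
- move=> r; apply/measurable_EFinP; apply: measurable_funM => //.
  by apply: measurable_funM => //; apply: measurableT_comp => //; exact: measurable_indic.
- move=> r y _; rewrite lee_fin mulr_ge0//.
  have [r0|r0] := leP 0 r; first by rewrite mulr_ge0.
  by rewrite preimage_nnfun0// indic0 mulr0.
Qed.

End density.

Section gaussian_shift.
Context {R : realType}.
Local Notation leb := (@lebesgue_measure R).

Lemma ge0_integral_lebesgue_shift (a : R) (f : R -> R) :
  measurable_fun [set: R] f -> (forall x, 0 <= f x) ->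
  (\int[leb]_x (f (x + a))%:E = \int[leb]_x (f x)%:E)%E.
Proof.
move=> mf f0.
have mD : measurable_fun [set: R] (fun x : R => x + a).
  exact: measurable_funD.
pose D : measurableTypeR R -> measurableTypeR R := fun x => x + a.
transitivity (\int[pushforward leb D]_x (f x)%:E)%E.
  rewrite ge0_integral_pushforward//.
  - exact/measurable_EFinP.
  - by move=> y _; rewrite lee_fin.
apply: eq_measure_integral => //= A mA _; apply/esym.
apply: lebesgue_measure_unique => //= _ [[b c]] _ <-.
rewrite /pushforward /D (_ : _ @^-1` _ = `]b - a, c - a]%classic).
  rewrite !lebesgue_measure_itv/= !lte_fin ltrD2r.
  by case: ifP => // _; rewrite -!EFinD; congr EFin; ring.
by apply/seteqP; split => x /=; rewrite !in_itv/= ltrBlDr lerBrDr.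
Qed.

Lemma ge0_integral_normal_prob (m s : R) (f : R -> R) :
  measurable_fun [set: R] f -> (forall x, 0 <= f x) ->
  (\int[normal_prob m s]_x (f x)%:E =
   \int[leb]_x (f x * normal_pdf m s x)%:E)%E.
Proof.
move=> mf f0.
apply: (@ge0_integral_density _ _ _ _ _ leb (normal_prob m s) id) => //.
- exact: measurable_normal_pdf.
- by move=> x; exact: normal_pdf_ge0.
- move=> A mA; rewrite /normal_prob [LHS]integral_mkcond; apply: eq_integral => x _.
  by rewrite patchE indicE; case: ifP; rewrite ?mul1r ?mul0r.
Qed.

(* The likelihood ratio of N(a, s^2) with respect to N(0, s^2). *)
Definition normal_lr (s a x : R) := expR (a * x / s ^+ 2 - a ^+ 2 / (2 * s ^+ 2)).

Lemma normal_lr_ge0 s a x : 0 <= normal_lr s a x.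
Proof. exact: expR_ge0. Qed.

Lemma measurable_normal_lr s a : measurable_fun [set: R] (normal_lr s a).
Proof.
apply: measurableT_comp => //; apply: measurable_funB => //.
by apply: measurable_funM => //; exact: measurable_funM.
Qed.

Lemma normal_pdf_shift (s a x : R) : s != 0 ->
  normal_pdf 0 s (x - a) = normal_lr s a x * normal_pdf 0 s x.
Proof.
move=> s0; rewrite normal_pdfE//= /normal_fun mulrCA; congr (_ * _).
rewrite -expRD; congr expR; rewrite -mulr_natr; field.
by rewrite s0.
Qed.

(** The Cameron-Martin formula in dimension one. *)
Lemma ge0_integral_normal_lr (s a : R) (f : R -> R) : s != 0 ->
  measurable_fun [set: R] f -> (forall x, 0 <= f x) ->
  (\int[normal_prob 0 s]_x (f x * normal_lr s a x)%:E =
   \int[normal_prob 0 s]_x (f (x + a))%:E)%E.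
Proof.
move=> s0 mf f0.
have mfa : measurable_fun [set: R] (fun x => f (x + a)).
  by apply: measurableT_comp => //; exact: measurable_funD.
rewrite !ge0_integral_normal_prob//; last 2 first.
- by apply: measurable_funM => //; exact: measurable_normal_lr.
- by move=> x; rewrite mulr_ge0// normal_lr_ge0.
rewrite -(@ge0_integral_lebesgue_shift (- a) (fun x => f (x + a) * _)).
- by apply: eq_integral => x _; rewrite subrK normal_pdf_shift// mulrA.
- by apply: measurable_funM => //; exact: measurable_normal_pdf.
- by move=> x; rewrite mulr_ge0// normal_pdf_ge0.
Qed.

(** Squaring the likelihood ratio doubles the shift: it becomes that of N(2a, s^2), up to the factor
    exp(a^2 / s^2). *)
Lemma integral_normal_lr_sqr (s a : R) : s != 0 ->
  (\int[normal_prob 0 s]_x (normal_lr s a x ^+ 2)%:E =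
   (expR (a ^+ 2 / s ^+ 2))%:E)%E.
Proof.
move=> s0.
transitivity (\int[normal_prob 0 s]_x
    ((expR (a ^+ 2 / s ^+ 2))%:E * (1 * normal_lr s (a *+ 2) x)%:E))%E.
  apply: eq_integral => x _; rewrite -EFinM mul1r; congr EFin.
  rewrite expr2 /normal_lr -!expRD; congr expR.
  by rewrite -mulr_natr; field; rewrite s0.
rewrite ge0_integralZl_EFin//; last 2 first.
- by move=> x _; rewrite lee_fin mul1r normal_lr_ge0.
- by apply/measurable_EFinP; apply: measurable_funM => //; exact: measurable_normal_lr.
rewrite (@ge0_integral_normal_lr s (a *+ 2) (fun=> 1))//.
by rewrite integral_cst//= probability_setT !mule1.
Qed.

End gaussian_shift.

(** Independence is given on events, so the factors are turned from indicators into arbitrary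
    functions one at a time. *)
Lemma integral_prod_independent (R : realType) (disp : measure_display)
    (Omega : measurableType disp) (P : probability Omega R) (n : nat)
    (X : 'I_n -> {RV P >-> R}) (psi : 'I_n -> R -> R) (e : 'I_n -> R) :
  mutually_independent X ->
  (forall i, measurable_fun [set: R] (psi i)) ->
  (forall i x, 0 <= psi i x) ->
  (forall i, (\int[P]_w (psi i (X i w))%:E = (e i)%:E)%E) ->
  (\int[P]_w (\prod_i psi i (X i w))%:E = (\prod_i e i)%:E)%E.
Proof.
move=> indX.
have mX (i : 'I_n) (f : R -> R) : measurable_fun [set: R] f ->
    measurable_fun [set: Omega] (fun w => f (X i w)).
  by move=> mf; apply: measurableT_comp.
(* Induction on [k], the number of leading factors that may be arbitrary; those from [k] on are
   indicators. *)
suff H k : forall (psi : 'I_n -> R -> R) (e : 'I_n -> R),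
    (forall i : 'I_n, (k <= i)%N ->
       exists2 A : set R, measurable A & psi i = \1_A) ->
    (forall i, measurable_fun [set: R] (psi i)) ->
    (forall i x, 0 <= psi i x) ->
    (forall i, (\int[P]_w (psi i (X i w))%:E = (e i)%:E)%E) ->
    (\int[P]_w (\prod_i psi i (X i w))%:E = (\prod_i e i)%:E)%E.
  by move=> ? ? ?; apply: (H n) => // i; rewrite leqNgt ltn_ord.
elim: k => [|k IHk] {}psi {}e psiA mpsi psi0 psie.
  have /choice[A AP] : forall i : 'I_n,
      exists A : set R, measurable A /\ psi i = \1_A.
    by move=> i; have [A mA ->] := psiA i isT; exists A.
  have mA i : measurable (A i) by have [] := AP i.
  have mXA i : measurable (X i @^-1` A i).
    by rewrite -[_ @^-1` _]setTI; exact: measurable_funP.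
  transitivity (\int[P]_w (\1_(\bigcap_(i in [set i | i \in [set: 'I_n]%SET])
      (X i @^-1` A i)) w)%:E)%E.
    apply: eq_integral => w _; congr EFin; rewrite indicE; set E := \bigcap_(i in _) _.
    have [wA|wA] := pselect (E w).
      rewrite mem_set//; apply: big1 => i _; have [_ ->] := AP i.
      by rewrite indicE mem_set//; apply: (wA i); rewrite /= finset.inE.
    rewrite memNset//; have [j jA] : exists j, ~ A j (X j w).
      apply: contrapT => /forallNP h; apply: wA => i _ /=.
      by apply: contrapT; exact: h.
    apply/eqP/prodf_eq0; exists j => //=.
    by have [_ ->] := AP j; rewrite indicE memNset// eqxx.
  rewrite integral_indic//; last first.
    apply: fin_bigcap_measurable => // i _; exact: mXA.
  rewrite setIT; apply: (etrans (indX [set: 'I_n]%SET A mA)); rewrite -prodEFin.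
  rewrite (eq_bigl xpredT) => [|i]; last by rewrite finset.inE.
  apply: eq_bigr => i _; rewrite -psie.
  have [_ ->] := AP i.
  rewrite (_ : (fun w => _) = (fun w => (\1_(X i @^-1` A i) w)%:E)).
    by rewrite integral_indic// setIT.
  by apply/funext => w; rewrite !indicE.
have [kn|nk] := ltnP k n; last first.
  by apply: IHk => // i ki; have := ltn_ord i; rewrite ltnNge (leq_trans nk).
pose j := Ordinal kn.
have e0 i : 0 <= e i.
  by rewrite -lee_fin -psie integral_ge0// => w _; rewrite lee_fin.
have C0 : 0 <= \prod_(i | i != j) e i by exact: prodr_ge0.
pose C : {nonneg R} := NngNum C0.
pose w y := \prod_(i | i != j) psi i (X i y).
have mw : measurable_fun [set: Omega] w.
  rewrite (_ : w = fun y => \prod_i (if i != j then psi i (X i y) else 1)); last first.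
    apply/funext => y; exact: big_mkcond.
  by apply: measurable_prod => i _; case: (i != j); [exact: mX|exact: measurable_cst].
have w0 y : 0 <= w y by exact: prodr_ge0.
transitivity (\int[P]_y (psi j (X j y) * w y)%:E)%E.
  by apply: eq_integral => y _; rewrite (bigD1 j).
(* By the induction hypothesis with an indicator in place [j], the law of [X j] weighted by the
   other factors is [C] times its plain law. *)
rewrite -(@ge0_integral_density _ _ _ _ _ P (mscale C (distribution P (X j)))
    (X j) w)//; last first.
  move=> A mA; rewrite /mscale /=.
  have mXA : measurable (X j @^-1` A).
    by rewrite -[_ @^-1` _]setTI; exact: measurable_funP.
  pose psi' i := if i == j then \1_A else psi i.
  pose e' i := if i == j then fine (P (X j @^-1` A)) else e i.
  rewrite [RHS](_ : _ = \int[P]_y (\prod_i psi' i (X i y))%:E)%E; last first.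
    apply: eq_integral => y _; rewrite [in RHS](bigD1 j)//= /psi' eqxx.
    by congr (_ * _)%:E; apply: eq_bigr => i /negbTE ->.
  rewrite (IHk psi' e').
  - rewrite [in RHS](bigD1 j)//= /e' eqxx EFinM fineK ?fin_num_measure//.
    rewrite [RHS]muleC; congr (_ * _)%E; congr EFin => /=.
    by apply: eq_bigr => i /negbTE ->.
  - move=> i ki; rewrite /psi'; case: eqP => [_|ij]; first by exists A.
    apply: psiA; rewrite ltn_neqAle ki andbT; apply/eqP => ki'.
    by apply: ij; exact: val_inj.
  - by move=> i; rewrite /psi'; case: eqP => // _; exact: measurable_indic.
  - by move=> i x; rewrite /psi'; case: eqP.
  - move=> i; rewrite /psi' /e'; case: eqP => // ->.
    rewrite fineK ?fin_num_measure//.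
    rewrite (_ : (fun w => _) = (fun w => (\1_(X j @^-1` A) w)%:E)).
      by rewrite integral_indic// setIT.
    by apply/funext => y; rewrite !indicE.
rewrite ge0_integral_mscale//; last 2 first.
- exact/measurable_EFinP.
- by move=> x _; rewrite lee_fin.
rewrite ge0_integral_distribution//; last 2 first.
- exact/measurable_EFinP.
- by move=> x; rewrite lee_fin.
by rewrite /= psie [in RHS](bigD1 j)//= mulrC EFinM.
Qed.

(** * Change of measure for the noise vector *)

Section tilted_measure.
Context d (T : measurableType d) (R : realType).
Variables (mu : {measure set T -> \bar R}) (f : T -> R).
Hypotheses (mf : measurable_fun [set: T] f) (f0 : forall x, 0 <= f x).

Definition tilted (A : set T) : \bar R := (\int[mu]_(x in A) (f x)%:E)%E.

Let tilted0 : tilted set0 = 0%E. Proof. exact: integral_set0. Qed.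

Let tilted_ge0 A : (0 <= tilted A)%E.
Proof. by apply: integral_ge0 => x _; rewrite lee_fin. Qed.

Let tilted_sigma_additive : semi_sigma_additive tilted.
Proof.
apply: semi_sigma_additive_nng_induced; first exact/measurable_EFinP.
by move=> x; rewrite lee_fin.
Qed.

Definition tilted_measure : {measure set T -> \bar R} :=
  HB.pack_for {measure set T -> \bar R} tilted
    (isMeasure.Build _ _ _ tilted tilted0 tilted_ge0 tilted_sigma_additive).

End tilted_measure.

Lemma measurable_mktuple d (T : measurableType d) (R : realType) (n : nat)
    (F : 'I_n -> T -> R) : (forall i, measurable_fun [set: T] (F i)) ->
  measurable_fun [set: T] (fun w => [tuple F i w | i < n]).
Proof.
move=> mF; apply/measurable_fun_tnthP => i.
rewrite (_ : _ \o _ = F i)//.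
by apply/funext => w /=; rewrite tnth_mktuple.
Qed.

Lemma measurable_box (R : realType) (n : nat) (A : 'I_n -> set R) :
  (forall i, measurable (A i)) -> measurable [set t : n.-tuple R | forall i, A i (tnth t i)].
Proof.
move=> mA; rewrite (_ : [set t | _] = \bigcap_(i in [set: 'I_n])
    ((@tnth _ R ^~ i) @^-1` A i)); last first.
  by apply/seteqP; split => t /= h i; [move=> _; exact: h|exact: (h i I)].
apply: fin_bigcap_measurable => // i _.
rewrite -[_ @^-1` _]setTI; exact: measurable_tnth.
Qed.

Lemma measure_tuple_unique (R : realType) (n : nat)
    (m1 m2 : {measure set (n.-tuple R) -> \bar R}) :
  (m1 setT < +oo)%E ->
  (forall A : 'I_n -> set R, (forall i, measurable (A i)) ->
    m1 [set t | forall i, A i (tnth t i)] = m2 [set t | forall i, A i (tnth t i)]) ->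
  forall B, measurable B -> m1 B = m2 B.
Proof.
move=> m1T m12 B mB.
pose G : set (set (n.-tuple R)) := [set C | exists A : 'I_n -> set R,
  (forall i, measurable (A i)) /\ C = [set t | forall i, A i (tnth t i)]].
have GT : G setT.
  exists (fun=> setT); split => // ; by apply/seteqP; split.
have mG : G `<=` measurable by move=> _ [A [mA ->]]; exact: measurable_box.
apply: (g_sigma_algebra_measure_unique G mG (fun=> setT)) => //.
- by rewrite bigcup_const.
- move=> _ _ [A [mA ->]] [A' [mA' ->]]; exists (fun i => A i `&` A' i); split.
    by move=> i; exact: measurableI.
  apply/seteqP; split => t /=; first by move=> [h h'] i; split.
  by move=> h; split => i; have [] := h i.
- by move=> _ [A [mA ->]]; exact: m12.
- move: B mB; apply: smallest_sub; first exact: smallest_sigma_algebra.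
  apply: (big_ind (fun S : set (set (n.-tuple R)) => S `<=` <<s G >>)).
  + by move=> x [].
  + by move=> S S' hS hS' x [/hS|/hS'].
  move=> i _ _ [A mA <-]; apply: sub_sigma_algebra.
  exists (fun j => if j == i then A else setT); split.
    by move=> j; case: eqP.
  apply/seteqP; split => t /=.
    by move=> [_ At] j; case: eqP => // ->.
  by move=> /(_ i); rewrite eqxx.
Qed.

Section gaussian_noise.
Context (R : realType) (disp : measure_display) (Omega : measurableType disp)
  (P : probability Omega R) (sigma : R) (n : nat) (xi : 'I_n -> {RV P >-> R}).
Hypotheses (s0 : sigma != 0) (noise : iid_gaussian_noise sigma xi).
Variable delta : 'I_n -> R.

Let lr (w : Omega) : R := \prod_i normal_lr sigma (delta i) (xi i w).

Let mxi (i : 'I_n) (f : R -> R) : measurable_fun [set: R] f ->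
  measurable_fun [set: Omega] (fun w => f (xi i w)).
Proof. by move=> mf; apply: measurableT_comp. Qed.

Let mlr : measurable_fun [set: Omega] lr.
Proof. by apply: measurable_prod => i _; apply: mxi; exact: measurable_normal_lr. Qed.

Let lr0 w : 0 <= lr w.
Proof. by apply: prodr_ge0 => i _; exact: normal_lr_ge0. Qed.

Let mtup (a : 'I_n -> R) : measurable_fun [set: Omega]
  (fun w => [tuple a i + xi i w | i < n]).
Proof. by apply: measurable_mktuple => i; exact: measurable_funD. Qed.

Lemma ge0_integral_noise i (f : R -> R) : measurable_fun [set: R] f ->
  (forall x, 0 <= f x) ->
  (\int[P]_w (f (xi i w))%:E = \int[normal_prob 0 sigma]_x (f x)%:E)%E.
Proof.
move=> mf f0; transitivity (\int[distribution P (xi i)]_x (f x)%:E)%E.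
  by rewrite ge0_integral_distribution//; exact/measurable_EFinP.
rewrite ge0_integral_normal_prob//.
apply: (@ge0_integral_density _ _ _ _ _ (@lebesgue_measure R)
  (distribution P (xi i)) id) => //.
- exact: measurable_normal_pdf.
- by move=> x; exact: normal_pdf_ge0.
- move=> A mA; apply: (etrans (noise.2 i A mA)).
  rewrite /normal_prob [LHS]integral_mkcond; apply: eq_integral => x _.
  by rewrite patchE indicE; case: ifP; rewrite ?mul1r ?mul0r.
Qed.

Lemma integral_noise_lr : (\int[P]_w (lr w)%:E = 1)%E.
Proof.
rewrite (@integral_prod_independent _ _ _ _ _ xi
  (fun i => normal_lr sigma (delta i)) (fun=> 1)).
- by rewrite big1.
- exact: noise.1.
- by move=> i; exact: measurable_normal_lr.
- by move=> *; exact: normal_lr_ge0.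
- move=> i; rewrite ge0_integral_noise; last 2 first.
  + exact: measurable_normal_lr.
  + by move=> *; exact: normal_lr_ge0.
  have /= := @ge0_integral_normal_lr R sigma (delta i) (fun=> 1) s0.
  under eq_integral do rewrite mul1r.
  by move=> ->//; rewrite integral_cst//= probability_setT mule1.
Qed.

Lemma integral_noise_lr_sqr : (\int[P]_w (lr w ^+ 2)%:E =
  (expR ((\sum_i delta i ^+ 2) / sigma ^+ 2))%:E)%E.
Proof.
under eq_integral do rewrite /lr -prodrXl.
rewrite (@integral_prod_independent _ _ _ _ _ xi
  (fun i x => normal_lr sigma (delta i) x ^+ 2)
  (fun i => expR (delta i ^+ 2 / sigma ^+ 2))).
- by rewrite -expR_sum mulr_suml.
- exact: noise.1.
- by move=> i; apply: measurable_funX; exact: measurable_normal_lr.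
- by move=> i x; exact: sqr_ge0.
- move=> i.
  rewrite (@ge0_integral_noise i (fun x => normal_lr sigma (delta i) x ^+ 2)).
  + exact: integral_normal_lr_sqr.
  + by apply: measurable_funX; exact: measurable_normal_lr.
  + by move=> x; exact: sqr_ge0.
Qed.

(** Both sides are measures in [B], the left one finite, so boxes suffice. There they agree by
    independence and the one-dimensional shift formula. *)
Lemma noise_shift (B : set (n.-tuple R)) : measurable B ->
  P ((fun w => [tuple delta i + xi i w | i < n]) @^-1` B) =
  (\int[P]_w (\1_B [tuple 0 + xi i w | i < n] * lr w)%:E)%E.
Proof.
move=> mB; pose Y := fun w => [tuple 0 + xi i w | i < n].
pose X := fun w => [tuple delta i + xi i w | i < n].
have mY : measurable_fun [set: Omega] Y by exact: mtup.
have mX : measurable_fun [set: Omega] X by exact: mtup.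
have mYB C : measurable C -> measurable (Y @^-1` C).
  by move=> mC; rewrite -[_ @^-1` _]setTI; exact: mY.
have tiltE C : measurable C -> pushforward (tilted_measure P mlr lr0) Y C =
    (\int[P]_w (\1_C (Y w) * lr w)%:E)%E.
  move=> mC; rewrite /pushforward /= /tilted integral_mkcond.
  apply: eq_integral => w _; rewrite patchE indicE.
  rewrite (_ : (w \in _) = (Y w \in C)); first by case: ifP; rewrite ?mul1r ?mul0r.
  by apply/idP/idP; rewrite !inE.
rewrite -tiltE//.
pose Ym : {mfun Omega >-> n.-tuple R} :=
  HB.pack Y (isMeasurableFun.Build _ _ _ _ Y mY).
pose Xm : {mfun Omega >-> n.-tuple R} :=
  HB.pack X (isMeasurableFun.Build _ _ _ _ X mX).
apply: (@measure_tuple_unique R n (pushforward P Xm)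
  (pushforward (tilted_measure P mlr lr0) Ym)) => //.
  apply: (@le_lt_trans _ _ 1%E); last exact: ltry.
  exact: (@probability_le1 _ _ _ P _ measurableT).
move=> A mA.
have mAd i : measurable ((fun x => x + delta i) @^-1` A i).
  rewrite -[_ @^-1` _]setTI; apply: measurable_funD => //.
transitivity (P (\bigcap_(i in [set i | i \in [set: 'I_n]%SET])
      (xi i @^-1` ((fun x => x + delta i) @^-1` A i)))).
  congr (P _); apply/seteqP; split => w /= h i.
    by move=> _ /=; have := h i; rewrite tnth_mktuple addrC.
  by rewrite tnth_mktuple addrC; apply: h; rewrite /= finset.inE.
rewrite (noise.1 [set: 'I_n]%SET _ mAd).
rewrite (eq_bigl xpredT) => [|i]; last by rewrite finset.inE.
have PA i : P (xi i @^-1` ((fun x => x + delta i) @^-1` A i)) \is a fin_num.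
  apply: fin_num_measure; rewrite -[_ @^-1` _]setTI; exact: measurable_funP.
under eq_bigr do rewrite -(fineK (PA _)).
rewrite prodEFin.
rewrite -(@integral_prod_independent _ _ _ _ _ xi
  (fun i x => \1_(A i) x * normal_lr sigma (delta i) x)).
- set C := [set t : n.-tuple R | forall i, A i (tnth t i)].
  have mC : measurable C by exact: measurable_box.
  apply: (etrans _ (esym (tiltE C mC))).
  apply: eq_integral => w _; congr EFin; rewrite big_split /=; congr (_ * _).
  rewrite [RHS]indicE; case: (boolP (_ \in _)) => [|h].
    rewrite inE /= => h; apply: big1 => i _; rewrite indicE mem_set//.
    by have := h i; rewrite tnth_mktuple add0r.
  have [j jA] : exists j, ~ A j (xi j w).
    apply: contrapT => /forallNP h'; move/negP: h; apply; rewrite inE => i /=.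
    by rewrite tnth_mktuple add0r; apply: contrapT; exact: h'.
  by apply/eqP/prodf_eq0; exists j => //=; rewrite indicE memNset// eqxx.
- exact: noise.1.
- move=> i; apply: measurable_funM; last exact: measurable_normal_lr.
  exact: measurable_indic.
- by move=> i x; rewrite mulr_ge0// normal_lr_ge0.
- move=> i; rewrite fineK//.
  rewrite (@ge0_integral_noise i (fun x => \1_(A i) x * normal_lr sigma (delta i) x)).
  + rewrite ge0_integral_normal_lr//.
    rewrite -(@ge0_integral_noise i (fun x => \1_(A i) (x + delta i)))//.
      transitivity (\int[P]_w (\1_(xi i @^-1` ((fun x => x + delta i) @^-1` A i)) w)%:E)%E.
        by apply: eq_integral => w _; rewrite !indicE.
      rewrite integral_indic ?setIT//.
      rewrite -[_ @^-1` _]setTI; exact: measurable_funP.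
    apply: measurableT_comp; [exact: measurable_indic|exact: measurable_funD].
  + by apply: measurable_funM; [exact: measurable_indic|exact: measurable_normal_lr].
  + by move=> x; rewrite mulr_ge0// normal_lr_ge0.
Qed.

End gaussian_noise.

(** A second moment bound. With lr the likelihood ratio, lr <= 1_B + 1_(~B) lr + lr^2 / 4 pointwise;
    integrating gives 1 <= S + E[lr^2] / 4, where S is the sum of the two probabilities, and E[lr^2]
    <= exp(1/2) <= 2. *)
Lemma two_point_gaussian (R : realType) (disp : measure_display)
    (Omega : measurableType disp) (P : probability Omega R) (sigma : R) (n : nat)
    (xi : 'I_n -> {RV P >-> R}) (f g : 'I_n -> R) (B : set (n.-tuple R)) :
  0 < sigma -> iid_gaussian_noise sigma xi ->
  \sum_i (g i - f i) ^+ 2 <= sigma ^+ 2 / 2 -> measurable B ->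
  ((1 / 2)%:E <= P ((fun w => [tuple (f i + xi i w)%R | i < n]) @^-1` B) +
    P ((fun w => [tuple (g i + xi i w)%R | i < n]) @^-1` ~` B))%E.
Proof.
move=> s_gt0 noise gf mB; have s0 : sigma != 0 by rewrite gt_eqF.
pose tr (t : n.-tuple R) := [tuple f i + tnth t i | i < n].
have mtr : measurable_fun [set: n.-tuple R] tr.
  by apply: measurable_mktuple => i; apply: measurable_funD => //; exact: measurable_tnth.
pose B' := tr @^-1` B.
have mB' : measurable B' by rewrite -[B']setTI; exact: mtr.
have mCB' : measurable (~` B') by exact: measurableC.
pose delta i := g i - f i.
pose Y w := [tuple 0 + xi i w | i < n].
pose lr w := \prod_i normal_lr sigma (delta i) (xi i w).
have lr0 w : 0 <= lr w by apply: prodr_ge0 => i _; exact: normal_lr_ge0.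
have mlr : measurable_fun [set: Omega] lr.
  apply: measurable_prod => i _; apply: measurableT_comp => //.
  exact: measurable_normal_lr.
have mY : measurable_fun [set: Omega] Y.
  by apply: measurable_mktuple => i; exact: measurable_funD.
have mYB C : measurable C -> measurable_fun [set: Omega] (fun w => \1_C (Y w) : R).
  move=> mC; apply: measurableT_comp mY; exact: measurable_indic.
have -> : P ((fun w => [tuple (f i + xi i w)%R | i < n]) @^-1` B) =
    (\int[P]_w (\1_B' (Y w))%:E)%E.
  transitivity (\int[P]_w (\1_(Y @^-1` B') w)%:E)%E.
    rewrite integral_indic ?setIT//; last by rewrite -[_ @^-1` _]setTI; exact: mY.
    congr (P _); apply/seteqP; rewrite /B' /tr; split => w /=.
      by congr B; apply: eq_mktuple => i; rewrite tnth_mktuple add0r.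
    by congr B; apply: eq_mktuple => i; rewrite tnth_mktuple add0r.
  by apply: eq_integral => w _; rewrite !indicE.
have -> : P ((fun w => [tuple (g i + xi i w)%R | i < n]) @^-1` ~` B) =
    (\int[P]_w (\1_(~` B') (Y w) * lr w)%:E)%E.
  rewrite -(noise_shift s0 noise delta mCB'); congr (P _).
  apply/seteqP; rewrite /B' /tr; split => w /= h h'; apply: h; move: h';
    by congr B; apply: eq_mktuple => i; rewrite tnth_mktuple addrA subrKC.
rewrite -ge0_integralD//; last 3 first.
- exact/measurable_EFinP/mYB.
- by move=> w _; rewrite lee_fin mulr_ge0.
- by apply/measurable_EFinP; apply: measurable_funM => //; exact: mYB.
set S := (\int[P]_w _)%E.
have : ((\int[P]_w (lr w)%:E) <= S + \int[P]_w ((1 / 4)%:E * (lr w ^+ 2)%:E))%E.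
  rewrite -ge0_integralD//.
  - apply: ge0_le_integral => //.
    + by move=> w _; rewrite lee_fin.
    + exact/measurable_EFinP.
    + apply/measurable_EFinP; apply: measurable_funD.
        apply: measurable_funD; first exact: mYB.
        by apply: measurable_funM => //; exact: mYB.
      by apply: measurable_funM => //; exact: measurable_funX.
    + move=> w _; rewrite lee_fin !indicE in_setC.
      have := sqr_ge0 (lr w / 2 - 1); have := sqr_ge0 (lr w).
      by case: (Y w \in B') => /=; nra.
  - by move=> w _; rewrite lee_fin addr_ge0// mulr_ge0.
  - apply/measurable_EFinP; apply: measurable_funD; first exact: mYB.
    by apply: measurable_funM => //; exact: mYB.
  - by move=> w _; rewrite lee_fin mulr_ge0// sqr_ge0.
  - apply/measurable_EFinP; apply: measurable_funM => //; exact: measurable_funX.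
rewrite integral_noise_lr// ge0_integralZl_EFin//; last 2 first.
- by move=> w _; rewrite lee_fin sqr_ge0.
- apply/measurable_EFinP; exact: measurable_funX.
rewrite integral_noise_lr_sqr// => h.
have h3 : expR ((\sum_i delta i ^+ 2) / sigma ^+ 2) <= 2.
  apply: (@le_trans _ _ (expR (1 / 2))).
    by rewrite ler_expR ler_pdivrMr ?exprn_gt0//; apply: (le_trans gf); lra.
  have := expR_ge1Dx (- (1 / 2) : R); rewrite expRN.
  have := expR_gt0 (1 / 2 : R); set x := expR _ => x0 hx.
  have := ler_wpM2l (ltW x0) hx; rewrite mulfV ?gt_eqF// => h'; lra.
case: S h => [s| |]//=; rewrite ?leey//.
by rewrite -!EFinM -EFinD !lee_fin; lra.
Qed.

(** * Assouad's lemma *)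

Lemma flipK (I : finType) (r : I) : involutive (flip r).
Proof. by move=> e; apply/ffunP => i; rewrite !ffunE; case: eqP => // _; rewrite negbK. Qed.

Lemma flip_at (I : finType) (r : I) (e : {ffun I -> bool}) : flip r e r = ~~ e r.
Proof. by rewrite ffunE eqxx. Qed.

(** [v] is the orthogonal projection of [u], and the square norm of [u - v] is nonnegative. *)
Lemma bessel (R : realFieldType) (n : nat) (I : finType) (A : {set I})
    (g : I -> 'I_n -> R) (G : R) (u : 'I_n -> R) : 0 < G ->
  {in A &, forall r r', r != r' -> \sum_i g r i * g r' i = 0} ->
  {in A, forall r, \sum_i g r i ^+ 2 = G} ->
  \sum_(r in A) (\sum_i g r i * u i) ^+ 2 / G <= \sum_i u i ^+ 2.
Proof.
move=> G0 orth norm.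
pose a r := (\sum_i g r i * u i) / G.
pose v i := \sum_(r in A) a r * g r i.
have uv : \sum_i u i * v i = \sum_(r in A) (\sum_i g r i * u i) ^+ 2 / G.
  under eq_bigr do rewrite mulr_sumr.
  rewrite exchange_big /=; apply: eq_bigr => r rA.
  rewrite (eq_bigr (fun i => a r * (g r i * u i))); last by move=> i _; ring.
  by rewrite -mulr_sumr /a; ring.
have vv : \sum_i v i * v i = \sum_(r in A) (\sum_i g r i * u i) ^+ 2 / G.
  rewrite (eq_bigr (fun i => \sum_(r in A) a r * (g r i * v i))); last first.
    by move=> i _; rewrite {1}/v mulr_suml; apply: eq_bigr => r _; ring.
  rewrite exchange_big /=; apply: eq_bigr => r rA.
  rewrite -mulr_sumr.
  have -> : \sum_i g r i * v i = a r * G.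
    under eq_bigr do rewrite mulr_sumr.
    rewrite exchange_big /= (bigD1 r)//= [X in _ + X]big1 ?addr0; last first.
      move=> r' /andP[r'A r'r].
      rewrite (eq_bigr (fun i => a r' * (g r' i * g r i))); last by move=> i _; ring.
      by rewrite -mulr_sumr orth ?mulr0.
    rewrite (eq_bigr (fun i => a r * g r i ^+ 2)); last by move=> i _; ring.
    by rewrite -mulr_sumr norm.
  by rewrite /a; field; rewrite gt_eqF.
have : 0 <= \sum_i (u i - v i) ^+ 2 by apply: sumr_ge0 => i _; exact: sqr_ge0.
rewrite (eq_bigr (fun i => u i ^+ 2 - (u i * v i) *+ 2 + v i * v i)); last first.
  by move=> i _; rewrite sqrrB expr2.
by rewrite !big_split /= sumrN sumrMnl uv vv; lra.
Qed.

(* Averaging over the whole hypercube lets the argument tolerate vertices [e] whose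
   function leaves the class, at the cost of their proportion. *)
Lemma assouad_pigeonhole (R : realFieldType) (I : finType) (A : {set I})
    (good : {set {ffun I -> bool}}) (p : {ffun I -> bool} -> I -> R) :
  (forall e r, 0 <= p e r <= 1) ->
  (forall e r, r \in A -> 1 / 2 <= p e r + p (flip r e) r) ->
  (16 * #|~: good| <= #|{ffun I -> bool}|)%N ->
  exists2 e, e \in good & #|A|%:R / 8 <= \sum_(r in A) p e r.
Proof.
move=> p01 pflip bad.
pose N : R := #|{ffun I -> bool}|%:R.
have N0 : 0 < N by rewrite ltr0n; apply/card_gt0P; exists [ffun=> true].
have badR : 16 * #|~: good|%:R <= N by rewrite -natrM ler_nat.
have goodN : #|good|%:R + #|~: good|%:R = N by rewrite -natrD cardsC.
(* Pairing [e] with [flip r e] gives each sign an average error of at least 1/4. *)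
have tot : #|A|%:R * N / 4 <= \sum_e \sum_(r in A) p e r.
  rewrite exchange_big /= -mulrA mulr_natl -sumr_const; apply: ler_sum => r rA.
  have : \sum_(e : {ffun I -> bool}) (1 / 2) <=
      \sum_e (p e r + p (flip r e) r) by apply: ler_sum => e _; exact: pflip.
  rewrite sumr_const -mulr_natl -/N big_split /=.
  have <- : \sum_e p e r = \sum_e p (flip r e) r.
    exact: reindex_inj (inv_inj (@flipK _ r)).
  lra.
apply: contrapT => none.
have lt_good e : e \in good -> \sum_(r in A) p e r < #|A|%:R / 8.
  by move=> eg; rewrite ltNge; apply/negP => h; apply: none; exists e.
(* Were no good vertex to work, the total would be at most 1/8 + 1/16 = 3/16 of [N * #|A|], less
   than the 1/4 of [tot]. *)
have good_le : \sum_(e in good) \sum_(r in A) p e r <= #|good|%:R * (#|A|%:R / 8).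
  rewrite mulr_natl -sumr_const; apply: ler_sum => e /lt_good/ltW//.
have bad_le : \sum_(e in ~: good) \sum_(r in A) p e r <= #|~: good|%:R * #|A|%:R.
  rewrite mulr_natl -sumr_const; apply: ler_sum => e _.
  rewrite -[leRHS]mulr1 mulr_natl -sumr_const; apply: ler_sum => r _.
  by have /andP[] := p01 e r.
have A0 : (0 : R) <= #|A|%:R by rewrite ler0n.
have g0 : (0 : R) <= #|good|%:R by rewrite ler0n.
have b0 : (0 : R) <= #|~: good|%:R by rewrite ler0n.
have [e eg] : exists e, e \in good.
  apply/card_gt0P; rewrite -(ltr_nat R); lra.
have := lt_good _ eg.
have : 0 <= \sum_(r in A) p e r by apply: sumr_ge0 => r _; have /andP[] := p01 e r.
move: tot; rewrite (bigID (mem good)) /=.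
rewrite [X in _ + X](eq_bigl (mem (~: good))); last by move=> e'; rewrite /= finset.inE.
move=> tot h1 h2.
have : #|~: good|%:R * #|A|%:R <= N / 16 * #|A|%:R by apply: ler_wpM2r => //; lra.
have : #|good|%:R * (#|A|%:R / 8) <= N * (#|A|%:R / 8).
  by apply: ler_wpM2r; [exact: divr_ge0|lra].
move=> h3 h4.
have : 0 < N * #|A|%:R by apply: mulr_gt0 => //; lra.
lra.
Qed.

Section assouad.
Context (R : realType) (disp : measure_display) (Omega : measurableType disp)
  (P : probability Omega R) (sigma V : R) (n d : nat) (x : 'I_n -> 'I_d -> R)
  (xi : 'I_n -> {RV P >-> R}).
Variables (I : finType) (A : {set I}) (good : {set {ffun I -> bool}})
  (F : {ffun I -> bool} -> ('I_d -> R) -> R) (g : I -> 'I_n -> R) (G kappa : R).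
Hypotheses (s_gt0 : 0 < sigma) (noise : iid_gaussian_noise sigma xi)
  (xcube : forall i, unit_cube (x i)) (G0 : 0 < G) (kappa0 : 0 <= kappa).
Hypothesis Fgood : forall e, e \in good ->
  entirely_monotone (F e) /\ (hk0_variation (F e) <= V%:E)%E.
Hypothesis bad : (16 * #|~: good| <= #|{ffun I -> bool}|)%N.
Hypothesis orth :
  {in A &, forall r r', r != r' -> \sum_i g r i * g r' i = 0}.
Hypothesis norm : {in A, forall r, \sum_i g r i ^+ 2 = G}.
Hypothesis extract : forall e, {in A, forall r,
  \sum_i g r i * F e (x i) = (-1) ^+ e r * kappa}.
Hypothesis close : forall e, {in A, forall r,
  \sum_i (F (flip r e) (x i) - F e (x i)) ^+ 2 <= sigma ^+ 2 / 2}.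

Let obs e w := observations x xi (F e) w.

Let mobs e : measurable_fun [set: Omega] (obs e).
Proof. by apply: measurable_mktuple => i; exact: measurable_funD. Qed.

(** The sign of [theta r] is the estimator's guess of sign [r]. The true coefficient is plus or
    minus [kappa], so a wrong guess puts [theta r] at distance at least [kappa] from it. *)
Lemma assouad :
  ((#|A|%:R / 8 * (kappa ^+ 2 / G / n%:R))%:E <= minimax_risk_EM x xi V)%E.
Proof.
apply: le_ereal_inf_tmp => _ /= [fhat mfhat <-].
have mf i : measurable_fun [set: n.-tuple R] (fun y => fhat y (x i)).
  exact: mfhat.
pose theta r y := \sum_i g r i * fhat y (x i).
have mtheta r : measurable_fun [set: n.-tuple R] (theta r).
  by apply: measurable_sum => i; exact: measurable_funM.
pose B r : set (n.-tuple R) := [set y | theta r y <= 0].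
have mB r : measurable (B r).
  rewrite -[B r]setTI (_ : B r = theta r @^-1` `]-oo, 0%R]).
    by apply: mtheta.
  by apply/seteqP; split => y /=; rewrite in_itv.
(* [wrong e r]: the sign of the r-th coefficient is guessed incorrectly. *)
pose wrong (e : {ffun I -> bool}) r := if e r then ~` B r else B r.
have mwrong e r : measurable (obs e @^-1` wrong e r).
  rewrite -[_ @^-1` _]setTI; apply: mobs => //; rewrite /wrong.
  by case: ifP => _ //; exact: measurableC.
pose p e r := fine (P (obs e @^-1` wrong e r)).
have pE e r : P (obs e @^-1` wrong e r) = (p e r)%:E.
  by rewrite fineK// fin_num_measure.
have p01 e r : 0 <= p e r <= 1.
  by rewrite -!lee_fin -pE measure_ge0 probability_le1.
have pflip e r : r \in A -> 1 / 2 <= p e r + p (flip r e) r.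
  move=> rA; rewrite -lee_fin EFinD -!pE /wrong flip_at.
  case: (e r) => /=; first rewrite addeC.
    apply: (two_point_gaussian s_gt0 noise) => //.
    rewrite (eq_bigr (fun i => (F (flip r e) (x i) - F e (x i)) ^+ 2)).
      exact: close.
    by move=> i _; rewrite -sqrrN opprB.
  by apply: (two_point_gaussian s_gt0 noise) => //; exact: close.
have [e eg le_p] := assouad_pigeonhole p01 pflip bad.
apply: (@le_trans _ _ (risk x xi fhat (F e))); last first.
  by apply: ereal_sup_ubound; exists (F e) => //; exact: Fgood.
pose c := kappa ^+ 2 / G / n%:R.
have c0 : 0 <= c by rewrite !divr_ge0 ?sqr_ge0// ltW.
have mind r : measurable_fun [set: Omega]
    (fun w => c * \1_(obs e @^-1` wrong e r) w).
  by apply: measurable_funM => //; exact: measurable_indic.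
have -> : risk x xi fhat (F e) =
    (\int[P]_w (loss x (fhat (obs e w)) (F e))%:E)%E by rewrite /risk unlock.
apply: (@le_trans _ _ (\int[P]_w
    (\sum_(r <- enum A) (c * \1_(obs e @^-1` wrong e r) w)%:E))%E).
  rewrite ge0_integral_sum//; last 2 first.
  - by move=> r; exact/measurable_EFinP.
  - by move=> r w _; rewrite lee_fin mulr_ge0.
  rewrite (eq_bigr (fun r => (p e r * c)%:E)); last first.
    move=> r _; under eq_integral do rewrite (EFinM c).
    rewrite ge0_integralZl_EFin//; last exact/measurable_EFinP/measurable_indic.
    rewrite integral_indic// setIT (mulrC (p e r)) (EFinM c (p e r)).
    by congr (_ * _)%E; exact: pE.
  rewrite sumEFin lee_fin big_enum /= -mulr_suml; exact: ler_wpM2r.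
apply: ge0_le_integral => //.
- by move=> w _; apply: sume_ge0 => r _; rewrite lee_fin mulr_ge0.
- by apply: emeasurable_sum => r; exact/measurable_EFinP.
- apply/measurable_EFinP; rewrite /loss; apply: measurable_funM => //.
  apply: measurable_sum => i; apply: measurable_funX; apply: measurable_funB => //.
  exact: (measurableT_comp (mf i) (mobs e)).
move=> w _; rewrite sumEFin lee_fin big_enum /=.
set y := obs e w; pose u i := fhat y (x i) - F e (x i).
have -> : \sum_(r in A) c * \1_(obs e @^-1` wrong e r) w =
    n%:R^-1 * \sum_(r in A) (kappa ^+ 2 * \1_(wrong e r) y) / G.
  rewrite mulr_sumr; apply: eq_bigr => r _; rewrite /c !indicE.
  rewrite (_ : (w \in _) = (y \in wrong e r)); first by ring.
  by apply/idP/idP; rewrite !inE.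
apply: ler_wpM2l; first by rewrite invr_ge0.
apply: le_trans (bessel u G0 orth norm).
apply: ler_sum => r rA; apply: ler_wpM2r; first by rewrite invr_ge0 ltW.
have -> : \sum_i g r i * u i = theta r y - (-1) ^+ e r * kappa.
  rewrite -extract// /theta -sumrB; apply: eq_bigr => i _.
  by rewrite mulrBr.
rewrite indicE; case: (boolP (y \in _)) => [|_]; last by rewrite mulr0 sqr_ge0.
rewrite inE /wrong mulr1; case: (e r) => /=.
  by move/negP; rewrite -ltNge => h; rewrite expr1 mulN1r opprK;
    have := mulr_ge0 (ltW h) kappa0; have := sqr_ge0 (theta r y); nra.
rewrite expr0 mul1r => h; have := sqr_ge0 (theta r y).
have : 0 <= - theta r y * kappa by rewrite mulr_ge0// oppr_ge0.
nra.
Qed.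

End assouad.

(** * Distribution functions of discrete measures *)

(** Distributivity with an index type for each factor, as the partitions of the axes may have
    different lengths. *)
Lemma big_dffun_distr (R : comPzSemiRingType) (I : finType) (T : I -> finType)
    (F : forall i, T i -> R) :
  \sum_(l : {dffun forall i, T i}) \prod_i F i (l i) = \prod_i \sum_(j : T i) F i j.
Proof.
rewrite (reindex _ (onW_bij _ (dffun_of_fprod_bij T))) /=.
pose G i : {ffun T i -> R} := [ffun j => F i j].
transitivity (\sum_(t : fprod T) \prod_(i in I) G i (t i)).
  by apply: eq_bigr => t _; apply: eq_bigr => i _; rewrite !ffunE.
rewrite (big_fprod 1 +%R G).
rewrite -(bigA_distr_big_dep (tagged_with (fun x => T x)) (fun i => untag 0 (G i))).
apply: eq_bigr => i _; rewrite -(big_tag G).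
by apply: eq_bigr => j _; rewrite ffunE.
Qed.

Section step_fun.
Context (R : realType) (C : finType) (rho : C -> R).

(** The distribution function of the measure with mass [rho c] at the point [t c]. *)
Definition step_fun (I : finType) (t : C -> I -> R) (u : I -> R) : R :=
  \sum_c rho c * \prod_i (t c i <= u i)%R%:R.

(** On a degenerate side the quasi-volume evaluates at the endpoint instead of taking a
    difference. *)
Definition step_diff (t a b : R) : R :=
  if a == b then (t <= b)%R%:R else (t <= b)%R%:R - (t <= a)%R%:R.

Lemma step_diff_ge0 t a b : a <= b -> 0 <= step_diff t a b.
Proof.
move=> ab; rewrite /step_diff; case: eqP => // _; rewrite subr_ge0 ler_nat.
by case: (leP t a) => // ta; rewrite (le_trans ta ab).
Qed.

Lemma quasi_volume_step_fun (I : finType) (t : C -> I -> R) (a b : I -> R) :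
  quasi_volume (step_fun t) a b = \sum_c rho c * \prod_i step_diff (t c i) (a i) (b i).
Proof.
rewrite /quasi_volume /step_fun.
under eq_bigr do rewrite mulr_sumr.
rewrite exchange_big /=; apply: eq_bigr => c _.
under eq_bigr do rewrite mulrCA.
rewrite -mulr_sumr; congr (_ * _).
(* The value 0 at forbidden indices turns the restricted sum into a full one, over which the product
   distributes. *)
pose E i (j : bool) : R := if (j <= (a i != b i))%N then
  (-1) ^+ j * (t c i <= b i + j%:R * (a i - b i))%R%:R else 0.
transitivity (\sum_(j : {ffun I -> bool}) \prod_i E i (j i)).
  rewrite big_mkcond; apply: eq_bigr => j _; case: ifPn => [/forallP h|].
    by rewrite expr_sum -big_split; apply: eq_bigr => i _; rewrite /E h.
  rewrite negb_forall => /existsP[i hi]; apply/esym/eqP/prodf_eq0.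
  by exists i => //; rewrite /E (negbTE hi).
rewrite -(bigA_distr_bigA E); apply: eq_bigr => i _.
rewrite big_bool /E /= expr1 expr0 mul0r addr0 mul1r /step_diff mulN1r addrC mul1r.
by rewrite subrKC; case: (a i =P b i) => //=; rewrite addr0.
Qed.

Hypothesis rho0 : forall c, 0 <= rho c.

Lemma quasi_volume_step_fun_ge0 (I : finType) (t : C -> I -> R) (a b : I -> R) :
  (forall i, a i <= b i) -> 0 <= quasi_volume (step_fun t) a b.
Proof.
move=> ab; rewrite quasi_volume_step_fun sumr_ge0// => c _; rewrite mulr_ge0//.
by apply: prodr_ge0 => i _; exact: step_diff_ge0.
Qed.

Lemma entirely_monotone_step_fun (I : finType) (t : C -> I -> R) :
  entirely_monotone (step_fun t).
Proof. by move=> a b _ _ _; exact: quasi_volume_step_fun_ge0. Qed.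

Lemma itv_partition_nth_lt (a b : R) s k : itv_partition a b s ->
  (k < size s)%N -> nth b (a :: s) k < nth b (a :: s) k.+1.
Proof.
move=> [+ _]; elim: s a k => // x s IHs a [|k] /= /andP[ax xs] //.
by rewrite ltnS => ks; exact: IHs.
Qed.

(** Quasi-volumes are nonnegative, so absolute values drop, and for each atom the increments along
    an axis telescope to at most 1. *)
Lemma vitali_variation_step_fun (I : finType) (t : C -> I -> R) :
  (vitali_variation (step_fun t) <= (\sum_c rho c)%:E)%E.
Proof.
apply: ge_ereal_sup => _ [p /= pP <-]; rewrite lee_fin /split_variation.
have plt i (k : 'I_(size (p i))) :
    nth 1 (0 :: p i) k < nth 1 (0 :: p i) k.+1.
  exact: itv_partition_nth_lt.
pose E c i (k : 'I_(size (p i))) : R :=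
  step_diff (t c i) (nth 1 (0 :: p i) k) (nth 1 (0 :: p i) k.+1).
rewrite (eq_bigr (fun l : {dffun forall i, 'I_(size (p i))} =>
    \sum_c rho c * \prod_i E c i (l i))); last first.
  move=> l _; rewrite ger0_norm ?quasi_volume_step_fun//.
  by rewrite -quasi_volume_step_fun quasi_volume_step_fun_ge0// => i; exact: ltW.
rewrite exchange_big /=; apply: ler_sum => c _.
rewrite -mulr_sumr ler_piMr//.
rewrite (big_dffun_distr (E c)).
have Ele i : \sum_(k < size (p i)) E c i k <= 1.
  rewrite (eq_bigr (fun k : 'I_(size (p i)) =>
    (t c i <= nth 1 (0 :: p i) k.+1)%R%:R - (t c i <= nth 1 (0 :: p i) k)%R%:R)).
    rewrite -(big_mkord xpredT (fun k =>
      (t c i <= nth 1 (0 :: p i) k.+1)%R%:R - (t c i <= nth 1 (0 :: p i) k)%R%:R)).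
    rewrite telescope_sumr//.
    by case: (t c i <= _); case: (t c i <= _); rewrite ?subrr ?sub0r ?subr0//; lra.
  by move=> k _; rewrite /E /step_diff lt_eqF.
apply: le_trans (_ : \prod_(i : I) 1 <= 1); last by rewrite big1.
apply: ler_prod => i _; rewrite Ele andbT sumr_ge0// => k _.
by apply: step_diff_ge0; exact: ltW.
Qed.

End step_fun.

(** All atoms have positive coordinates, so the function vanishes on each face where some coordinate
    is fixed at 0, and only the full set of coordinates contributes. *)
Lemma hk0_variation_step_fun (R : realType) (C I : finType) (rho : C -> R)
    (t : C -> I -> R) :
  (forall c, 0 <= rho c) -> (forall c i, 0 < t c i) ->
  (hk0_variation (step_fun rho t) <= (\sum_c rho c)%:E)%E.
Proof.
move=> rho0 t0; rewrite /hk0_variation.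
apply: (@le_trans _ _ (\sum_(S : {set I} | S != finset.set0)
    (if S == [set: I]%SET then (\sum_c rho c)%:E else 0))%E).
  apply: lee_sum => S _; case: eqP => [->|/eqP ST].
    rewrite (_ : @face_restriction _ _ _ _ =
      step_fun rho (fun c (i : {i | i \in [set: I]%SET}) => t c (val i))).
      exact: vitali_variation_step_fun.
    apply/funext => u; apply: eq_bigr => c _; congr (_ * _).
    rewrite (reindex_onto (fun i : {i | i \in [set: I]%SET} => val i)
      (fun i => Sub i (finset.in_setT i))) => [|i _]; last exact: SubK.
    apply: eq_big => [i|i _]; first by apply/eqP/val_inj.
    by rewrite valK.
  rewrite (_ : @face_restriction _ _ _ _ =
      step_fun (fun=> 0) (fun c (i : {i | i \in S}) => t c (val i))).
    apply: le_trans (vitali_variation_step_fun _ _) _ => //.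
    by rewrite big1.
  apply/funext => u; apply: eq_bigr => c _; rewrite mul0r.
  have [i _ iS] : exists2 i, i \in [set: I]%SET & i \notin S.
    by apply/subsetPn; rewrite finset.subTset.
  rewrite (bigD1 i)//= insubN// leNgt t0 mul0r mulr0//.
rewrite -big_mkcondr /=.
(* With no coordinates at all the sum over nonempty sets is empty. *)
have [T0|T0] := eqVneq [set: I]%SET finset.set0.
  rewrite big1 ?lee_fin ?sumr_ge0// => S /andP[S0 /eqP ST].
  by rewrite ST T0 eqxx in S0.
rewrite (eq_bigl (pred1 [set: I]%SET)); first by rewrite big_pred1_eq.
by move=> S /=; have [->|] := eqVneq S [set: I]%SET; rewrite ?T0 ?andbF.
Qed.

(** * The lattice design *)

(** The quotient by [w] identifies the points of a block; points past the [N] full blocks are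
    discarded. *)
Lemma sum_divn (R : pzSemiRingType) (N w K : nat) (F : nat -> R) :
  (0 < w)%N -> (N * w <= K)%N ->
  \sum_(a < K) (a %/ w < N)%N%:R * F (a %/ w)%N = w%:R * \sum_(x < N) F x.
Proof.
move=> w0 NwK.
rewrite -(big_mkord xpredT (fun a => (a %/ w < N)%N%:R * F (a %/ w)%N)).
rewrite (big_cat_nat (leq0n (N * w)) NwK) /= [X in _ + X]big_nat_cond.
rewrite [X in _ + X]big1 ?addr0; last first.
  move=> a /andP[/andP[+ _] _].
  by rewrite -leq_divRL// leqNgt => /negbTE ->; rewrite mul0r.
rewrite big_mkord (sum_ord_mul (fun a => (a %/ w < N)%N%:R * F (a %/ w)%N) (erefl (N * w)%N)).
rewrite mulr_sumr; apply: eq_bigr => x _.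
rewrite (eq_bigr (fun=> F x)); first by rewrite sumr_const card_ord mulr_natl.
move=> t _; rewrite divnMDl// divn_small// addn0.
by have := ltn_ord x => ->; rewrite mul1r.
Qed.

Section lattice_design.
Context (R : realType) (d : nat) (ns : 'I_d -> nat) (n : nat) (x : 'I_n -> 'I_d -> R).
Hypotheses (ns0 : forall j, (0 < ns j)%N) (xE : enumerates x (lattice R ns)).

(** Whatever the order of enumeration, sums of products over the design factor over the axes. *)
Lemma lattice_indexE : exists idx : 'I_n -> 'I_d -> nat,
  [/\ forall i j, (idx i j < ns j)%N, forall i j, x i j = (idx i j)%:R / (ns j)%:R &
   forall F : ('I_d -> nat -> R), \sum_i \prod_j F j (idx i j) =
     \prod_j \sum_(a < ns j) F j a].
Proof.
have [xinj xr] := xE.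
have /choice[idx idxP] : forall i, exists m : 'I_d -> nat,
    (forall j, (m j < ns j)%N) /\ x i = (fun j => (m j)%:R / (ns j)%:R).
  by move=> i; have : range x (x i) by []; rewrite xr.
have idxlt i j : (idx i j < ns j)%N by have [] := idxP i.
exists idx; split=> // [i j|F]; first by have [_ ->] := idxP i.
rewrite -(@big_dffun_distr R 'I_d (fun j => 'I_(ns j)) (fun j a => F j a)).
pose h i : {dffun forall j, 'I_(ns j)} := [ffun j => Ordinal (idxlt i j)].
have hinj : injective h.
  move=> i i' hi; apply: xinj; apply/funext => j.
  have [_ ->] := idxP i; have [_ ->] := idxP i'.
  by have /ffunP/(_ j) := hi; rewrite !ffunE => -[->].
have hsurj (l : {dffun forall j, 'I_(ns j)}) : exists i, h i = l.
  have : lattice R ns (fun j => (l j)%:R / (ns j)%:R) by exists (fun j => l j); split.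
  rewrite -xr => -[i _ xi]; exists i; apply/ffunP => j; rewrite ffunE.
  apply/val_inj => /=; apply/eqP; rewrite -(eqr_nat R).
  have [_ xi'] := idxP i; have := xi; rewrite xi' => /(congr1 (@^~ j)) /=.
  move/(congr1 (fun z => z * (ns j)%:R)).
  by rewrite !divfK ?pnatr_eq0 -?lt0n// => ->.
have /choice[h' h'K] := hsurj.
rewrite (reindex h); first by apply: eq_bigr => i _; apply: eq_bigr => j _; rewrite ffunE.
by exists h' => l _; [apply: hinj; rewrite h'K|rewrite h'K].
Qed.

End lattice_design.

(** * The lower bound given by one family of densities *)

Section grid_lower_bound.
Context (R : realType) (d : nat) (ns : 'I_d -> nat) (n : nat) (x : 'I_n -> 'I_d -> R)
  (disp : measure_display) (Omega : measurableType disp) (P : probability Omega R)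
  (sigma V : R) (xi : 'I_n -> {RV P >-> R}).
Context (L m : nat) (T : finType) (k : T -> 'I_d -> nat).
Local Notation N := (4 ^ L)%N.
Local Notation cell := {ffun 'I_d -> 'I_N}.
Local Notation par := (T * cell)%type.
Context (rho : {ffun par -> bool} -> cell -> R) (good : {set {ffun par -> bool}}) (a : R).
Hypotheses (s0 : 0 < sigma) (V0 : 0 < V) (a0 : 0 <= a).
Hypotheses (nE : n = (\prod_j ns j)%N) (xE : enumerates x (lattice R ns)).
Hypothesis noise : iid_gaussian_noise sigma xi.
Hypotheses (kL : forall s j, (k s j < L)%N) (km : forall s, (\sum_j k s j)%N = m).
Hypothesis mdL : (m <= d * L)%N.
Hypothesis kinj : forall s s', k s =1 k s' -> s = s'.
Hypothesis fam : grid_family k rho good a.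
Hypothesis Nns : forall j, (N <= ns j)%N.
(** This hides a flipped sign: the squared displacement is at most 4 a^2 V^2 n / 4^(3m), hence at
    most sigma^2 / 2. *)
Hypothesis near : 8 * a ^+ 2 * V ^+ 2 * n%:R <= sigma ^+ 2 * (4 ^ m)%:R ^+ 3.

(** On axis [j] a block consists of [w j] lattice points; [W] is the number of lattice points in a
    cell and [Q] the number of cells in a box. *)
Let w j := (ns j %/ N)%N.
Let W : R := \prod_j (w j)%:R.
Let Q : R := (4 ^ (d * L - m))%:R.

Let ns0 j : (0 < ns j)%N. Proof. exact: leq_trans (exp4_gt0 L) (Nns j). Qed.
Let w0 j : (0 < w j)%N. Proof. by rewrite divn_gt0 ?exp4_gt0// Nns. Qed.
Let W0 : 0 < W. Proof. by apply: prodr_gt0 => j _; rewrite ltr0n w0. Qed.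
Let Q0 : 0 < Q. Proof. by rewrite ltr0n exp4_gt0. Qed.
Let NwE j : (N * w j <= ns j)%N. Proof. by rewrite mulnC leq_trunc_div. Qed.

Let prodQ s : \prod_j (4 ^ (L - k s j))%:R = Q.
Proof.
rewrite -natr_prod -expn_sum; congr (_ ^ _)%:R.
rewrite -(km s) sumnB => [|j _]; last exact: ltnW.
by rewrite sum_nat_const card_ord.
Qed.

Let mQ : (4 ^ m)%:R * Q = (N ^ d)%:R :> R.
Proof.
by rewrite -natrM -expnD subnKC// mulnC expnM.
Qed.

(* At least half of each axis is covered by the [N] blocks of [w j] points. *)
Let W_ge : n%:R <= 2 ^+ d * (W * (N ^ d)%:R).
Proof.
have -> : (N ^ d)%:R = \prod_(j < d) N%:R :> R.
  by rewrite prodr_const card_ord natrX.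
have -> : 2 ^+ d = \prod_(j < d) 2 :> R by rewrite prodr_const card_ord.
rewrite /W nE natr_prod -!big_split /=; apply: ler_prod => j _; rewrite ler0n /=.
rewrite -!natrM ler_nat {1}(divn_eq (ns j) N) -/(w j).
have := ltn_pmod (ns j) (exp4_gt0 L); have := w0 j.
by move: (ns j %% N)%N => r wj rN; nia.
Qed.

Let W_le : W * (N ^ d)%:R <= n%:R.
Proof.
have -> : (N ^ d)%:R = \prod_(j < d) N%:R :> R.
  by rewrite prodr_const card_ord natrX.
rewrite /W nE natr_prod -big_split /=; apply: ler_prod => j _.
by rewrite mulr_ge0//= -natrM ler_nat mulnC.
Qed.

(** Atoms sit at the upper corners of the cells: their coordinates are positive, and the value at a
    lattice point is, up to the factor V / N^d, [cumul] at the index of its cell. *)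
Let step (e : {ffun par -> bool}) : ('I_d -> R) -> R :=
  step_fun (fun c : cell => V / (N ^ d)%:R * rho e c)
    (fun (c : cell) j => ((c j).+1 * w j)%:R / (ns j)%:R).

(** The 8 comes from the averaging over the hypercube. Per axis, 640 = 64 * 5 * 2: 64 from the
    square of the pairing, as -2 b^2 = -(4b)^2 / 8; 5 from the norm of the test function; 2 from the
    lattice points left uncovered. *)
Lemma grid_lower_bound :
  ((#|T|%:R * a ^+ 2 * V ^+ 2 / (8 * 640 ^+ d * (4 ^ m)%:R ^+ 2))%:E <=
   minimax_risk_EM x xi V)%E.
Proof.
have [famD fambad famA famC] := fam.
have [idx [idxlt xidx sum_idx]] := lattice_indexE ns0 xE.
pose C i j := (idx i j %/ w j)%N.
pose Nd : R := (N ^ d)%:R.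
have Nd0 : 0 < Nd by rewrite ltr0n expn_gt0 exp4_gt0.
have sum_block (F : 'I_d -> nat -> R) :
    \sum_i \prod_j ((C i j < N)%N%:R * F j (C i j)) = W * \prod_j \sum_(y < N) F j y.
  rewrite (sum_idx (fun j b => (b %/ w j < N)%N%:R * F j (b %/ w j)%N)) /W -big_split /=.
  by apply: eq_bigr => j _; rewrite sum_divn.
have stepE e i : step e (x i) = V / Nd * cumul (rho e) (C i).
  rewrite /step /step_fun /cumul mulr_sumr; apply: eq_bigr => c _.
  rewrite -mulrA; congr (_ * (_ * _)); apply: eq_bigr => j _; congr (nat_of_bool _)%:R.
  rewrite xidx ler_pM2r ?invr_gt0 ?ltr0n// ler_nat /C -leq_divRL//.
(* The sign (-1)^d cancels that of the factors -2 in the pairing. *)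
pose g (r : par) i : R := (-1) ^+ d * \prod_j ((C i j < N)%N%:R * @tdiff R L (k r.1 j) (r.2 j) (C i j)).
have gg r r' : \sum_i g r i * g r' i = W * \sum_c par_tdiff R k r c * par_tdiff R k r' c.
  rewrite (eq_bigr (fun i => \prod_j ((C i j < N)%N%:R *
      (@tdiff R L (k r.1 j) (r.2 j) (C i j) * @tdiff R L (k r'.1 j) (r'.2 j) (C i j))))).
    rewrite (sum_block (fun j y => @tdiff R L (k r.1 j) (r.2 j) y * @tdiff R L (k r'.1 j) (r'.2 j) y)).
    congr (_ * _); rewrite -(sum_cell_prod L (fun j y => @tdiff R L (k r.1 j) (r.2 j) y * @tdiff R L (k r'.1 j) (r'.2 j) y)).
    by apply: eq_bigr => c _; rewrite /par_tdiff /cell_prod -big_split.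
  move=> i _; rewrite /g mulrACA -expr2 sqrr_sign mul1r -big_split /=.
  apply: eq_bigr => j _; rewrite mulrACA; congr (_ * _).
  by rewrite -natrM mulnb andbb.
have gstep e r : \sum_i g r i * step e (x i) =
    (-1) ^+ d * (V / Nd * W * \sum_c rho e c * par_tdiff_tail R k r c).
  rewrite (eq_bigr (fun i => \sum_(c : cell) (-1) ^+ d * (V / Nd) * rho e c *
      \prod_j ((C i j < N)%N%:R * ((c j < C i j)%N%:R * @tdiff R L (k r.1 j) (r.2 j) (C i j))))).
    rewrite exchange_big /= mulr_sumr mulr_sumr; apply: eq_bigr => c _.
    rewrite -mulr_sumr (sum_block (fun j y => (c j < y)%N%:R * @tdiff R L (k r.1 j) (r.2 j) y)).
    rewrite /par_tdiff_tail /cell_prod.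
    by move: (\prod_j _) => B; rewrite /tdiff_tail; ring.
  move=> i _; rewrite stepE /cumul mulr_sumr mulr_sumr; apply: eq_bigr => c _.
  rewrite /g [X in _ = _ * X](_ : _ = (\prod_j (c j < C i j)%N%:R) *
    \prod_j ((C i j < N)%N%:R * @tdiff R L (k r.1 j) (r.2 j) (C i j))).
    by move: (\prod_j _) (\prod_j _) (_ ^+ d) => A B D; ring.
  by rewrite -big_split /=; apply: eq_bigr => j _; rewrite mulrCA.
have VNd0 : 0 <= V / Nd by rewrite divr_ge0// ltW.
pose M : R := (4 ^ m)%:R.
have M0 : 0 < M by rewrite ltr0n exp4_gt0.
have QE : Q = Nd / M by rewrite /Nd -mQ mulrC mulKf// gt_eqF.
have n0 : 0 < n%:R :> R by rewrite ltr0n nE prodn_gt0.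
pose G : R := W * (5 ^+ d * Q).
pose kappa : R := V / Nd * W * a * (Q ^+ 2 / 8 ^+ d).
have G0 : 0 < G by rewrite !mulr_gt0 ?exprn_gt0.
have kappa0 : 0 <= kappa.
  by rewrite /kappa !mulr_ge0 ?invr_ge0 ?exprn_ge0// ltW.
have good_step e : e \in good ->
    entirely_monotone (step e) /\ (hk0_variation (step e) <= V%:E)%E.
  move=> /famD[rho0 rho1].
  have rho0' c : 0 <= V / Nd * rho e c by rewrite mulr_ge0// divr_ge0// ltW.
  split; first exact: entirely_monotone_step_fun.
  have -> : V = \sum_(c : cell) V / Nd * rho e c.
    by rewrite -mulr_sumr rho1 divfK// gt_eqF.
  apply: hk0_variation_step_fun => // c j.
  by rewrite divr_gt0 ?ltr0n// muln_gt0 w0.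
have xcube i : unit_cube (x i).
  move=> j; rewrite xidx divr_ge0//= ler_pdivrMr ?ltr0n// mul1r ler_nat.
  exact: ltnW.
have norm : {in valid_par L k, forall r, \sum_i g r i ^+ 2 = G}.
  move=> r rv; under eq_bigr do rewrite expr2.
  rewrite gg /G; congr (_ * _); under eq_bigr do rewrite -expr2.
  rewrite sum_par_tdiff_sqr// big_split /= prodQ; congr (_ * _).
  by rewrite prodr_const card_ord.
have orth : {in valid_par L k &, forall r r', r != r' -> \sum_i g r i * g r' i = 0}.
  by move=> r r' _ _ rr'; rewrite gg sum_par_tdiff_orthogonal// mulr0.
have extract e : {in valid_par L k, forall r,
    \sum_i g r i * step e (x i) = (-1) ^+ e r * kappa}.
  move=> r rv; rewrite gstep famA//.
  have -> : \prod_j (- 2 * (4 ^ (L - (k r.1 j).+1))%:R ^+ 2) =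
      (-1) ^+ d * (Q ^+ 2 / 8 ^+ d) :> R.
    rewrite -(prodQ r.1) -prodrXl -exprVn.
    have -> : (-1) ^+ d = \prod_(j < d) -1 :> R by rewrite prodr_const card_ord.
    have -> : 8^-1 ^+ d = \prod_(j < d) 8^-1 :> R by rewrite prodr_const card_ord.
    rewrite -!big_split /=; apply: eq_bigr => j _.
    by rewrite (block_size (kL r.1 j)) natrM; field.
  rewrite /kappa; have := sqrr_sign R d; rewrite expr2.
  move: ((-1) ^+ d) ((-1) ^+ e r) (Q ^+ 2 / _) (V / Nd) => S E X Y SS.
  by rewrite -[RHS]mul1r -SS; ring.
have close e : {in valid_par L k, forall r,
    \sum_i (step (flip r e) (x i) - step e (x i)) ^+ 2 <= sigma ^+ 2 / 2}.
  move=> r rv; have /(valid_parP) rvj := rv.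
  (* Summed over a block, [H] gives the cube of its length: a square from the change of the
     distribution function, one more power from the number of cells. *)
  pose H j (y : nat) : R := in_block R L (k r.1 j) (r.2 j) y * (4 ^ (L - k r.1 j))%:R ^+ 2.
  apply: (@le_trans _ _ (\sum_i (V / Nd * (2 * a)) ^+ 2 *
      \prod_j ((C i j < N)%N%:R * H j (C i j)))).
    apply: ler_sum => i _; rewrite !stepE -mulrBr.
    rewrite (_ : \prod_j _ = (\prod_j (in_block R L (k r.1 j) (r.2 j) (C i j) *
        (4 ^ (L - k r.1 j))%:R)) ^+ 2); last first.
      rewrite -prodrXl; apply: eq_bigr => j _.
      rewrite /H exprMn [in_block _ _ _ _ _ ^+ 2]in_block_idem.
      case: ltnP => [_|NC]; first by rewrite mul1r.
      rewrite [in_block _ _ _ _ _](_ : _ = 0) ?mul0r//.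
      rewrite /in_block (_ : _ == _ = false)//; apply/negbTE.
      rewrite neq_ltn; apply/orP; right; apply: leq_trans (rvj j) _.
      by rewrite /ancestor leq_divRL ?exp4_gt0// -expnD subnKC// ltnW.
    rewrite -exprMn -[X in X <= _](real_normK (num_real _)) ler_sqr ?nnegrE//.
    - rewrite normrM (ger0_norm VNd0) -[leRHS]mulrA.
      by apply: ler_wpM2l => //; exact: famC.
    - apply: mulr_ge0; first by apply: mulr_ge0 => //; exact: mulr_ge0.
      by apply: prodr_ge0 => j _; rewrite mulr_ge0 ?ler0n.
  rewrite -mulr_sumr (sum_block H).
  have -> : \prod_j \sum_(y < N) H j y = Q ^+ 3.
    rewrite -(prodQ r.1) -prodrXl; apply: eq_bigr => j _.
    by rewrite -mulr_suml sum_in_block// -exprS.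
  have -> : (V / Nd * (2 * a)) ^+ 2 * (W * Q ^+ 3) =
      4 * a ^+ 2 * V ^+ 2 * (W * Nd) / M ^+ 3.
    by rewrite QE; field; apply/andP; split; exact: lt0r_neq0.
  rewrite ler_pdivrMr ?exprn_gt0//.
  apply: (@le_trans _ _ (4 * a ^+ 2 * V ^+ 2 * n%:R)).
    by apply: ler_wpM2l W_le; rewrite mulr_ge0 ?sqr_ge0// mulr_ge0 ?sqr_ge0.
  by move: near; rewrite -/M; lra.
apply: le_trans (assouad s0 noise xcube G0 kappa0 good_step fambad orth norm extract close).
rewrite lee_fin (card_valid_par kL km) natrM -/M.
rewrite (_ : _ / 8 * _ = #|T|%:R * a ^+ 2 * V ^+ 2 / (8 * 320 ^+ d * M ^+ 2) *
    (W * Nd / n%:R)); last first.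
  rewrite /kappa /G QE (_ : 320 = 64 * 5 :> R) ?exprMn; last lra.
  rewrite (_ : 64 = 8 * 8 :> R) ?exprMn; last lra.
  by field; do ?[apply/andP; split]; rewrite ?expf_neq0 ?gt_eqF//.
rewrite (_ : 640 = 320 * 2 :> R) ?exprMn; last lra.
rewrite (_ : _ / (_ * _ * _) = #|T|%:R * a ^+ 2 * V ^+ 2 / (8 * 320 ^+ d * M ^+ 2) *
    (2 ^+ d)^-1); last first.
  by field; do ?[apply/andP; split]; rewrite ?expf_neq0 ?gt_eqF//.
apply: ler_wpM2l.
  apply: divr_ge0; first by do 2 (apply: mulr_ge0; last exact: sqr_ge0).
  by apply: mulr_ge0; [apply: mulr_ge0 => //; exact: exprn_ge0|exact: sqr_ge0].
rewrite ler_pdivlMr// mulrC ler_pdivrMr ?exprn_gt0// mulrC; exact: W_ge.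
Qed.

End grid_lower_bound.

(** * Random signs *)

Section rademacher.
Variable R : realType.

(** From exp(x) <= 1 / (1 - x) and (1 + x + 2 x^2) (1 - x) = 1 + x^2 (1 - 2 x) >= 1. *)
Lemma expR_quadratic (x : R) : x <= 1 / 2 -> expR x <= 1 + x + 2 * x ^+ 2.
Proof.
move=> x2; have xN : 0 < 1 - x by lra.
have : 1 - x <= (expR x)^-1 by rewrite -expRN; exact: expR_ge1Dx.
rewrite -[X in X <= _]invrK lef_pV2 ?posrE ?invr_gt0 ?expR_gt0// => h.
apply: (le_trans h); rewrite -[X in _ <= X]mulr1 -[X in _ <= _ * X](mulfV (lt0r_neq0 xN)) mulrA.
rewrite ler_peMl ?invr_ge0 ?(ltW xN)//.
rewrite (_ : _ * (1 - x) = 1 + x ^+ 2 * (1 - 2 * x)); last by ring.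
by rewrite lerDl mulr_ge0 ?sqr_ge0//; lra.
Qed.

Lemma expR_add_expRN (x : R) : `|x| <= 1 / 2 -> expR x + expR (- x) <= 2 * expR (2 * x ^+ 2).
Proof.
rewrite ler_norml => /andP[x1 x2].
have h1 := expR_quadratic x2; have h2 := @expR_quadratic (- x) _.
have {}h2 : expR (- x) <= 1 - x + 2 * x ^+ 2 by rewrite -(sqrrN x); apply: h2; lra.
have h3 := expR_ge1Dx (2 * x ^+ 2); lra.
Qed.

Lemma rademacher_mgf (I : finType) (b : I -> R) : (forall i, `|b i| <= 1 / 2) ->
  \sum_(e : {ffun I -> bool}) expR (\sum_i (-1) ^+ e i * b i) <=
  #|{ffun I -> bool}|%:R * expR (2 * \sum_i b i ^+ 2).
Proof.
move=> b2.
under eq_bigr do rewrite expR_sum.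
rewrite -(bigA_distr_bigA (fun i (t : bool) => expR ((-1) ^+ t * b i))) /=.
rewrite card_ffun card_bool natrX -prodr_const mulr_sumr expR_sum -big_split /=.
apply: ler_prod => i _; rewrite big_bool /= expr1 expr0 mulN1r mul1r addrC.
by rewrite addr_ge0 ?expR_ge0// expR_add_expRN.
Qed.

End rademacher.

Section linear_bad.
Context (R : realType) (d L : nat) (T : finType) (k : T -> 'I_d -> nat).
Local Notation N := (4 ^ L)%N.
Local Notation cell := {ffun 'I_d -> 'I_N}.
Local Notation par := (T * cell)%type.

Lemma haar_sqr j p x : @haar R L j p x ^+ 2 = in_block R L j p x.
Proof.
rewrite /haar exprMn [in_block _ _ _ _ _ ^+ 2]in_block_idem.
by rewrite -[haar_coef _ _ ^+ 2]real_normK ?num_real// normr_haar_coef_digit expr1n mulr1.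
Qed.

(** For each shape a cell lies in at most one box. *)
Lemma sum_par_haar_sqr (c : cell) : \sum_r par_haar R k r c ^+ 2 <= #|T|%:R.
Proof.
rewrite -[X in _ <= X%:R]sum1_card natr_sum.
rewrite -(pair_bigA _ (fun s (p : cell) => par_haar R k (s, p) c ^+ 2)) /=.
apply: ler_sum => s _.
rewrite (eq_bigr (fun p : cell => \prod_j in_block R L (k s j) (p j) (c j))); last first.
  by move=> p _; rewrite /par_haar /cell_prod -prodrXl; apply: eq_bigr => j _; rewrite haar_sqr.
rewrite -(bigA_distr_bigA (fun j (q : 'I_N) => in_block R L (k s j) q (c j))) /=.
apply: le_trans (_ : \prod_(j < d) 1 <= 1); last by rewrite big1.
apply: ler_prod => j _; rewrite sum_in_block_le1 andbT.
by apply: sumr_ge0 => q _; rewrite /in_block ler0n.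
Qed.

Lemma par_haar_le1 r (c : cell) : `|par_haar R k r c| <= 1.
Proof.
rewrite -(@ler_pXn2r _ 2)// ?nnegrE// expr1n real_normK ?num_real//.
rewrite /par_haar /cell_prod -prodrXl; apply: le_trans (_ : \prod_(j < d) 1 <= 1).
  apply: ler_prod => j _; rewrite haar_sqr /in_block ler0n /=.
  by case: (_ == _).
by rewrite big1.
Qed.

(** Chernoff's bound with parameter [l], then a union over the cells and over the two signs of the
    sum: 32 = 16 * 2. *)
Lemma linear_bad_card (a l : R) : 0 < a -> 0 < l <= 1 / 2 ->
  32 * (N ^ d)%:R * expR (2 * l ^+ 2 * #|T|%:R) <= expR (l / a) ->
  (16 * #|~: linear_good L k a| <= #|{ffun par -> bool}|)%N.
Proof.
move=> a0 /andP[l0 l2] key.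
pose E : R := expR (l / a); have E0 : 0 < E by exact: expR_gt0.
pose S (e : {ffun par -> bool}) (c : cell) := signed_sum R k e c.
pose FT : R := #|{ffun par -> bool}|%:R.
have mgf (c : cell) (s : R) : (s = 1 \/ s = -1) -> \sum_(e : {ffun par -> bool}) expR (s * (l * S e c)) <=
    FT * expR (2 * l ^+ 2 * #|T|%:R).
  move=> s1; have ss : s ^+ 2 = 1 by case: s1 => ->; rewrite ?sqrrN expr1n.
  rewrite (eq_bigr (fun e : {ffun par -> bool} =>
      expR (\sum_r (-1) ^+ e r * (s * (l * par_haar R k r c))))); last first.
    move=> e _; congr expR; rewrite /S /signed_sum mulr_sumr mulr_sumr.
    apply: eq_bigr => r _; move: ((-1) ^+ e r) (par_haar _ _ _ _) => A B; ring.
  apply: le_trans (rademacher_mgf _) _.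
    move=> r; rewrite normrM normrM (gtr0_norm l0).
    have -> : `|s| = 1 by case: s1 => ->; rewrite ?normrN normr1.
    rewrite (mul1r (l * _)); apply: (@le_trans _ _ (l * 1)); last by rewrite mulr1.
    by rewrite ler_pM2l// par_haar_le1.
  apply: ler_wpM2l; first by rewrite ler0n.
  rewrite ler_expR -mulrA ler_wpM2l//.
  rewrite (eq_bigr (fun r => l ^+ 2 * par_haar R k r c ^+ 2)); last first.
    by move=> r _; rewrite !exprMn ss mul1r.
  by rewrite -mulr_sumr ler_wpM2l ?sqr_ge0// sum_par_haar_sqr.
have markov (e : {ffun par -> bool}) : (e \in ~: linear_good L k a)%:R <=
    \sum_c (expR (1 * (l * S e c)) + expR (-1 * (l * S e c))) / E.
  have pos c : 0 <= (expR (1 * (l * S e c)) + expR (-1 * (l * S e c))) / E.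
    by rewrite divr_ge0 ?addr_ge0 ?expR_ge0// ltW.
  rewrite !finset.inE; case: (boolP [forall c, _]) => [_|].
    by apply: sumr_ge0.
  rewrite negb_forall => /existsP[c]; rewrite -ltNge => aS.
  rewrite (bigD1 c)//=; apply: ler_wpDr; first exact: sumr_ge0.
  rewrite ler_pdivlMr// mul1r mulN1r mul1r.
  have : E <= expR `|l * S e c|.
    rewrite ler_expR normrM (gtr0_norm l0) ler_pM2l// -[a^-1]mul1r ler_pdivrMr// mulrC.
    by move: aS; rewrite normrM (gtr0_norm a0) => /ltW.
  have := expR_ge0 (l * S e c); have := expR_ge0 (- (l * S e c)).
  by case: (ger0P (l * S e c)) => _; lra.
have bad_le : #|~: linear_good L k a|%:R <=
    (N ^ d)%:R * (2 * FT * expR (2 * l ^+ 2 * #|T|%:R) / E) :> R.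
  rewrite -sum1_card natr_sum big_mkcond /=.
  apply: (@le_trans _ _ (\sum_e \sum_c (expR (1 * (l * S e c)) + expR (-1 * (l * S e c))) / E)).
    by apply: ler_sum => e _; apply: le_trans (markov e); case: (_ \in _).
  have -> : (N ^ d)%:R = #|{: cell}|%:R :> R by rewrite card_ffun !card_ord.
  rewrite exchange_big /= (mulr_natl _ #|{: cell}|) -sumr_const; apply: ler_sum => c _.
  rewrite -mulr_suml; apply: ler_wpM2r; first by rewrite invr_ge0 ltW.
  rewrite big_split /= -mulrA mulr_natl mulr2n.
  by apply: lerD; apply: mgf; [left|right].
rewrite -(ler_nat R) natrM -/FT.
apply: (@le_trans _ _ (16 * ((N ^ d)%:R * (2 * FT * expR (2 * l ^+ 2 * #|T|%:R) / E)))).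
  exact: ler_wpM2l.
rewrite (_ : 16 * _ = FT * (32 * (N ^ d)%:R * expR (2 * l ^+ 2 * #|T|%:R)) / E); last first.
  by move: (N ^ d)%:R (expR (_ * _)) => A B; ring.
rewrite ler_pdivrMr//; apply: ler_wpM2l => //; exact: ler0n.
Qed.

End linear_bad.

(** * Choice of the level and rate *)

Lemma expR1_ge2 (R : realType) : 2 <= expR 1 :> R.
Proof. by have := expR_ge1Dx (1 : R); rewrite -mulr2n. Qed.

Lemma exprn_le_expR (R : realType) (n : nat) : 2 ^+ n <= expR n%:R :> R.
Proof.
by rewrite -[n%:R]mulr1 expRM_natl lerXn2r ?nnegrE ?expR_ge0 ?expR1_ge2.
Qed.

Lemma powR23_cube (R : realType) (x : R) : 0 <= x -> (x `^ (2 / 3)) ^+ 3 = x ^+ 2.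
Proof.
move=> x0; rewrite -powR_mulrn ?powR_ge0// -powRrM.
by rewrite (_ : 2 / 3 * 3%:R = 2%:R) ?powR_mulrn//; field.
Qed.

Section minimax_rate.
Context (R : realType) (d : nat) (cs : R).
Variables (beta K : nat -> R) (C0 c2 c3 : R) (E : nat) (Lam : R -> R).
Hypotheses (d0 : (0 < d)%N) (cs01 : 0 < cs <= 1).
Hypotheses (C01 : 1 <= C0) (c20 : 0 <= c2) (c30 : 0 < c3).
Hypothesis beta1 : forall t, (0 < t)%N -> 1 <= beta t.
Hypothesis betaS : forall t, (0 < t)%N -> beta t.+1 <= C0 * beta t.
Hypothesis beta_exp : forall t, (0 < t)%N -> beta t <= expR (c2 * t%:R).
Hypothesis K0 : forall t, (0 < t)%N -> 0 <= K t.
Hypothesis K_ge : forall t, (0 < t)%N -> c3 * t%:R ^+ E * beta t <= K t ^+ 3.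
(** [Lam] is the logarithmic factor of the rate, known through its cube so that one argument covers
    both rates. *)
Hypothesis Lam0 : forall l, 0 <= l -> 0 <= Lam l.
Hypothesis Lam3 : forall l, 0 <= l -> Lam l ^+ 3 = l ^+ E.

(* [beta t] is the inverse square of the amplitude and [K t] the number of shapes at
   level [t]; [Y t] is the signal-to-noise ratio [n V^2 / sigma^2]
   for which level [t] is the right one. *)
Let Y t : R := beta t * 64 ^+ (d ^ 2 * t).
(** [C0 * 64 ^+ (d ^ 2)] bounds the growth of [Y] from one level to the next; 8 is the factor in
    [8 * X]. *)
Let C1 : R := C0 * 64 ^+ (d ^ 2) * 8.

Let C1_gt0 : 0 < C1.
Proof. by rewrite !mulr_gt0 ?exprn_gt0// (lt_le_trans _ C01). Qed.

(** Take the smallest such level: [Y] is below [8 * X] at its predecessor, which is positive by the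
    hypothesis on [Y 1]. *)
Lemma exists_level (X : R) : Y 1 < 8 * X ->
  exists t, [/\ (0 < t)%N, 8 * X <= Y t & Y t <= C1 * X].
Proof.
move=> X1; have Y_unbounded : exists t, (0 < t)%N && (8 * X <= Y t).
  have [n nX] : exists n, 8 * X < n%:R.
    by exists (Num.bound (8 * X)); apply: le_lt_trans (archi_boundP _); rewrite ?ler_norm//;
      apply: ltW; apply: le_lt_trans X1; rewrite mulr_ge0 ?exprn_ge0// (le_trans _ (beta1 _)).
  exists n.+1 => /=; apply: (@le_trans _ _ (n.+1%:R)).
    by apply: (le_trans (ltW nX)); rewrite ler_nat.
  apply: (@le_trans _ _ (1 * 64 ^+ (d ^ 2 * n.+1))); last first.
    by rewrite ler_wpM2r ?exprn_ge0 ?beta1.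
  rewrite mul1r -natrX ler_nat; apply: (@leq_trans (64 ^ n.+1)).
    by rewrite ltnW// ltn_expl.
  by rewrite leq_exp2l// leq_pmull// expn_gt0 d0.
case: (ex_minnP Y_unbounded) => t /andP[t0 tX] tmin.
exists t; split => //.
case: t t0 tX tmin => [//|[|t]] _ tX tmin; first by move: X1; rewrite ltNge tX.
have Yt : Y t.+1 < 8 * X.
  by rewrite ltNge; apply/negP => h; have := tmin t.+1; rewrite /= h ltnn => /(_ isT).
apply: (@le_trans _ _ (C0 * 64 ^+ (d ^ 2) * Y t.+1)).
  rewrite /Y mulnS exprD [X in _ <= X](_ : _ =
    (C0 * beta t.+1) * (64 ^+ (d ^ 2) * 64 ^+ (d ^ 2 * t.+1))); last by ring.
  by rewrite ler_wpM2r ?mulr_ge0 ?exprn_ge0 ?betaS.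
rewrite [leRHS](_ : _ = (C0 * 64 ^+ (d ^ 2)) * (8 * X)); last by rewrite /C1; ring.
apply: ler_wpM2l; last exact: ltW.
by rewrite mulr_ge0 ?exprn_ge0// (le_trans _ C01).
Qed.

(** The logarithm of [Y t] is at most [c4 * t], [kappa0] is the constant of [grid_lower_bound], and
    [z] is what the cubed inequality of [rate_le] leaves over. *)
Let c4 : R := c2 + (6 * d ^ 2)%:R.
Let kappa0 : R := 8 * 640 ^+ d.
Let z : R := c3 / (c4 ^+ E * kappa0 ^+ 3 * C1 ^+ 2).

Let c4_gt0 : 0 < c4.
Proof. by rewrite ltr_wpDl// ltr0n muln_gt0 expn_gt0 d0. Qed.

Let z_gt0 : 0 < z.
Proof.
have k0 : 0 < kappa0 by rewrite mulr_gt0 ?exprn_gt0 ?ltr0n.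
apply: divr_gt0 => //; apply: mulr_gt0; last exact: exprn_gt0.
by apply: mulr_gt0; exact: exprn_gt0.
Qed.

Lemma level_ge_ln (X : R) t : (0 < t)%N -> 1 <= X -> 8 * X <= Y t ->
  ln (Num.sqrt X) <= c4 * t%:R.
Proof.
move=> t0 X1 XY; have X0 : 0 < X by lra.
have s1 : 1 <= Num.sqrt X by rewrite -[leLHS]sqrtr1; exact: ler_wsqrtr.
rewrite -[leRHS]expRK; rewrite ler_ln ?posrE ?expR_gt0 ?(lt_le_trans _ s1)//.
apply: (@le_trans _ _ X).
  by rewrite -{2}(sqr_sqrtr (ltW X0)) expr2 ler_peMl ?(le_trans _ s1).
apply: (@le_trans _ _ (Y t)); first by lra.
rewrite /Y /c4 mulrDl expRD; apply: ler_pM; rewrite ?exprn_ge0 ?beta_exp//.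
  by rewrite (le_trans _ (beta1 t0)).
rewrite (_ : 64 = 2 ^+ 6 :> R); last by rewrite -natrX.
by rewrite -exprM -natrM -mulnA; exact: exprn_le_expR.
Qed.

(* Cubing turns every real power of the rate into an integer power. *)
Lemma rate_le (V sigma n : R) t : 0 < V -> 0 < sigma -> 0 < n -> (0 < t)%N ->
  let X := n * V ^+ 2 / sigma ^+ 2 in
  1 <= X -> 8 * X <= Y t -> Y t <= C1 * X ->
  Num.min 1 z * (sigma ^+ 2 * V / n) `^ (2 / 3) * Lam (ln (V * Num.sqrt n / sigma)) <=
  K t * V ^+ 2 / (beta t * kappa0 * (4 ^+ (d ^ 2 * t)) ^+ 2).
Proof.
move=> V0 s0 n0 t0 X X1 XY YX.
have -> : V * Num.sqrt n / sigma = Num.sqrt X.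
  have -> : X = (V * Num.sqrt n / sigma) ^+ 2.
    by rewrite exprMn exprVn exprMn (sqr_sqrtr (ltW n0)) /X (mulrC n).
  by rewrite sqrtr_sqr ger0_norm// divr_ge0 ?mulr_ge0 ?sqrtr_ge0// ltW.
have l0 : 0 <= ln (Num.sqrt X).
  by rewrite ln_ge0// -[leLHS]sqrtr1; exact: ler_wsqrtr.
have lt := level_ge_ln t0 X1 XY.
set l := ln _ in l0 lt *.
have b1 := beta1 t0; have b0 : 0 < beta t by lra.
have D0 : 0 < 4 ^+ (d ^ 2 * t) :> R by exact: exprn_gt0.
set D : R := 4 ^+ (d ^ 2 * t) in D0 *.
have YE : Y t = beta t * D ^+ 3.
  have e64 : 64 = 4 ^+ 3 :> R by rewrite -natrX.
  by rewrite /Y /D e64 -!exprM mulnC.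
have k0 : 0 < kappa0 by rewrite mulr_gt0 ?exprn_gt0 ?ltr0n.
have m0 : 0 <= Num.min 1 z by rewrite le_min ler01 ltW.
have P0 : 0 <= sigma ^+ 2 * V / n by rewrite divr_ge0 ?mulr_ge0 ?sqr_ge0// ltW.
rewrite -(@ler_pXn2r _ 3)// ?nnegrE; last 2 first.
- by rewrite !mulr_ge0 ?powR_ge0// Lam0.
- apply: divr_ge0; first by rewrite mulr_ge0 ?sqr_ge0 ?K0.
  apply: mulr_ge0; last exact: sqr_ge0.
  exact: mulr_ge0 (ltW b0) (ltW k0).
rewrite exprMn [(Num.min 1 z * _) ^+ 3]exprMn powR23_cube// Lam3// [leRHS]expr_div_n.
apply: (@le_trans _ _ (z * (sigma ^+ 2 * V / n) ^+ 2 * (c4 * t%:R) ^+ E)).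
  apply: ler_pM.
  - by apply: mulr_ge0; [exact: exprn_ge0|exact: sqr_ge0].
  - exact: exprn_ge0.
  (* As [Num.min 1 z] is at most 1, its cube is at most itself, hence at most [z]: this avoids a
     cube root. *)
  - apply: ler_wpM2r; first exact: sqr_ge0.
    apply: (@le_trans _ _ (Num.min 1 z)); last by rewrite ge_min lexx orbT.
    by rewrite exprS ler_piMr// exprn_ile1// ge_min lexx.
  - by rewrite lerXn2r ?nnegrE// mulr_ge0// ltW.
rewrite ler_pdivlMr; last first.
  by rewrite exprn_gt0// mulr_gt0 ?exprn_gt0// mulr_gt0.
apply: (@le_trans _ _ ((c3 * t%:R ^+ E * beta t) * ((sigma ^+ 2 * V / n) ^+ 2 * (Y t / C1) ^+ 2))).
  rewrite YE /z [(c4 * _) ^+ E]exprMn le_eqVlt; apply/orP; left; apply/eqP.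
  have := lt0r_neq0 C1_gt0; have := lt0r_neq0 c4_gt0; have := lt0r_neq0 k0.
  move: (C1) (c4) (kappa0) => C1' c4' k' k'0 c4'0 C1'0.
  by field; rewrite k'0 C1'0 (gt_eqF n0) expf_neq0.
apply: (@le_trans _ _ (K t ^+ 3 * ((sigma ^+ 2 * V / n) ^+ 2 * X ^+ 2))).
  apply: ler_pM.
  - by apply: mulr_ge0; [apply: mulr_ge0; [exact: ltW|exact: exprn_ge0]|exact: ltW].
  - by apply: mulr_ge0; exact: sqr_ge0.
  - exact: K_ge.
  apply: ler_wpM2l; first exact: sqr_ge0.
  rewrite lerXn2r ?nnegrE//; last by rewrite ler_pdivrMr// mulrC.
    by rewrite divr_ge0 ?(ltW C1_gt0)// YE mulr_ge0 ?exprn_ge0// ltW.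
  by lra.
rewrite le_eqVlt; apply/orP; left; apply/eqP; rewrite /X.
by field; rewrite !gt_eqF.
Qed.

Hypothesis level_bound : forall (t : nat) (V sigma : R) (n : nat) (ns : 'I_d -> nat),
  (0 < t)%N -> 0 < V -> 0 < sigma -> n = (\prod_j ns j)%N ->
  (forall j, (4 ^ (2 * (d * t)).+1 <= ns j)%N) ->
  8 * V ^+ 2 * n%:R <= sigma ^+ 2 * (beta t * (4 ^+ (d ^ 2 * t)) ^+ 3) ->
  forall x : 'I_n -> 'I_d -> R, enumerates x (lattice R ns) ->
  forall (disp : measure_display) (Omega : measurableType disp)
    (P : probability Omega R) (xi : 'I_n -> {RV P >-> R}),
    iid_gaussian_noise sigma xi ->
    ((K t * V ^+ 2 / (beta t * kappa0 * (4 ^+ (d ^ 2 * t)) ^+ 2))%:E <=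
      minimax_risk_EM x xi V)%E.

Lemma minimax_rate : exists C : R, 0 < C /\
  exists N : R -> R, (forall r : R, 0 < r -> 0 < N r) /\
  forall (V sigma : R) (n : nat) (ns : 'I_d -> nat),
    0 < V -> 0 < sigma ->
    (forall j, (1 <= ns j)%N) -> n = (\prod_j ns j)%N ->
    (forall j, cs * n%:R `^ d%:R^-1 <= (ns j)%:R) ->
    N (sigma ^+ 2 / V ^+ 2) < n%:R ->
  forall x : 'I_n -> 'I_d -> R, enumerates x (lattice R ns) ->
  forall (disp : measure_display) (Omega : measurableType disp)
    (P : probability Omega R) (xi : 'I_n -> {RV P >-> R}),
    iid_gaussian_noise sigma xi ->
    ((C * (sigma ^+ 2 * V / n%:R) `^ (2 / 3) * Lam (ln (V * Num.sqrt n%:R / sigma)))%:E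
      <= minimax_risk_EM x xi V)%E.
Proof.
have /andP[cs0 cs1] := cs01.
have Y1 : 0 < Y 1 by rewrite /Y mulr_gt0 ?exprn_gt0// (lt_le_trans _ (beta1 _)).
exists (Num.min 1 z); split; first by rewrite lt_min ltr01 z_gt0.
(* The first summand makes the axes long enough for the grid, the second gives [Y 1 < X], the third
   [1 < X]. *)
pose Nr r := 64 ^+ d * C1 ^+ 2 / (r ^+ 2 * cs ^+ (3 * d)) + r * Y 1 + r.
have Nr1 r : 0 < r -> 0 <= 64 ^+ d * C1 ^+ 2 / (r ^+ 2 * cs ^+ (3 * d)).
  move=> r0; apply: divr_ge0; apply: mulr_ge0; try exact: sqr_ge0.
    by apply: exprn_ge0; rewrite ler0n.
  by apply: exprn_ge0; exact: ltW.
exists Nr; split.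
  by move=> r r0; rewrite /Nr ltr_wpDl// addr_ge0 ?Nr1// mulr_ge0// ltW.
move=> V sigma n ns V0 s0 ns1 nE nsE nN x xE disp Omega P xi noise.
have n0 : 0 < n%:R :> R by rewrite ltr0n nE prodn_gt0.
pose r := sigma ^+ 2 / V ^+ 2; have r0 : 0 < r by rewrite divr_gt0 ?exprn_gt0.
pose X : R := n%:R * V ^+ 2 / sigma ^+ 2.
have XE : X * r = n%:R by rewrite /X /r; field; rewrite !gt_eqF.
have rX u : r * u < n%:R -> u < X by rewrite -XE mulrC ltr_pM2r.
have [t1 t2] : r * Y 1 < n%:R /\ r * 1 < n%:R.
  move: nN; rewrite -/r /Nr; have := Nr1 _ r0; have : 0 < r * Y 1 by exact: mulr_gt0.
  by set u := (_ / _); set v := r * Y 1; split; lra.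
have X1 : 1 <= X by apply/ltW/rX.
have [t [t0 XY YX]] : exists t, [/\ (0 < t)%N, 8 * X <= Y t & Y t <= C1 * X].
  by apply: exists_level; have := rX _ t1; lra.
apply: le_trans (level_bound t0 V0 s0 nE _ _ xE noise).
- by rewrite lee_fin; exact: rate_le.
(* The power 3 d turns n^(1/d) into n^3 and the number of blocks into 64^d (64^(d^2 t))^2, which the
   bound on [Y t] compares with X^2. *)
- move=> j; rewrite -(ler_nat R) natrX -(@ler_pXn2r _ (3 * d)) ?muln_gt0 ?nnegrE ?exprn_ge0 ?ler0n//.
  apply: (@le_trans _ _ ((cs * n%:R `^ d%:R^-1) ^+ (3 * d))); last first.
    by rewrite lerXn2r ?nnegrE ?mulr_ge0 ?powR_ge0 ?ler0n// ltW.
  rewrite exprMn [(n%:R `^ _) ^+ _](_ : _ = n%:R ^+ 3); last first.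
    rewrite mulnC exprM -(powR_mulrn d) ?powR_ge0// -powRrM mulVf ?pnatr_eq0 -?lt0n//.
    by rewrite powRr1 ?ler0n.
  apply: (@le_trans _ _ (64 ^+ d * (C1 * X) ^+ 2)).
    have -> : (4 ^+ (2 * (d * t)).+1) ^+ (3 * d) = 64 ^+ d * (64 ^+ (d ^ 2 * t)) ^+ 2 :> R.
      have e64 : 64 = 4 ^+ 3 :> R by rewrite -natrX.
      by rewrite e64 -!exprM -exprD; congr (_ ^+ _); rewrite expnS expn1; ring.
    apply: ler_wpM2l; first by apply: exprn_ge0; rewrite ler0n.
    have D0 : 0 <= 64 ^+ (d ^ 2 * t) :> R by apply: exprn_ge0; rewrite ler0n.
    have DX : 64 ^+ (d ^ 2 * t) <= C1 * X.
      by apply: le_trans YX; rewrite /Y ler_peMl// beta1.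
    by rewrite lerXn2r// nnegrE// (le_trans D0).
  have : 64 ^+ d * C1 ^+ 2 / (r ^+ 2 * cs ^+ (3 * d)) <= n%:R.
    apply: ltW; apply: le_lt_trans nN; rewrite -/r /Nr -addrA lerDl.
    by rewrite addr_ge0 ?(ltW r0)// mulr_ge0// ltW.
  rewrite ler_pdivrMr; last by apply: mulr_gt0; exact: exprn_gt0.
  move=> h.
  rewrite exprMn mulrA; apply: le_trans (ler_wpM2r (sqr_ge0 X) h) _.
  by rewrite -XE le_eqVlt; apply/orP; left; apply/eqP; ring.
- move: XY; rewrite /X /Y (_ : 64 = 4 ^+ 3 :> R); last by rewrite -natrX.
  rewrite -exprM (mulnC 3) exprM mulrA ler_pdivrMr ?exprn_gt0// (mulrC (sigma ^+ 2)).
  by rewrite [8 * V ^+ 2 * _](_ : _ = 8 * (n%:R * V ^+ 2))//; ring.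
Qed.

End minimax_rate.

(** * Shapes in general dimension, and the two rates *)

Section shapes.
Variables (d' t : nat).
Local Notation d := d'.+1.

(* Levels are shifted away from [d * t] in all coordinates but the last, which
   compensates, so that all boxes have the same volume. *)
Definition shape_level (s : {ffun 'I_d' -> 'I_t}) (j : 'I_d) : nat :=
  if unlift ord_max j is Some i then (d * t - s i)%N else (d * t + \sum_i s i)%N.

Let shape_le (s : {ffun 'I_d' -> 'I_t}) i : (s i <= d * t)%N.
Proof. by rewrite (leq_trans (ltnW (ltn_ord (s i))))// leq_pmull. Qed.

Lemma shape_level_lt s j : (shape_level s j < (2 * (d * t)).+1)%N.
Proof.
rewrite ltnS /shape_level; case: unliftP => [i|] _.
  by rewrite (leq_trans (leq_subr _ _))// leq_pmull.
rewrite mul2n -addnn leq_add2l.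
apply: (@leq_trans (\sum_(i < d') t)).
  by apply: leq_sum => i _; exact: ltnW.
by rewrite sum_nat_const card_ord leq_mul2r leqnSn orbT.
Qed.

Lemma sum_shape_level s : (\sum_j shape_level s j = d * (d * t))%N.
Proof.
rewrite (bigD1_ord ord_max)//= /shape_level unlift_none.
rewrite [X in (_ + X)%N](eq_bigr (fun i => d * t - s i)%N) => [|i _]; last by rewrite liftK.
rewrite sumnB => [|i _]; last exact: shape_le.
rewrite sum_nat_const card_ord (mulSn d' (d * t)).
have : (\sum_(i < d') s i <= \sum_(i < d') d * t)%N.
  by apply: leq_sum => i _; exact: shape_le.
rewrite sum_nat_const card_ord.
by move: (\sum_(i < d') _)%N (d' * (d * t))%N (d * t)%N => S M D SM; lia.
Qed.

Lemma shape_level_inj s s' : shape_level s =1 shape_level s' -> s = s'.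
Proof.
move=> ss'; apply/ffunP => i; apply/val_inj => /=.
have := ss' (lift ord_max i); rewrite /shape_level liftK.
by have := shape_le s i; have := shape_le s' i; move: (d * t)%N => D; lia.
Qed.

End shapes.

Lemma le_expR_nat (R : realType) (n : nat) : n%:R <= expR n%:R :> R.
Proof. by have := expR_ge1Dx (n%:R : R); lra. Qed.

Lemma box_count_le (d t : nat) : (0 < d)%N -> (0 < t)%N ->
  ((4 ^ (2 * (d * t)).+1) ^ d <= 2 ^ (6 * d ^ 2 * t))%N.
Proof.
move=> d0 t0; rewrite -[4%N]/(2 ^ 2)%N -!expnM leq_exp2l//.
have dt : (d <= d * (d * t))%N by rewrite leq_pmulr// muln_gt0 d0.
rewrite expnS expn1 -!mulnA (_ : 2 * _ = 4 * (d * (d * t)) + 2 * d)%N; last first.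
  by rewrite -[(2 * (d * t)).+1]addn1; ring.
by move: (d * (d * t))%N dt => D dD; clear -dD; lia.
Qed.

Lemma minimax_rate_general (R : realType) (d : nat) (cs : R) : (2 <= d)%N -> 0 < cs <= 1 ->
  exists C : R, 0 < C /\
    exists N : R -> R, (forall r : R, 0 < r -> 0 < N r) /\
    forall (V sigma : R) (n : nat) (ns : 'I_d -> nat),
      0 < V -> 0 < sigma ->
      (forall j, (1 <= ns j)%N) -> n = (\prod_j ns j)%N ->
      (forall j, cs * n%:R `^ d%:R^-1 <= (ns j)%:R) ->
      N (sigma ^+ 2 / V ^+ 2) < n%:R ->
    forall x : 'I_n -> 'I_d -> R, enumerates x (lattice R ns) ->
    forall (disp : measure_display) (Omega : measurableType disp)
      (P : probability Omega R) (xi : 'I_n -> {RV P >-> R}),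
      iid_gaussian_noise sigma xi ->
      ((C * (sigma ^+ 2 * V / n%:R) `^ (2 / 3)
          * ln (V * Num.sqrt n%:R / sigma) `^ (2 * (d%:R - 2) / 3))%:E
        <= minimax_risk_EM x xi V)%E.
Proof.
case: d => [//|d'] d2 cs01; set d := d'.+1.
(* For [t >= 1] this gives 5 + 6 d^2 t + 1 <= A t / 2, where 5 accounts for the 32, 6 d^2 t for the
   number of cells and 1 for the exponential moment. *)
pose a : nat := (12 * d ^ 2 + 12)%N; pose A : R := a%:R.
have A0 : 0 < A by rewrite ltr0n addn_gt0 orbT.
have A1 : 1 <= A by rewrite ler1n addn_gt0 orbT.
pose beta (t : nat) : R := A ^+ 2 * t%:R ^+ d.+1.
pose K (t : nat) : R := t%:R ^+ d'.
have tR0 t : (0 < t)%N -> (1 : R) <= t%:R by rewrite ler1n.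
apply: (@minimax_rate R d cs beta K (2 ^+ d.+1) (A ^+ 2 + d.+1%:R) (A ^- 2) (2 * (d - 2))
  (fun l => l `^ (2 * (d%:R - 2) / 3))) => //.
- by apply: exprn_ege1; rewrite ler1n.
- by rewrite addr_ge0 ?sqr_ge0.
- by rewrite invr_gt0 exprn_gt0.
- by move=> t t0; rewrite mulr_ege1 ?exprn_ege1 ?tR0.
- move=> t t0; rewrite /beta [leRHS]mulrCA; apply: ler_wpM2l; first exact: sqr_ge0.
  rewrite -exprMn lerXn2r ?nnegrE ?mulr_ge0 ?ler0n//.
  by rewrite -natrM ler_nat; lia.
- move=> t t0; rewrite /beta mulrDl expRD; apply: ler_pM; rewrite ?sqr_ge0 ?exprn_ge0 ?ler0n//.
    rewrite /A -natrX -natrM; apply: le_trans (le_expR_nat _ _).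
    by rewrite ler_nat leq_pmulr.
  by rewrite expRM_natl lerXn2r ?nnegrE ?expR_ge0 ?ler0n ?le_expR_nat.
- by move=> t t0; rewrite exprn_ge0 ?ler0n.
(* The cube of the number of shapes over [beta] has exponent 3 (d - 1) - (d + 1) = 2 (d - 2). *)
- move=> t t0; rewrite /K /beta le_eqVlt; apply/orP; left; apply/eqP.
  rewrite -exprM mulrAC mulrA mulVf ?expf_neq0 ?gt_eqF// mul1r -exprD.
  by congr (_ ^+ _); rewrite /d in d2 *; lia.
- by move=> l l0; rewrite powR_ge0.
- move=> l l0; rewrite -powR_mulrn ?powR_ge0// -powRrM -powR_mulrn//; congr (_ `^ _).
  by rewrite natrM natrB//; field.
move=> t V sigma n ns t0 V0 s0 nE nsE near x xE disp Omega P xi noise.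
have t1 := tR0 _ t0.
pose r : R := Num.sqrt (t%:R ^+ d').
have r2 : r ^+ 2 = t%:R ^+ d' by rewrite sqr_sqrtr ?exprn_ge0 ?ler0n.
have r1 : 1 <= r by rewrite -[leLHS]sqrtr1; apply: ler_wsqrtr; exact: exprn_ege1.
have r0 : 0 < r by lra.
(* As [r] is the root of the number of shapes, l = 1 / (2 r) keeps 2 l^2 [#|T|] at 1 / 2, while l /
   al = A t / 2 outgrows the logarithm of the number of cells. *)
pose al : R := (A * t%:R * r)^-1.
have al0 : 0 < al by rewrite invr_gt0 !mulr_gt0// ltr0n.
have al2 : al ^+ 2 = (beta t)^-1.
  by rewrite /al /beta exprVn !exprMn r2 -mulrA -exprD.
have kL := @shape_level_lt d' t; have kinj := @shape_level_inj d' t.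
have b0 : 0 < beta t by rewrite mulr_gt0 ?exprn_gt0// ltr0n.
have half : 0 < (2 * r)^-1 <= 1 / 2.
  rewrite invr_gt0 mulr_gt0//= mul1r lef_pV2 ?posrE ?mulr_gt0//.
  by rewrite -[leLHS]mulr1 ler_pM2l.
have key : 32 * ((4 ^ (2 * (d * t)).+1) ^ d)%:R *
    expR (2 * (2 * r)^-1 ^+ 2 * #|{ffun 'I_d' -> 'I_t}|%:R) <= expR ((2 * r)^-1 / al).
  have -> : #|{ffun 'I_d' -> 'I_t}|%:R = r ^+ 2 by rewrite card_ffun !card_ord natrX r2.
  rewrite (_ : 2 * _ ^+ 2 * r ^+ 2 = 1 / 2); last by field; rewrite gt_eqF.
  rewrite (_ : (2 * r)^-1 / al = A * t%:R / 2); last first.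
    by rewrite /al; field; rewrite !gt_eqF// ltr0n.
  have e5 : 32 <= expR 5%:R :> R by apply: le_trans (exprn_le_expR _ _); rewrite -natrX.
  have eN : ((4 ^ (2 * (d * t)).+1) ^ d)%:R <= expR (6 * d ^ 2 * t)%:R :> R.
    apply: le_trans (exprn_le_expR _ _); rewrite -natrX ler_nat.
    exact: box_count_le.
  have e1 : expR (1 / 2) <= expR 1 :> R by rewrite ler_expR; lra.
  apply: (@le_trans _ _ (expR 5%:R * expR (6 * d ^ 2 * t)%:R * expR 1)).
    by apply: ler_pM; rewrite ?expR_ge0 ?mulr_ge0 ?ler0n//; apply: ler_pM; rewrite ?ler0n.
  rewrite -!expRD ler_expR [(6 * d ^ 2 * t)%:R]natrM (natrM R 6) /A /a natrD (natrM R 12).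
  by move: (d ^ 2)%:R t%:R t1 => D T T1; lra.
have bad := @linear_bad_card R d (2 * (d * t)).+1 _ (@shape_level d' t) al _ al0 half key.
have fam := linear_grid_family kL (ltn0Sn d') (ltW al0) kinj bad.
have mE : (4 ^ (d * (d * t)))%:R = 4 ^+ (d ^ 2 * t) :> R.
  by rewrite natrX expnS expn1 mulnA.
have mdL : (d * (d * t) <= d * (2 * (d * t)).+1)%N.
  by rewrite leq_mul2l orbC (leq_trans _ (leqnSn _))// leq_pmull.
have nearm : 8 * al ^+ 2 * V ^+ 2 * n%:R <= sigma ^+ 2 * (4 ^ (d * (d * t)))%:R ^+ 3.
  rewrite mE al2 (_ : _ * n%:R = (8 * V ^+ 2 * n%:R) / beta t); last by ring.
  by rewrite ler_pdivrMr// -[leRHS]mulrA (mulrC _ (beta t)).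
have := grid_lower_bound s0 V0 (ltW al0) nE xE noise kL (@sum_shape_level d' t) mdL
  kinj fam nsE nearm.
apply: le_trans; rewrite lee_fin mE al2 card_ffun !card_ord natrX -/(K t).
set k0 := 8 * 640 ^+ d; set D := 4 ^+ (d ^ 2 * t).
rewrite le_eqVlt; apply/orP; left; apply/eqP.
by rewrite -(mulrA (beta t)) invfM; move: (beta t)^-1 (k0 * _)^-1 (K t) => X Y Z; ring.
Qed.

(** Amplitude 1 makes [beta] constant. With L' = 4 t there are 4 t + 1 shapes, whose cube gives the
    third power of the logarithm, hence its first power in the rate. *)
Lemma minimax_rate_2 (R : realType) (cs : R) : 0 < cs <= 1 ->
  exists C : R, 0 < C /\
    exists N : R -> R, (forall r : R, 0 < r -> 0 < N r) /\
    forall (V sigma : R) (n : nat) (ns : 'I_2 -> nat),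
      0 < V -> 0 < sigma ->
      (forall j, (1 <= ns j)%N) -> n = (\prod_j ns j)%N ->
      (forall j, cs * n%:R `^ 2%:R^-1 <= (ns j)%:R) ->
      N (sigma ^+ 2 / V ^+ 2) < n%:R ->
    forall x : 'I_n -> 'I_2 -> R, enumerates x (lattice R ns) ->
    forall (disp : measure_display) (Omega : measurableType disp)
      (P : probability Omega R) (xi : 'I_n -> {RV P >-> R}),
      iid_gaussian_noise sigma xi ->
      ((C * (sigma ^+ 2 * V / n%:R) `^ (2 / 3)
          * ln (V * Num.sqrt n%:R / sigma))%:E
        <= minimax_risk_EM x xi V)%E.
Proof.
move=> cs01.
apply: (@minimax_rate R 2 cs (fun=> 1) (fun t => (2 * (2 * t)).+1%:R) 1 0 1 3 (fun l => l)) => //.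
- by move=> t _; rewrite mulr1.
- by move=> t _; rewrite mul0r expR0.
- move=> t _; rewrite mul1r mulr1 lerXn2r ?nnegrE ?ler0n// ler_nat; lia.
move=> t V sigma n ns t0 V0 s0 nE nsE near x xE disp Omega P xi noise.
have mE : (4 ^ (2 * (2 * t)))%:R = 4 ^+ (2 ^ 2 * t) :> R by rewrite natrX mulnA.
have kL := @level2_lt (2 * (2 * t)).
have := grid_lower_bound (a := 1) s0 V0 ler01 nE xE noise kL (@sum_level2 (2 * (2 * t))) _
  (@level2_inj (2 * (2 * t))) (riesz_grid_family R (2 * (2 * t))) nsE _.
rewrite mE card_ord expr1n !mulr1 !mul1r; apply; first by lia.
by move: near; rewrite mul1r.
Qed.

Theorem theorem4p2 (R : realType) :
  (forall (d : nat) (cs : R), (2 <= d)%N -> 0 < cs <= 1 ->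
    exists C : R, 0 < C /\
    exists N : R -> R, (forall r : R, 0 < r -> 0 < N r) /\
    forall (V sigma : R) (n : nat) (ns : 'I_d -> nat),
      0 < V -> 0 < sigma ->
      (forall j, (1 <= ns j)%N) -> n = (\prod_j ns j)%N ->
      (forall j, cs * n%:R `^ d%:R^-1 <= (ns j)%:R) ->
      N (sigma ^+ 2 / V ^+ 2) < n%:R ->
    forall x : 'I_n -> 'I_d -> R, enumerates x (lattice R ns) ->
    forall (disp : measure_display) (Omega : measurableType disp)
      (P : probability Omega R) (xi : 'I_n -> {RV P >-> R}),
      iid_gaussian_noise sigma xi ->
      ((C * (sigma ^+ 2 * V / n%:R) `^ (2 / 3)
          * ln (V * Num.sqrt n%:R / sigma) `^ (2 * (d%:R - 2) / 3))%:E
        <= minimax_risk_EM x xi V)%E)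
  /\
  (forall cs : R, 0 < cs <= 1 ->
    exists C : R, 0 < C /\
    exists N : R -> R, (forall r : R, 0 < r -> 0 < N r) /\
    forall (V sigma : R) (n : nat) (ns : 'I_2 -> nat),
      0 < V -> 0 < sigma ->
      (forall j, (1 <= ns j)%N) -> n = (\prod_j ns j)%N ->
      (forall j, cs * n%:R `^ 2%:R^-1 <= (ns j)%:R) ->
      N (sigma ^+ 2 / V ^+ 2) < n%:R ->
    forall x : 'I_n -> 'I_2 -> R, enumerates x (lattice R ns) ->
    forall (disp : measure_display) (Omega : measurableType disp)
      (P : probability Omega R) (xi : 'I_n -> {RV P >-> R}),
      iid_gaussian_noise sigma xi ->
      ((C * (sigma ^+ 2 * V / n%:R) `^ (2 / 3)
          * ln (V * Num.sqrt n%:R / sigma))%:E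
        <= minimax_risk_EM x xi V)%E).
Proof.
by split=> [d cs d2|cs] cs01; [exact: minimax_rate_general|exact: minimax_rate_2].
Qed.
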